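(* Let $\theta=7/64$. There exists a fixed unbounded subset $\mathcal N\subset\mathbb N$ such that for every sequence of positive numbers $\{y_n\}_{n\in\mathbb N}$ satisfying $y_n\ll n^{-2+4\theta}$, and for Lebesgue-almost every $x\in\mathbb R/\mathbb Z$, both $\delta_{n,x,y_n}$ and $\delta^{\rm pr}_{n,x,y_n}$ converge weakly to $\mu_{\mathcal M}$ as $n\to\infty$ along $n\in\mathcal N$.
   Context: $\mathcal M=\Gamma\backslash\mathbb H$ with $\Gamma=\mathrm{SL}_2(\mathbb Z)$; $\mu_{\mathcal M}$ is the normalized hyperbolic area $\frac3\pi\frac{dx\,dy}{y^2}$. $\delta_{n,x,y}=\frac1n\sum_{j=0}^{n-1}\delta_{\Gamma(x+j/n+iy)}$ and $\delta^{\rm pr}_{n,x,y}=\frac1{\varphi(n)}\sum_{j\in(\mathbb Z/n\mathbb Z)^\times}\delta_{\Gamma(x+j/n+iy)}$ are probability measures on $\mathcal M$. *)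

(* Defs.v *)
From HB Require Import structures.
From mathcomp Require Import all_boot all_order all_algebra.
From mathcomp Require Import all_classical all_reals all_analysis.
Set Implicit Arguments. Unset Strict Implicit. Unset Printing Implicit Defensive.
Import Order.TTheory GRing.Theory Num.Theory.
Import numFieldNormedType.Exports.
Local Open Scope classical_set_scope.
Local Open Scope ring_scope.

Definition upper_half (R : realType) : set (R * R) := [set z | 0 < z.2].

(* The Moebius action of [[a, b], [c, d]] in SL_2(Z) on H:
   (a z + b)/(c z + d), written in real coordinates. *)
Definition moebius (R : realType) (a b c d : int) (z : R * R) : R * R :=
  let x := z.1 in let y := z.2 in
  let den := (c%:~R * x + d%:~R) ^+ 2 + (c%:~R * y) ^+ 2 in
  (((a%:~R * x + b%:~R) * (c%:~R * x + d%:~R) + a%:~R * c%:~R * y ^+ 2) / den,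
   y / den).

(* f : H -> R is the lift of a bounded continuous function on
   M = SL_2(Z)\H (quotient topology), i.e. f is bounded and continuous on H
   and SL_2(Z)-invariant. *)
Definition test_fun (R : realType) (f : R * R -> R) : Prop :=
  {within @upper_half R, continuous f} /\
  (exists M : R, forall z, @upper_half R z -> `|f z| <= M) /\
  (forall (a b c d : int) z, a * d - b * c = 1 -> @upper_half R z ->
     f (moebius a b c d z) = f z).

Definition fund_dom (R : realType) : set (R * R) :=
  [set z | `|z.1| <= 2^-1 /\ 1 <= z.1 ^+ 2 + z.2 ^+ 2 /\ 0 < z.2].

(* \int_M f d mu_M, with mu_M = (3/pi) dx dy / y^2 (normalized area),
   computed on the fundamental domain. *)
Definition int_muM (R : realType) (f : R * R -> R) : R :=
  (3 / pi) * fine (\int[(@lebesgue_measure R \x @lebesgue_measure R)%E]_(z in @fund_dom R)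
                     ((f z / z.2 ^+ 2)%:E))%E.

Definition int_delta (R : realType) (n : nat) (x y : R) (f : R * R -> R) : R :=
  n%:R^-1 * \sum_(j < n) f (x + j%:R / n%:R, y).

Definition int_delta_pr (R : realType) (n : nat) (x y : R) (f : R * R -> R) : R :=
  (totient n)%:R^-1 * \sum_(j < n | coprime j n) f (x + j%:R / n%:R, y).

Definition cvg_along (R : realType) (N : set nat) (u : nat -> R) (L : R) : Prop :=
  forall e : R, 0 < e -> exists n0 : nat, forall n, N n -> (n0 <= n)%N -> `|u n - L| < e.

Definition theta (R : realType) : R := 7 / 64.

(* Main.v *)
(** The set is [N = {2 ^ k_j}] for a sufficiently sparse sequence [k_j].
    Put [U f (z) = (f (z / 2) + f ((z + 1) / 2)) / 2]; then
    [delta_{2^k, x, y} (f) = (U^k f) (2^k (x + i y))], and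
    [U^k f (z) = w_k z - w_{k-1} (2 z) / 2], where [w_k] is the modular function
    obtained by applying the Hecke operator of index [2 ^ k] to [f].
    For [f] of mean zero, the self-adjointness of the Hecke operator at 2 makes
    the sum over [k] of the mean square variation of [w_k] over the three Hecke
    neighbours of a point telescope, so this variation tends to 0.  Uniform
    continuity turns this into [w_k (z) - w_k (z') -> 0] whenever [z] and [z']
    are joined by Hecke correspondences and modular transformations, hence, by
    density of such points, for all [z] and [z'], and the mean being zero,
    [w_k -> 0] locally uniformly.  Long closed horocycles spend little time high
    in the cusp, so [delta_{2^k, x, y} (f)] tends to the mean of [f] in
    [L^1 (dx)], uniformly in [y] as long as [2 ^ k * y] stays bounded.  Since
    [-2 + 4 theta <= -1], this covers the heights [y_n], and a sparse choice of
    [k_j] that does not depend on [y_n] gives almost everywhere convergence for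
    a countable family of functions which suffices for weak convergence.
    Finally [delta^pr_{2^k} = 2 delta_{2^k} - delta_{2^{k-1}}]. *)
Require Import Defs.
From HB Require Import structures.
From mathcomp Require Import all_boot all_order all_algebra.
From mathcomp Require Import all_classical all_reals all_analysis.
From mathcomp Require Import measurable_realfun.
From mathcomp Require Import ring lra zify.
Set Implicit Arguments. Unset Strict Implicit. Unset Printing Implicit Defensive.
Import Order.TTheory GRing.Theory Num.Theory.
Import numFieldNormedType.Exports.
Local Open Scope classical_set_scope.
Local Open Scope ring_scope.

(** * Invariance of the hyperbolic area *)

(** Working with powers of a single prime lets a three-term recursion replace spectral theory: no
    bound towards the Ramanujan conjecture is used, only that the Hecke operator is symmetric and
    commutes with the modular action. Symmetry is proved by unfolding over integer matrices of
    determinant 2, where passing to the adjugate exchanges the two functions. The order of the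
    quantifiers shapes the rest. [N] is fixed before the heights and before the implied constant, so
    the [L^1] estimate may depend on [y] only through a bound for [2 ^ k * y]; stage [j] of the
    construction admits the bound [j], which eventually exceeds any constant. The null set is fixed
    before the test function, yet bounded continuous functions on a noncompact space are neither
    separable nor uniformly continuous, and the decay argument needs uniform continuity. Both
    defects are avoided by testing positive normalised functionals only from below, on finite maxima
    of rational bumps: these are countable in number, uniformly continuous for the invariant
    distance, and exhaust the mean of any nonnegative test function. *)

Section line_integrals.
Context (R : realType).
Local Notation mu := (@lebesgue_measure R).
Implicit Types (F : R -> \bar R) (a k : R).

Lemma measurable_addr a : measurable_fun [set: R] (fun x : R => x + a).
Proof. by apply: measurable_realfun.measurable_funD => //; exact: measurable_cst. Qed.

Lemma ge0_integral_shift F a : measurable_fun [set: R] F -> (forall x, 0 <= F x)%E ->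
  (\int[mu]_x F (x + a)%R = \int[mu]_x F x)%E.
Proof.
move=> mF F0.
pose h := (fun x => x + a) : measurableTypeR R -> measurableTypeR R.
have mh : measurable_fun [set: R] h by exact: measurable_addr.
pose H := HB.pack_for {mfun measurableTypeR R >-> measurableTypeR R} h
  (@isMeasurableFun.Build _ _ _ _ h mh).
have -> : (\int[mu]_x F (x + a)%R = \int[mu]_(x in H @^-1` setT) (F \o H) x)%E by [].
rewrite -(@ge0_integral_pushforward _ _ _ _ _ H)//.
apply: eq_measure_integral => A mA _; apply/esym/lebesgue_measure_unique => //=.
move=> _ [[c d]] _ <-; rewrite /pushforward.
have -> : h @^-1` `]c, d]%classic = `]c - a, d - a]%classic.
  by apply/seteqP; split => x /=; rewrite /h !in_itv/= ltrBlDr lerBrDr.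
rewrite !lebesgue_measure_itv/= !lte_fin ltrD2r.
by case: ifP => // _; rewrite -!EFinD; congr EFin; ring.
Qed.

Lemma ge0_integral_opp F : measurable_fun [set: R] F -> (forall x, 0 <= F x)%E ->
  (\int[mu]_x F (- x)%R = \int[mu]_x F x)%E.
Proof.
move=> mF F0.
have -> : (\int[mu]_x F (- x)%R = \int[mu]_(x in (-%R : _ -> measurableTypeR R) @^-1` setT) (F \o -%R) x)%E by [].
rewrite -ge0_integral_pushforward//.
by apply: eq_measure_integral => A mA _; apply: lebesgue_measureN.
Qed.

Lemma ge0_integral_scale F k : 0 < k -> measurable_fun [set: R] F ->
  (forall x, 0 <= F x)%E ->
  (\int[mu]_x F (k * x)%R = (k^-1)%:E * \int[mu]_x F x)%E.
Proof.
move=> k0 mF F0.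
pose h := (fun x => k * x) : measurableTypeR R -> measurableTypeR R.
have mh : measurable_fun [set: R] h by exact: mulrl_measurable.
pose H := HB.pack_for {mfun measurableTypeR R >-> measurableTypeR R} h
  (@isMeasurableFun.Build _ _ _ _ h mh).
have -> : (\int[mu]_x F (k * x)%R = \int[mu]_(x in H @^-1` setT) (F \o H) x)%E by [].
rewrite -(@ge0_integral_pushforward _ _ _ _ _ H)//.
have kV : 0 <= k^-1 by rewrite invr_ge0 ltW.
pose K := NngNum kV.
rewrite -[k^-1]/(K%:num) -ge0_integral_mscale//.
apply: eq_measure_integral => A mA _.
have [nu nu_def] : exists nu : {measure set (measurableTypeR R) -> \bar R},
    forall A, nu A = (k%:E * mu (h @^-1` A))%E.
  by unshelve eexists (mscale (NngNum (ltW k0)) (pushforward mu h)).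
have nuE : forall A, measurable A -> mu A = nu A.
  apply: lebesgue_measure_unique => _ [[c d]] _ <-; rewrite nu_def.
  have -> : h @^-1` `]c, d]%classic = `]k^-1 * c, k^-1 * d]%classic.
    apply/seteqP; split => x /=; rewrite /h !in_itv/=.
      by rewrite !(mulrC k^-1) ltr_pdivrMr// ler_pdivlMr// (mulrC x).
    by rewrite !(mulrC k^-1) ltr_pdivrMr// ler_pdivlMr// (mulrC x).
  rewrite !lebesgue_measure_itv/= !lte_fin ltr_pM2l ?invr_gt0//.
  case: ifP => // _; last by rewrite mule0.
  rewrite -!EFinD -EFinM; congr EFin; field; exact: lt0r_neq0.
change (mu (h @^-1` A) = (k^-1)%:E * mu A)%E.
rewrite (nuE A mA) nu_def muleA -EFinM mulVf ?mul1e//.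
exact: lt0r_neq0.
Qed.

Lemma measurable_invr : measurable_fun [set: R] (fun x : R => x^-1).
Proof.
have mN0 : measurable (~` [set 0] : set R) by apply: measurableC; exact: measurable_set1.
have -> : [set: R] = [set 0] `|` ~` [set 0] by rewrite setUv.
apply/measurable_funU => //; split.
  by apply: measurable_fun_set1.
apply: open_continuous_measurable_fun.
  by apply: closed_openC; exact: closed_eq.
by move=> x; rewrite inE /= => /eqP x0; exact: inv_continuous.
Qed.

Definition inv_density (y : R) : R := if 0 < y then y ^- 2 else 0.

Lemma inv_density_ge0 y : 0 <= inv_density y.
Proof. by rewrite /inv_density; case: ifP => // y0; rewrite invr_ge0 exprn_ge0// ltW. Qed.

Lemma measurable_inv_density : measurable_fun [set: R] inv_density.
Proof.
apply: measurable_fun_ifT => //=.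
  exact: measurable_fun_ltr.
apply: (measurableT_comp measurable_invr).
exact: exprn_measurable.
Qed.

Definition inv_measure (A : set (measurableTypeR R)) : \bar R :=
  (\int[mu]_(y in A) (inv_density y)%:E)%E.

Let inv_measure0 : inv_measure set0 = 0%E.
Proof. by rewrite /inv_measure integral_set0. Qed.

Let inv_measure_ge0 A : (0 <= inv_measure A)%E.
Proof. by rewrite integral_ge0// => y _; rewrite lee_fin inv_density_ge0. Qed.

Let inv_measure_sigma : semi_sigma_additive inv_measure.
Proof.
move=> /= F mF tF mUF; rewrite /inv_measure; apply: cvg_toP.
  apply: ereal_nondecreasing_is_cvgn => m n mn.
  apply: lee_sum_nneg_natr => // k _ _; apply: integral_ge0 => /= x Fkx.
  by rewrite lee_fin inv_density_ge0.
rewrite ge0_integral_bigcup//=.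
- apply/measurable_funTS/measurable_EFinP.
  exact: measurable_inv_density.
- by move=> x _; rewrite lee_fin inv_density_ge0.
Qed.

HB.instance Definition _ := isMeasure.Build _ _ _
  inv_measure inv_measure0 inv_measure_ge0 inv_measure_sigma.

Let m1 : {measure set (measurableTypeR R) -> \bar R} := inv_measure.

Import HBNNSimple.

Lemma integral_inv_measure F : measurable_fun [set: R] F -> (forall x, 0 <= F x)%E ->
  (\int[m1]_x F x = \int[mu]_x (F x * (inv_density x)%:E))%E.
Proof.
move=> mF F0.
pose f_ := @nnsfun_approx _ (measurableTypeR R) R setT measurableT F mF.
have cf_ x : (f_ n x)%:E @[n --> \oo] --> F x by exact: cvg_nnsfun_approx.
have nd x : nondecreasing_seq (fun n => (f_ n x)%:E).
  by move=> m n mn; rewrite lee_fin; exact/lefP/nd_nnsfun_approx.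
have mw : measurable_fun [set: R] (fun x => (inv_density x)%:E).
  by apply/measurable_EFinP; exact: measurable_inv_density.
have w0 x : (0 <= (inv_density x)%:E)%E by rewrite lee_fin inv_density_ge0.
transitivity (limn (fun n => \int[m1]_x (f_ n x)%:E))%E.
  rewrite -monotone_convergence//.
  - by apply: eq_integral => x _; apply/esym/cvg_lim.
  - by move=> n; exact/measurable_EFinP.
  - by move=> n x _; rewrite lee_fin.
transitivity (limn (fun n => \int[mu]_x ((f_ n x)%:E * (inv_density x)%:E)))%E; last first.
  rewrite -monotone_convergence//.
  - apply: eq_integral => x _; apply/cvg_lim => //.
    by apply: cvgeZr => //; exact: cf_.
  - by move=> n; apply: emeasurable_funM => //; exact/measurable_EFinP.
  - by move=> n x _; rewrite mule_ge0 // lee_fin.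
  - by move=> x _ a b ab; rewrite lee_wpmul2r//; exact: nd.
congr (limn _); apply/funext => n.
have E1 x : (f_ n x)%:E = (\sum_(r \in range (f_ n)) (r * \1_(f_ n @^-1` [set r]) x)%:E)%E.
  by rewrite fimfunE -fsumEFin.
transitivity (\int[m1]_x (\sum_(r \in range (f_ n)) (r * \1_(f_ n @^-1` [set r]) x)%:E))%E.
  by apply: eq_integral => x _; exact: E1.
transitivity (\int[mu]_x (\sum_(r \in range (f_ n))
    ((r * \1_(f_ n @^-1` [set r]) x)%:E * (inv_density x)%:E)))%E; last first.
  apply: eq_integral => x _; rewrite E1 ge0_mule_fsuml// => r.
  exact: nnfun_muleindic_ge0.
rewrite ge0_integral_fsum//; last 2 first.
- by move=> r; exact/measurable_EFinP/measurable_funM.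
- by move=> r x _; rewrite nnfun_muleindic_ge0.
rewrite ge0_integral_fsum//; last 2 first.
- move=> r; apply: emeasurable_funM => //.
  exact/measurable_EFinP/measurable_funM.
- by move=> r x _; rewrite mule_ge0// nnfun_muleindic_ge0.
apply: eq_fsbigr => r /[!inE] -[x0 _ r0].
rewrite integralZl_indic_nnsfun// integral_indic//= setIT.
under [RHS]eq_integral do rewrite EFinM -muleA.
have r00 : 0 <= r by rewrite -r0.
rewrite ge0_integralZl//; last 2 first.
- by apply: emeasurable_funM => //; exact/measurable_EFinP/measurable_indic.
- by move=> x _; rewrite mule_ge0// lee_fin.
congr (_ * _)%E; rewrite /inv_measure [LHS]integral_mkcond.
apply: eq_integral => x _; rewrite patchE indicE.
by case: ifPn => /= _; rewrite ?mul1e ?mul0e.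
Qed.

Let derive_oppV (x : R) : x != 0 -> is_derive x 1 (fun y : R => - y^-1) (x ^- 2).
Proof.
move=> x0.
have dV : is_derive x (1 : R) (fun y : R => y^-1) (- x ^- 2 *: 1).
  exact: is_deriveV.
have := is_deriveN dV.
by rewrite -[X in is_derive _ _ _ X]/(- (- x ^- 2 * 1)) mulr1 opprK.
Qed.

Let cont_sqV (x : R) : x != 0 -> {for x, continuous (fun y : R => y ^- 2)}.
Proof.
move=> x0; apply: (@continuousV _ _ (fun y : R => y ^+ 2)).
  by rewrite expf_neq0.
exact: exprn_continuous.
Qed.

(** The antiderivative is [- 1 / y]. For [a = 0] the set is a half-line, which calls for the
    improper form of the fundamental theorem. *)
Let inv_measure_itv a b : 0 <= a -> a < b ->
  (\int[mu]_(y in [set y | (y^-1)%R \in `]a, b]]) (inv_density y)%:E = (b - a)%:E)%E.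
Proof.
move=> a0 ab; have b0 : 0 < b by exact: le_lt_trans ab.
have bV0 : 0 < b^-1 by rewrite invr_gt0.
move: a0; rewrite le_eqVlt => /orP[/eqP a0|a0].
  have -> : [set y | (y^-1)%R \in `]a, b]] = `[b^-1, +oo[%classic.
    apply/seteqP; split => y /=; rewrite !in_itv/= -a0 invr_gt0 andbT.
      by move=> /andP[y0]; rewrite invf_ple.
    move=> h; have y0 : 0 < y by exact: lt_le_trans h.
    by rewrite y0 /= invf_ple.
  transitivity (\int[mu]_(y in `[(b^-1)%R, +oo[) (y ^- 2)%:E)%E.
    apply: eq_integral => y; rewrite inE /= in_itv/= andbT => h.
    by rewrite /inv_density (lt_le_trans bV0 h).
  rewrite (@ge0_continuous_FTC2y _ _ (fun y => - y^-1) _ 0).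
  - by rewrite invrK sub0e EFinN oppeK -a0 subr0.
  - by move=> x h; rewrite invr_ge0 sqr_ge0.
  - apply: continuous_in_subspaceT => x; rewrite inE/= in_itv/= andbT => h.
    by apply: cont_sqV; rewrite gt_eqF// (lt_le_trans bV0 h).
  - rewrite -oppr0; apply: cvgN; apply/(gtr0_cvgV0 (f := id)) => //; exact: nbhs_pinfty_gt.
  - move=> x h; have x0 : x != 0 by rewrite gt_eqF// (lt_trans bV0 h).
    by have [] := derive_oppV x0.
  - apply: cvg_at_right_filter; apply: cvgN.
    by apply: inv_continuous; rewrite gt_eqF.
  - move=> x; rewrite in_itv/= andbT => h.
    have x0 : x != 0 by rewrite gt_eqF// (lt_trans bV0 h).
    by rewrite derive1E; have [] := derive_oppV x0.
have aV0 : 0 < a^-1 by rewrite invr_gt0.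
have baV : b^-1 < a^-1 by rewrite ltf_pV2.
have -> : [set y | (y^-1)%R \in `]a, b]] = `[b^-1, a^-1[%classic.
  apply/seteqP; split => y /=; rewrite !in_itv/=.
    move=> /andP[h1 h2]; have y0 : 0 < y by rewrite -invr_gt0 (lt_trans a0).
    by rewrite invf_ple// h2 invf_pgt.
  move=> /andP[h1 h2]; have y0 : 0 < y by exact: lt_le_trans h1.
  by rewrite invf_pgt// h2 invf_ple.
transitivity (\int[mu]_(y in `[(b^-1)%R, (a^-1)%R[) (y ^- 2)%:E)%E.
  apply: eq_integral => y; rewrite inE /= in_itv/= => /andP[h _].
  by rewrite /inv_density (lt_le_trans bV0 h).
have cc : {within `[b^-1, a^-1], continuous (fun y : R => y ^- 2)}.
  apply: continuous_in_subspaceT => x; rewrite inE/= in_itv/= => /andP[h _].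
  by apply: cont_sqV; rewrite gt_eqF// (lt_le_trans bV0 h).
rewrite integral_itv_bndo_bndc; last first.
  apply/measurable_EFinP; apply: (@measurable_funS _ _ _ _ `[b^-1, a^-1]%classic) => //.
    by move=> x /=; rewrite !in_itv/= => /andP[-> /ltW].
  exact: subspace_continuous_measurable_fun.
rewrite (@continuous_FTC2 _ _ (fun y => - y^-1))//.
- by rewrite !invrK -EFinB; congr EFin; rewrite opprK addrC.
- split.
  + move=> x; rewrite in_itv/= => /andP[h _].
    have x0 : x != 0 by rewrite gt_eqF// (lt_trans bV0 h).
    by have [] := derive_oppV x0.
  + apply: cvg_at_right_filter; apply: cvgN.
    by apply: inv_continuous; rewrite gt_eqF.
  + apply: cvg_at_left_filter; apply: cvgN.
    by apply: inv_continuous; rewrite gt_eqF.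
- move=> x; rewrite in_itv/= => /andP[h _].
  have x0 : x != 0 by rewrite gt_eqF// (lt_trans bV0 h).
  by rewrite derive1E; have [] := derive_oppV x0.
Qed.

Let inv_measure_neg (A : set R) : (forall x, A x -> x <= 0) -> inv_measure A = 0%E.
Proof.
move=> h; apply: integral0_eq => x /h x0.
by rewrite /inv_density ltNge x0.
Qed.

Let inv : measurableTypeR R -> measurableTypeR R := fun x => x^-1.
Let Inv := HB.pack_for {mfun measurableTypeR R >-> measurableTypeR R} inv
  (@isMeasurableFun.Build _ _ _ _ inv measurable_invr).
Let mneg : measurable (`]-oo, 0] : set (measurableTypeR R)). Proof. by []. Qed.

(** The substitution [y -> 1 / y] for measures. The image of [dy / y^2] lives on the positive axis,
    so Lebesgue measure on the rest is added back to make uniqueness of Lebesgue measure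
    applicable. *)
Let mu_split A : measurable A ->
  mu A = (mu (A `&` `]-oo, 0%R]) + inv_measure (inv @^-1` A))%E.
Proof.
have [m2 m2E] : exists m2 : {measure set (measurableTypeR R) -> \bar R},
    forall A, m2 A = (mu (A `&` `]-oo, 0%R]) + inv_measure (inv @^-1` A))%E.
  unshelve eexists (measure_add (mrestr mu mneg) (pushforward m1 inv)).
    exact: measurable_invr.
  by move=> B; rewrite [LHS](measure_addE (mrestr mu mneg)) .
rewrite -m2E; apply: lebesgue_measure_unique => _ [[c d]] _ <-.
rewrite m2E.
have [cd|dc] := ltP c d; last first.
  by rewrite set_itv_ge -?leNgt ?bnd_simp// set0I preimage_set0 !measure0 add0e.
have key e : Num.max 0 c = e -> e < d -> inv_measure (inv @^-1` `]c, d]) = (d - e)%:E.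
  move=> he ed; rewrite -inv_measure_itv//; last by rewrite -he le_max lexx.
  rewrite /inv_measure [LHS]integral_mkcond [RHS]integral_mkcond.
  apply: eq_integral => y _; rewrite !patchE.
  have [y0|y0] := leP y 0.
    rewrite /inv_density ltNge y0 /=; by do 2 case: ifPn.
  suff -> : (y \in inv @^-1` `]c, d]%classic) =
            (y \in [set y0 | (y0^-1)%R \in `]e, d]]) by [].
  apply/idP/idP; rewrite !inE /= /inv !in_itv/= => /andP[h ->]; rewrite andbT.
    by rewrite -he gt_max h invr_gt0 y0.
  by move: h; rewrite -he gt_max => /andP[].
have [d0|d0] := leP d 0.
  rewrite [X in (_ = _ + X)%E]inv_measure_neg ?adde0.
    congr (mu _); apply/esym/setIidPl => x /=; rewrite !in_itv/= => /andP[_ h].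
    exact: le_trans h d0.
  move=> x /=; rewrite /inv in_itv/= => /andP[_ h].
  by rewrite -invr_le0 (le_trans h).
rewrite (key (Num.max 0 c))//; last by rewrite gt_max d0.
have [c0|c0] := leP 0 c.
  rewrite (_ : _ `&` _ = set0) ?measure0 ?add0e.
    by rewrite lebesgue_measure_itv/= lte_fin cd -EFinB.
  by rewrite -subset0 => x [/=]; rewrite !in_itv/= => /andP[h1 _] h2; lra.
rewrite (_ : _ `&` _ = `]c, 0]%classic).
  by rewrite !lebesgue_measure_itv/= !lte_fin cd c0 -!EFinB -EFinD; congr EFin; ring.
apply/seteqP; split => x /=; rewrite !in_itv/=.
  by move=> [/andP[-> _] ->].
by move=> /andP[-> h]; split => //; apply: le_trans h _; exact: ltW.
Qed.

Lemma ge0_integral_inv F : measurable_fun [set: R] F -> (forall x, 0 <= F x)%E ->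
  (\int[mu]_x (F (x^-1)%R * (inv_density x)%:E) = \int[mu]_(x in `]0%R, +oo[) F x)%E.
Proof.
move=> mF F0.
have mFV : measurable_fun [set: R] (F \o (fun x => x^-1)).
  exact: (measurableT_comp mF measurable_invr).
have mD : measurable (Inv @^-1` `]0%R, +oo[).
  by rewrite -[X in measurable X]setTI; exact: measurable_invr.
transitivity (\int[m1]_(x in Inv @^-1` `]0%R, +oo[) (F \o Inv) x)%E.
  rewrite [RHS]integral_mkcond integral_inv_measure.
  - apply: eq_integral => y _; rewrite patchE.
    case: ifPn => //; rewrite notin_setE /= in_itv/= andbT invr_gt0 => /negP.
    by rewrite -leNgt => y0; rewrite /inv_density ltNge y0/= !mule0.
  - by apply/(measurable_restrictT _ mD); exact: measurable_funTS.
  - by move=> x; rewrite patchE; case: ifPn => //= _; exact: F0.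
rewrite -ge0_integral_pushforward//; last first.
  exact: measurable_funTS.
apply: eq_measure_integral => A mA A0.
rewrite [RHS]mu_split// [X in (_ = X + _)%E](_ : _ = 0%E) ?add0e//.
rewrite (_ : A `&` _ = set0) ?measure0//.
by rewrite -subset0 => x [/A0] /=; rewrite !in_itv/= andbT ltNge => /negP.
Qed.

End line_integrals.

(** * Invariance under translations, dilations and the inversion *)

Section hyperbolic_integral.
Context (R : realType).
Local Notation mu := (@lebesgue_measure R).
Implicit Types (F : R * R -> \bar R) (a k r : R).

Lemma measurable_pairR (g h : R * R -> R) : measurable_fun [set: R * R] g ->
  measurable_fun [set: R * R] h -> measurable_fun [set: R * R] (fun z => (g z, h z)).
Proof. by move=> mg mh; exact: measurable_fun_pair. Qed.

Lemma measurable_fstR : measurable_fun [set: R * R] (fun z : R * R => z.1).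
Proof. exact: measurable_fst. Qed.

Lemma measurable_sndR : measurable_fun [set: R * R] (fun z : R * R => z.2).
Proof. exact: measurable_snd. Qed.

(* [int_H F dx dy / y^2] over the upper half-plane: [inv_density] vanishes
   outside of it. *)
Definition hint F : \bar R :=
  (\int[mu \x mu]_z (F z * (inv_density z.2)%:E))%E.

Lemma measurable_hdens : measurable_fun [set: R * R] (fun z : R * R => (inv_density z.2)%:E).
Proof.
apply/measurable_EFinP.
exact: (measurableT_comp (@measurable_inv_density R) measurable_sndR).
Qed.

Let mhint F : measurable_fun [set: R * R] F ->
  measurable_fun [set: R * R] (fun z => (F z * (inv_density z.2)%:E)%E).
Proof. by move=> mF; apply: emeasurable_funM => //; exact: measurable_hdens. Qed.

Let hint0 F : (forall z, 0 <= F z)%E -> forall z : R * R, (0 <= F z * (inv_density z.2)%:E)%E.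
Proof. by move=> F0 z; rewrite mule_ge0// lee_fin inv_density_ge0. Qed.

Lemma measurable_xsec F y : measurable_fun [set: R * R] F ->
  measurable_fun [set: R] (fun x => F (x, y)).
Proof. by move=> mF; apply: (measurableT_comp mF); exact: measurable_fun_pair. Qed.

Lemma measurable_yint F : measurable_fun [set: R * R] F -> (forall z, 0 <= F z)%E ->
  measurable_fun [set: R] (fun y => (\int[mu]_x F (x, y))%E).
Proof.
move=> mF F0.
exact: (@measurable_fun_fubini_tonelli_G _ _ (measurableTypeR R) (measurableTypeR R) R mu F).
Qed.

Lemma measurable_xint F : measurable_fun [set: R * R] F -> (forall z, 0 <= F z)%E ->
  measurable_fun [set: R] (fun x => (\int[mu]_y F (x, y))%E).
Proof.
move=> mF F0.
exact: (@measurable_fun_fubini_tonelli_F _ _ (measurableTypeR R) (measurableTypeR R) R mu F).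
Qed.

Lemma tonelli_swap F : measurable_fun [set: R * R] F -> (forall z, 0 <= F z)%E ->
  (\int[mu]_y \int[mu]_x F (x, y) = \int[mu]_x \int[mu]_y F (x, y))%E.
Proof.
move=> mF F0.
by rewrite -(@fubini_tonelli _ _ (measurableTypeR R) (measurableTypeR R) R mu mu F mF F0).
Qed.

Lemma hintE F : measurable_fun [set: R * R] F -> (forall z, 0 <= F z)%E ->
  hint F = (\int[mu]_y ((\int[mu]_x F (x, y)) * (inv_density y)%:E))%E.
Proof.
move=> mF F0; rewrite /hint.
rewrite (@fubini_tonelli2 _ _ (measurableTypeR R) (measurableTypeR R) R mu mu _ (mhint mF) (hint0 F0)).
apply: eq_integral => y _; rewrite /fubini_G /=.
rewrite ge0_integralZr//; first exact: measurable_xsec.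
by rewrite lee_fin inv_density_ge0.
Qed.

Lemma hint_shift F a : measurable_fun [set: R * R] F -> (forall z, 0 <= F z)%E ->
  hint (fun z => F (z.1 + a, z.2)) = hint F.
Proof.
move=> mF F0.
have mS : measurable_fun [set: R * R] (fun z => F (z.1 + a, z.2)).
  apply: (measurableT_comp mF); apply: measurable_pairR; last exact: measurable_sndR.
  by apply: measurable_funD; [exact: measurable_fstR|exact: measurable_cst].
rewrite (hintE mF F0) (hintE mS (fun z => F0 _)).
apply: eq_integral => y _ /=; congr (_ * _)%E.
by rewrite (@ge0_integral_shift _ (fun x => F (x, y)))//; exact: measurable_xsec.
Qed.

Lemma hint_scale F r : 0 < r -> measurable_fun [set: R * R] F -> (forall z, 0 <= F z)%E ->
  hint (fun z => F (r * z.1, r * z.2)) = hint F.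
Proof.
move=> r0 mF F0.
have mS : measurable_fun [set: R * R] (fun z => F (r * z.1, r * z.2)).
  apply: (measurableT_comp mF); apply: measurable_pairR.
    by apply: measurable_funM; [exact: measurable_cst|exact: measurable_fstR].
  by apply: measurable_funM; [exact: measurable_cst|exact: measurable_sndR].
rewrite (hintE mF F0) (hintE mS (fun z => F0 _)).
pose K y := ((\int[mu]_x F (x, y)) * (inv_density y)%:E)%E.
have K0 y : (0 <= K y)%E.
  by rewrite /K mule_ge0 ?integral_ge0// lee_fin inv_density_ge0.
have mK : measurable_fun [set: R] K.
  apply: emeasurable_funM; first exact: measurable_yint.
  by apply/measurable_EFinP; exact: measurable_inv_density.
transitivity (\int[mu]_y (r%:E * K (r * y)%R))%E.
  apply: eq_integral => y _ /=.
  rewrite (@ge0_integral_scale _ (fun x => F (x, (r * y)%R)))//; last exact: measurable_xsec.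
  rewrite /K -muleA [RHS]muleCA [LHS]muleCA; congr (_ * _)%E.
  rewrite -!EFinM; congr EFin; rewrite /inv_density.
  rewrite pmulr_rgt0//; case: ifP => y0; last by rewrite !mulr0.
  by field; rewrite !gt_eqF.
rewrite ge0_integralZl//; last 2 first.
- by apply: (measurableT_comp mK); exact: mulrl_measurable.
- by rewrite lee_fin ltW.
rewrite (@ge0_integral_scale _ K)// muleA -EFinM mulfV ?mul1e//.
by rewrite gt_eqF.
Qed.

(** The density of [dy / y] on the positive axis: Haar measure of the multiplicative group, hence
    invariant under [y -> 1 / (k y)]. *)
Let v (y : R) : R := y * inv_density y.

Let v_ge0 y : 0 <= v y.
Proof.
rewrite /v /inv_density; case: ifPn => [y0|_]; last by rewrite mulr0.
by rewrite mulr_ge0 ?invr_ge0 ?exprn_ge0// ltW.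
Qed.

Let mv : measurable_fun [set: R] (fun y => (v y)%:E).
Proof.
apply/measurable_EFinP; apply: measurable_funM => //.
exact: measurable_inv_density.
Qed.

Let v_scale k y : 0 < k -> v (k * y) = k^-1 * v y.
Proof.
move=> k0; rewrite /v /inv_density pmulr_rgt0//; case: ifP => y0.
  by field; rewrite !gt_eqF.
by rewrite !mulr0.
Qed.

Let int_inv (G : R -> \bar R) k : 0 < k -> measurable_fun [set: R] G ->
  (forall y, 0 <= G y)%E ->
  (\int[mu]_y (G (k * y)^-1%R * (v y)%:E) = \int[mu]_y (G y * (v y)%:E))%E.
Proof.
move=> k0 mG G0.
have kV0 : 0 < k^-1 by rewrite invr_gt0.
pose H t := (G (k^-1 * t)%R * (v t)%:E)%E.
have mH : measurable_fun [set: R] H.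
  apply: emeasurable_funM => //; apply: (measurableT_comp mG).
  exact: mulrl_measurable.
have H0 t : (0 <= H t)%E by rewrite mule_ge0// lee_fin.
transitivity (\int[mu]_y (H y^-1%R * (inv_density y)%:E))%E.
  apply: eq_integral => y _; rewrite /H -muleA invfM; congr (_ * _)%E.
  rewrite -EFinM; congr EFin; rewrite /v /inv_density invr_gt0.
  by case: ifP => y0; rewrite ?mulr0//; field; rewrite gt_eqF.
rewrite ge0_integral_inv//.
transitivity (\int[mu]_t H t)%E.
  rewrite integral_mkcond; apply: eq_integral => t _; rewrite patchE.
  case: ifPn => //; rewrite notin_setE /= in_itv/= andbT => /negP t0.
  by rewrite /H /v /inv_density (negbTE t0) mulr0 mule0.
transitivity (\int[mu]_t ((k^-1)%:E * (fun y => G y * (v y)%:E) (k^-1 * t)%R))%E.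
  apply: eq_integral => t _; rewrite /H v_scale// invrK muleCA -EFinM.
  by rewrite mulrA mulVf ?mul1r// gt_eqF.
have mGv : measurable_fun [set: R] (fun y => G y * (v y)%:E)%E by exact: emeasurable_funM.
rewrite ge0_integralZl//; last 3 first.
- by apply: (measurableT_comp mGv); exact: mulrl_measurable.
- by move=> x _; rewrite mule_ge0// lee_fin.
- by rewrite lee_fin ltW.
rewrite (@ge0_integral_scale _ (fun y => G y * (v y)%:E))%E//; last first.
  by move=> x; rewrite mule_ge0// lee_fin.
by rewrite muleA -EFinM invrK mulVf ?mul1e// gt_eqF.
Qed.

(** In the coordinates [x = b y] the area [dx dy / y^2] is [db dy / y]. They are chosen because
    [z -> -1 / z] becomes [b -> -b], [y -> 1 / ((1 + b^2) y)], which reduces its invariance to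
    one-variable substitutions. *)
Let hint_polar F : measurable_fun [set: R * R] F -> (forall z, 0 <= F z)%E ->
  hint F = (\int[mu]_b \int[mu]_y (F ((b * y)%R, y) * (v y)%:E))%E.
Proof.
move=> mF F0; rewrite hintE//.
have mF' : measurable_fun [set: R * R] (fun z => F ((z.1 * z.2)%R, z.2)).
  apply: (measurableT_comp mF); apply: measurable_pairR; last exact: measurable_sndR.
  by apply: measurable_funM; [exact: measurable_fstR|exact: measurable_sndR].
have mF'' : measurable_fun [set: R * R] (fun z => F ((z.1 * z.2)%R, z.2) * (v z.2)%:E)%E.
  by apply: emeasurable_funM => //; exact: (measurableT_comp mv measurable_sndR).
rewrite -(@tonelli_swap (fun z => F ((z.1 * z.2)%R, z.2) * (v z.2)%:E)%E)//; last first.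
  by move=> z; rewrite mule_ge0// lee_fin.
apply: eq_integral => y _ /=.
rewrite ge0_integralZr//; last 2 first.
- exact: (measurable_xsec _ mF').
- by rewrite lee_fin.
have [y0|y0] := ltP 0 y; last first.
  by rewrite /v /inv_density ltNge y0 /= mulr0 !mule0.
under [in RHS]eq_integral do rewrite mulrC.
rewrite (@ge0_integral_scale _ (fun x => F (x, y)))//; last exact: measurable_xsec.
rewrite -muleA muleCA; congr (_ * _)%E; rewrite -EFinM; congr EFin.
by rewrite /v mulrA mulVf ?mul1r// gt_eqF.
Qed.

Lemma hint_inversion F : measurable_fun [set: R * R] F -> (forall z, 0 <= F z)%E ->
  hint (fun z => F (- z.1 / (z.1 ^+ 2 + z.2 ^+ 2), z.2 / (z.1 ^+ 2 + z.2 ^+ 2))) = hint F.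
Proof.
move=> mF F0.
have mI : measurable_fun [set: R * R]
    (fun z => F (- z.1 / (z.1 ^+ 2 + z.2 ^+ 2), z.2 / (z.1 ^+ 2 + z.2 ^+ 2))).
  have mn : measurable_fun [set: R * R] (fun z : R * R => (z.1 ^+ 2 + z.2 ^+ 2)^-1).
    apply: (measurableT_comp (@measurable_invr R)).
    by apply: measurable_funD; apply: measurable_funX; [exact: measurable_fstR|exact: measurable_sndR].
  apply: (measurableT_comp mF); apply: measurable_pairR; apply: measurable_funM => //.
  by apply: measurable_funN; exact: measurable_fstR.
rewrite (hint_polar mF F0) (hint_polar mI (fun z => F0 _)).
have mFm : measurable_fun [set: R * R] (fun z => F ((z.1 * z.2)%R, z.2) * (v z.2)%:E)%E.
  apply: emeasurable_funM; last exact: (measurableT_comp mv measurable_sndR).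
  apply: (measurableT_comp mF); apply: measurable_pairR; last exact: measurable_sndR.
  by apply: measurable_funM; [exact: measurable_fstR|exact: measurable_sndR].
rewrite -(@ge0_integral_opp _ (fun b => \int[mu]_y (F ((b * y)%R, y) * (v y)%:E)))%E; last 2 first.
- apply: (measurable_xint mFm) => z; by rewrite mule_ge0// lee_fin.
- by move=> b; apply: integral_ge0 => y _; rewrite mule_ge0// lee_fin.
apply: eq_integral => b _ /=.
have b0 : 0 < 1 + b ^+ 2 by rewrite ltr_pwDl// sqr_ge0.
have mG : measurable_fun [set: R] (fun y => F ((- b * y)%R, y)).
  apply: (measurableT_comp mF); exact: measurable_fun_pair.
rewrite -(int_inv b0 mG)//; apply: eq_integral => y _.
have [y0|y0] := ltP 0 y; last first.
  by rewrite /v /inv_density ltNge y0 /= mulr0 !mule0.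
by congr (F _ * _)%E; congr pair; field; rewrite ?gt_eqF//= ltr_wpDl ?sqr_ge0 ?exprn_gt0.
Qed.

End hyperbolic_integral.

(** * Real Moebius transformations of positive determinant *)

Section moebius_real.
Context (R : realType).
Implicit Types (F : R * R -> \bar R) (a b c d : R) (z : R * R).

Definition mobden c d z : R := (c * z.1 + d) ^+ 2 + (c * z.2) ^+ 2.

(** The factor [a * d - b * c] in the imaginary part covers all positive determinants, since Hecke
    correspondences need determinant 2. *)
Definition mobR a b c d z : R * R :=
  (((a * z.1 + b) * (c * z.1 + d) + a * c * z.2 ^+ 2) / mobden c d z,
   (a * d - b * c) * z.2 / mobden c d z).

Lemma mobden_gt0 a b c d z : 0 < z.2 -> a * d - b * c != 0 -> 0 < mobden c d z.
Proof.
move=> z0 D; rewrite /mobden.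
have [c0|c0] := eqVneq c 0.
  have d0 : d != 0 by apply: contra_neq D => ->; rewrite c0; ring.
  by rewrite c0 !mul0r add0r expr0n addr0 exprn_even_gt0.
by rewrite ltr_wpDl ?sqr_ge0// exprn_even_gt0//= mulf_neq0// gt_eqF.
Qed.

Lemma mobR_gt0 a b c d z : 0 < z.2 -> 0 < a * d - b * c -> 0 < (mobR a b c d z).2.
Proof.
move=> z0 D; rewrite /= divr_gt0 ?mulr_gt0//.
by apply: (@mobden_gt0 a b) => //; rewrite gt_eqF.
Qed.

Lemma mobden_comp a b c d a' b' c' d' z : 0 < z.2 -> a' * d' - b' * c' != 0 ->
  mobden c d (mobR a' b' c' d' z) * mobden c' d' z =
  mobden (c * a' + d * c') (c * b' + d * d') z.
Proof.
move=> z0 D; have d0 : mobden c' d' z != 0 by rewrite gt_eqF// (mobden_gt0 z0 D).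
rewrite {1}/mobden /mobR /=.
have E e f g : g != 0 -> ((c * (e / g) + d) ^+ 2 + (c * (f / g)) ^+ 2) * g =
    ((c * e + d * g) ^+ 2 + (c * f) ^+ 2) / g by move=> g0; field.
by rewrite E//; apply: (mulIf d0); rewrite divfK// /mobden; ring.
Qed.

Lemma mobR_comp a b c d a' b' c' d' z : 0 < z.2 ->
  0 < a * d - b * c -> 0 < a' * d' - b' * c' ->
  mobR a b c d (mobR a' b' c' d' z) =
  mobR (a * a' + b * c') (a * b' + b * d') (c * a' + d * c') (c * b' + d * d') z.
Proof.
move=> z0 D D'; have D'0 : a' * d' - b' * c' != 0 by rewrite gt_eqF.
have d0 : mobden c' d' z != 0 by rewrite gt_eqF// (mobden_gt0 z0 D'0).
have w0 := mobR_gt0 z0 D'.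
have D0 : a * d - b * c != 0 by rewrite gt_eqF.
have e0 : mobden c d (mobR a' b' c' d' z) != 0 by rewrite gt_eqF// (mobden_gt0 w0 D0).
rewrite [LHS]/mobR [RHS]/mobR -mobden_comp//.
set E := mobden c d _ in e0 *.
congr pair.
  have RH q : q / (E * mobden c' d' z) = q / mobden c' d' z / E by field; rewrite d0 e0.
  rewrite RH; congr (_ / _).
  have H x y g : g != 0 -> ((a * (x / g) + b) * (c * (x / g) + d) + a * c * (y / g) ^+ 2) =
    ((a * x + b * g) * (c * x + d * g) + a * c * y ^+ 2) / g / g by move=> g0; field.
  rewrite /= H//; congr (_ / _).
  by apply: (mulIf d0); rewrite divfK// /mobden; ring.
rewrite /=; set G := mobden c' d' z in d0 *; field.
by rewrite d0 e0.
Qed.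

(** Measurability is included so that invariance is stable under composition. *)
Definition hinv (h : R * R -> R * R) := measurable_fun [set: R * R] h /\
  forall F, measurable_fun [set: R * R] F -> (forall z, 0 <= F z)%E ->
    hint (F \o h) = hint F.

Lemma hinv_comp h g : hinv h -> hinv g -> hinv (h \o g).
Proof.
move=> [mh ih] [mg ig]; split; first exact: measurableT_comp.
move=> F mF F0; rewrite -(ih F)//; apply: (ig (F \o h)); first exact: measurableT_comp.
by move=> z; exact: F0.
Qed.

Lemma hinv_shift a : hinv (fun z => (z.1 + a, z.2)).
Proof.
split; last by move=> F mF F0; exact: hint_shift.
apply: measurable_pairR; last exact: measurable_sndR.
by apply: measurable_funD; [exact: measurable_fstR|exact: measurable_cst].
Qed.

Lemma hinv_scale r : 0 < r -> hinv (fun z => (r * z.1, r * z.2)).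
Proof.
move=> r0; split; last by move=> F mF F0; exact: hint_scale.
apply: measurable_pairR; apply: measurable_funM; try exact: measurable_cst.
  exact: measurable_fstR.
exact: measurable_sndR.
Qed.

Lemma hinv_inversion :
  hinv (fun z => (- z.1 / (z.1 ^+ 2 + z.2 ^+ 2), z.2 / (z.1 ^+ 2 + z.2 ^+ 2))).
Proof.
split; last by move=> F mF F0; exact: hint_inversion.
have mn : measurable_fun [set: R * R] (fun z : R * R => (z.1 ^+ 2 + z.2 ^+ 2)^-1).
  apply: (measurableT_comp (@measurable_invr R)).
  by apply: measurable_funD; apply: measurable_funX; [exact: measurable_fstR|exact: measurable_sndR].
apply: measurable_pairR; apply: measurable_funM => //.
by apply: measurable_funN; exact: measurable_fstR.
Qed.

Lemma eq_hint F G : (forall z, 0 < z.2 -> F z = G z) -> hint F = hint G.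
Proof.
move=> FG; apply: eq_integral => z _.
have [z0|z0] := ltP 0 z.2; first by rewrite FG.
by rewrite /inv_density ltNge z0 /= !mule0.
Qed.

Lemma measurable_mobR a b c d : measurable_fun [set: R * R] (mobR a b c d).
Proof.
have m1 := @measurable_fstR R; have m2 := @measurable_sndR R.
have ml (p q : R) : measurable_fun [set: R * R] (fun z : R * R => p * z.1 + q).
  by apply: measurable_funD; [apply: measurable_funM => //|]; exact: measurable_cst.
have md : measurable_fun [set: R * R] (fun z : R * R => (mobden c d z)^-1).
  apply: (measurableT_comp (@measurable_invr R)).
  apply: measurable_funD; apply: measurable_funX => //.
  by apply: measurable_funM => //; exact: measurable_cst.
apply: measurable_pairR; apply: measurable_funM => //.
  apply: measurable_funD; first exact: measurable_funM.
  by apply: measurable_funM; [exact: measurable_cst|exact: measurable_funX].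
by apply: measurable_funM => //; exact: measurable_cst.
Qed.

(** Bruhat decomposition: for [c != 0] the map is translation by [d / c], dilation by
    [c^2 / (a d - b c)], the inversion, then translation by [a / c]; for [c = 0] it is affine. *)
Lemma hint_mobR a b c d F : 0 < a * d - b * c ->
  measurable_fun [set: R * R] F -> (forall z, 0 <= F z)%E ->
  hint (fun z => F (mobR a b c d z)) = hint F.
Proof.
move=> D mF F0.
have [c0|c0] := eqVneq c 0.
  have ad : 0 < a * d by move: D; rewrite c0 mulr0 subr0.
  have d0 : d != 0 by apply: contraTneq ad => ->; rewrite mulr0 ltxx.
  have a0 : 0 < a / d by rewrite -(pmulr_lgt0 _ (_ : 0 < d ^+ 2)) ?exprn_even_gt0//; apply: etrans ad; congr (_ < _); field.
  rewrite -((hinv_comp (hinv_shift (b / d)) (hinv_scale a0)).2 F)//.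
  apply: eq_hint => z z0; rewrite /mobR /mobden c0 /=; congr F.
  by congr pair; field.
have r0 : 0 < c ^+ 2 / (a * d - b * c) by rewrite divr_gt0// exprn_even_gt0.
rewrite -((hinv_comp (hinv_shift (a / c)) (hinv_comp hinv_inversion (hinv_comp (hinv_scale r0) (hinv_shift (d / c))))).2 F)//.
have D0 : a * d - b * c != 0 by rewrite gt_eqF.
apply: eq_hint => z z0.
have dn : mobden c d z != 0 by rewrite gt_eqF// (mobden_gt0 z0 D0).
rewrite /mobR /=; congr F; set r := c ^+ 2 / _.
have -> : (r * (z.1 + d / c)) ^+ 2 + (r * z.2) ^+ 2 =
   (c / (a * d - b * c)) ^+ 2 * mobden c d z.
  by rewrite /r /mobden; field; rewrite D0 c0.
congr pair; rewrite /r; last first.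
  by field; rewrite D0 c0 dn.
have H x e : e != 0 -> (- (c ^+ 2 / (a * d - b * c) * x) / ((c / (a * d - b * c)) ^+ 2 * e)
    + a / c) * e = - (a * d - b * c) * x + a / c * e.
  by move=> e0; field; rewrite D0 c0 e0.
apply: (mulIf dn); rewrite divfK// H// /mobden; field.
by [].
Qed.

End moebius_real.

(** * The modular group and its fundamental domain *)

Lemma mulz_eq1 (a d : int) : a * d = 1 -> a * a = 1 /\ a = d.
Proof.
move=> ad; have : (a %| 1)%Z by apply/dvdzP; exists d; rewrite mulrC.
rewrite dvdz1 => /eqP a1.
have [ha|ha] : a = 1 \/ a = -1 by lia.
  by move: ad; rewrite ha !mul1r.
by move: ad; rewrite ha => ad; split => //; lia.
Qed.

Section modular_group.
Context (R : realType).
Implicit Types (z w : R * R) (f : R * R -> R).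

Definition mobZ (a b c d : int) z : R * R := mobR a%:~R b%:~R c%:~R d%:~R z.

Definition mobdenZ (c d : int) z : R := mobden c%:~R d%:~R z.

Lemma detZR (a b c d : int) : (a%:~R * d%:~R - b%:~R * c%:~R)%R = (a * d - b * c)%:~R :> R.
Proof. by rewrite intrB !intrM. Qed.

Lemma moebiusE (a b c d : int) z : a * d - b * c = 1 -> moebius a b c d z = mobZ a b c d z.
Proof. by move=> D; rewrite /moebius /mobZ /mobR detZR D mul1r. Qed.

Lemma mobdenZ_gt0 (a b c d : int) z : 0 < z.2 -> a * d - b * c != 0 -> 0 < mobdenZ c d z.
Proof.
by move=> z0 D; apply: (@mobden_gt0 _ a%:~R b%:~R) => //; rewrite detZR intr_eq0.
Qed.

Lemma mobZ_gt0 (a b c d : int) z : 0 < z.2 -> 0 < a * d - b * c -> 0 < (mobZ a b c d z).2.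
Proof. by move=> z0 D; apply: mobR_gt0 => //; rewrite detZR ltr0z. Qed.

Lemma mobZ_im (a b c d : int) z : a * d - b * c = 1 ->
  (mobZ a b c d z).2 = z.2 / mobdenZ c d z.
Proof. by move=> D; rewrite /= detZR D mul1r. Qed.

Lemma mobZ_comp (a b c d a' b' c' d' : int) z : 0 < z.2 ->
  0 < a * d - b * c -> 0 < a' * d' - b' * c' ->
  mobZ a b c d (mobZ a' b' c' d' z) =
  mobZ (a * a' + b * c') (a * b' + b * d') (c * a' + d * c') (c * b' + d * d') z.
Proof.
move=> z0 D D'; rewrite /mobZ mobR_comp ?detZR ?ltr0z//.
by rewrite -!intrM -!intrD.
Qed.

Lemma mobZ_scalar (e b : int) z : e * e = 1 -> mobZ e b 0 e z = (z.1 + (e * b)%:~R, z.2).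
Proof.
move=> e1; have e2 : (e%:~R * e%:~R = 1 :> R) by rewrite -intrM e1.
rewrite /mobZ /mobR mulr0z.
have -> : mobden 0 e%:~R z = 1 by rewrite -[RHS]e2 /mobden; ring.
rewrite !divr1 intrM; congr pair.
  by transitivity (e%:~R * e%:~R * z.1 + e%:~R * b%:~R); [ring|rewrite e2 mul1r].
by rewrite mulr0 subr0 e2 mul1r.
Qed.

Lemma mobZ_shift (k : int) z : mobZ 1 k 0 1 z = (z.1 + k%:~R, z.2).
Proof. by rewrite mobZ_scalar// mul1r. Qed.

Definition modular f := forall (a b c d : int) z, a * d - b * c = 1 -> 0 < z.2 ->
  f (mobZ a b c d z) = f z.

Lemma modular_gen f :
  (forall z, 0 < z.2 -> f (z.1 + 1, z.2) = f z) ->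
  (forall z, 0 < z.2 -> f (mobZ 0 (-1) 1 0 z) = f z) ->
  modular f.
Proof.
move=> fT fS.
have fTn (n : nat) z : 0 < z.2 -> f (z.1 + n%:R, z.2) = f z.
  move=> z0; elim: n => [|n IH]; first by rewrite addr0; case: z {z0}.
  by rewrite -IH -[RHS]fT//= -addrA -natr1.
have fTk (k : int) z : 0 < z.2 -> f (z.1 + k%:~R, z.2) = f z.
  move=> z0; case: (intP k) => [|n|n]; first by rewrite addr0; case: z {z0}.
    exact: fTn.
  rewrite mulrNz -[LHS](fTn n.+1)//=; congr f.
  by rewrite -addrA addNr addr0; case: z {z0}.
have main (n : nat) : forall (a b c d : int) z, (`|c| <= n)%N -> a * d - b * c = 1 -> 0 < z.2 ->
    f (mobZ a b c d z) = f z.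
  elim: n => [|n IH] a b c d z cn D z0.
    have c0 : c = 0 by move: cn; lia.
    have [e1 ed] : a * a = 1 /\ a = d.
      move: D; rewrite c0 mulr0 subr0 => D.
      exact: mulz_eq1.
    by rewrite c0 -ed mobZ_scalar// fTk.
  have [c0|c0] := eqVneq c 0; first by apply: IH => //; rewrite c0.
  pose q := (d %/ c)%Z.
  have dE : d = q * c + (d %% c)%Z by rewrite /q -divz_eq.
  have r0 : 0 <= (d %% c)%Z by rewrite modz_ge0.
  have rc : (d %% c)%Z < `|c| by rewrite ltz_mod.
  (* The new lower left entry [c q - d] is minus the remainder of [d] modulo [c], so the induction
     hypothesis applies. *)
  have -> : mobZ a b c d z = mobZ (a * q - b) a (c * q - d) c (mobZ 0 (-1) 1 q z).
    rewrite mobZ_comp ?(mul0r, mulN1r, opprK)//; first by congr (mobZ _ _ _ _ _); ring.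
    by rewrite (_ : _ - _ = 1)// -D; ring.
  have zq0 : 0 < (mobZ 0 (-1) 1 q z).2 by apply: mobZ_gt0 => //; rewrite mul0r mulN1r opprK.
  rewrite IH//; last 2 first.
  - by move: cn rc r0 dE; set r := (d %% c)%Z; lia.
  - by rewrite -D; ring.
  have -> : mobZ 0 (-1) 1 q z = mobZ 0 (-1) 1 0 (z.1 + q%:~R, z.2).
    rewrite -mobZ_shift mobZ_comp ?(mulr0, mulr1, subr0, mul0r, mulN1r, opprK)//.
    by congr (mobZ _ _ _ _ _); ring.
  by rewrite fS// fTk.
by move=> a b c d z; exact: (main `|c|%N).
Qed.

Definition fund_domo : set (R * R) :=
  [set z | `|z.1| < 2^-1 /\ 1 < z.1 ^+ 2 + z.2 ^+ 2 /\ 0 < z.2].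

Lemma mobdenE (c d : int) z : mobdenZ c d z =
  c%:~R ^+ 2 * (z.1 ^+ 2 + z.2 ^+ 2) + 2 * c%:~R * d%:~R * z.1 + d%:~R ^+ 2.
Proof. by rewrite /mobdenZ /mobden; ring. Qed.

(** Since [|z| > 1] and [|Re z| < 1/2], [|c z + d|^2] exceeds [c^2 - |c d| + d^2], a positive
    integer. *)
Lemma mobden_gt1 (c d : int) z : fund_domo z -> c != 0 -> 1 < mobdenZ c d z.
Proof.
move=> [x1 [r1 y0]] c0; rewrite mobdenE.
have c2 : 0 < c%:~R ^+ 2 :> R by rewrite exprn_even_gt0//= intr_eq0.
have h1 : c%:~R ^+ 2 < c%:~R ^+ 2 * (z.1 ^+ 2 + z.2 ^+ 2) by rewrite ltr_pMr.
have h2 : - `|c%:~R * d%:~R| <= 2 * c%:~R * d%:~R * z.1.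
  have -> : 2 * c%:~R * d%:~R * z.1 = c%:~R * d%:~R * (2 * z.1) by ring.
  have : `|c%:~R * d%:~R * (2 * z.1)| <= `|c%:~R * d%:~R|.
    rewrite normrM ler_piMr// normrM ger0_norm//; lra.
  by rewrite ler_norml => /andP[].
have h3 : 1 <= c%:~R ^+ 2 - `|c%:~R * d%:~R| + d%:~R ^+ 2 :> R.
  rewrite -intrM -intr_norm -!rmorphXn/= -intrB -intrD ler1z.
  rewrite normrM -(real_normK (num_real c)) -(real_normK (num_real d)).
  have : 1 <= `|c| by rewrite -gtz0_ge1 normr_gt0.
  have := normr_ge0 d; move: `|c| `|d| => p q q0 p1.
  by nia.
lra.
Qed.

(** If [c != 0], the matrix and its inverse would both strictly lower the height. With [c = 0] the
    map is an integer translation shorter than the width 1 of the domain. *)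
Lemma fund_domo_unique (a b c d : int) z : a * d - b * c = 1 ->
  fund_domo z -> fund_domo (mobZ a b c d z) ->
  [/\ b = 0, c = 0, a = d & a * a = 1].
Proof.
move=> D zo wo; have z0 : 0 < z.2 by case: zo => _ [].
have w0 : 0 < (mobZ a b c d z).2 by case: wo => _ [].
have D' : d * a - (- b) * (- c) = 1 by rewrite -D; ring.
have zE : mobZ d (- b) (- c) a (mobZ a b c d z) = z.
  rewrite mobZ_comp ?D ?D'//.
  rewrite (_ : d * a + _ = 1); last by rewrite -D; ring.
  rewrite (_ : d * b + _ = 0); last by ring.
  rewrite (_ : - c * a + _ = 0); last by ring.
  rewrite (_ : - c * b + _ = 1); last by rewrite -D; ring.
  by rewrite mobZ_shift mulr0z addr0; case: (z).
have [c0|c0] := eqVneq c 0; last first.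
  have h1 : (mobZ a b c d z).2 < z.2.
    rewrite mobZ_im// ltr_pdivrMr; first by rewrite ltr_pMr// mobden_gt1.
    by apply: lt_trans (mobden_gt1 d zo c0).
  have : (mobZ d (- b) (- c) a (mobZ a b c d z)).2 < (mobZ a b c d z).2.
    have cN0 : - c != 0 by rewrite oppr_eq0.
    rewrite mobZ_im// ltr_pdivrMr; first by rewrite ltr_pMr// mobden_gt1.
    by apply: lt_trans (mobden_gt1 a wo cN0).
  by rewrite zE => /(lt_trans h1); rewrite ltxx.
have [e1 ed] : a * a = 1 /\ a = d.
  move: D; rewrite c0 mulr0 subr0 => D.
  exact: mulz_eq1.
split=> //.
move: wo; rewrite c0 -ed mobZ_scalar// => -[/= h _]; case: zo => h' _.
have : `|(a * b)%:~R : R| < 1.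
  have -> : (a * b)%:~R = (z.1 + (a * b)%:~R) - z.1 by ring.
  by rewrite (le_lt_trans (ler_normB _ _))//; lra.
rewrite -intr_norm ltrz1 => hab.
have ab0 : a * b = 0 by lia.
by rewrite -[b]mul1r -e1 -mulrA ab0 mulr0.
Qed.

End modular_group.

(** * Reduction to the fundamental domain, and the Hecke neighbours of a point *)

Section reduction.
Context (R : realType).
Implicit Types (z w : R * R) (f : R * R -> R).

Lemma mobdenZ_ge1 (N : nat) (c d : int) z : 0 < z.2 ->
  z.2^-1 <= N%:R -> 1 + `|z.1| / z.2 <= N%:R ->
  (N < `|c|)%N || (N < `|d|)%N -> 1 <= mobdenZ c d z.
Proof.
move=> z0 N1 N2 /orP H.
have [cy|cy] := leP 1 `|c%:~R * z.2|.
  rewrite /mobdenZ /mobden ler_wpDl ?sqr_ge0//.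
  by rewrite -(real_normK (num_real (_ * z.2))) exprn_ege1.
have cy' : `|c%:~R : R| < z.2^-1.
  by move: cy; rewrite normrM (gtr0_norm z0) -ltr_pdivlMr// div1r.
case: H => [cN|dN].
  have : (N%:R : R) < `|c%:~R|.
    by rewrite -intr_norm pmulrn ltr_int -abszE ltz_nat.
  move=> /ltW h; have := lt_le_trans cy' (le_trans N1 h).
  by rewrite ltxx.
have dN' : (N%:R : R) < `|d%:~R|.
  by rewrite -intr_norm pmulrn ltr_int -abszE ltz_nat.
have h1 : `|c%:~R * z.1| <= `|z.1| / z.2.
  by rewrite normrM mulrC ler_wpM2l// ltW.
have h2 : 1 <= `|c%:~R * z.1 + d%:~R|.
  have := ler_normB (c%:~R * z.1 + d%:~R) (c%:~R * z.1 : R).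
  rewrite addrAC subrr add0r; lra.
rewrite /mobdenZ /mobden ler_wpDr ?sqr_ge0//.
by rewrite -(real_normK (num_real (_ + _))) exprn_ege1.
Qed.

(** The pair [(0, 1)] has value 1 and every pair outside a finite box has value at least 1, so the
    minimum is taken over the box. *)
Lemma mobdenZ_min z : 0 < z.2 -> exists c d : int, [/\ (c, d) != (0, 0),
  coprimez c d & forall c' d', (c', d') != (0, 0) -> mobdenZ c d z <= mobdenZ c' d' z].
Proof.
move=> z0.
pose M := Num.max z.2^-1 (1 + `|z.1| / z.2).
have [N NM] : exists N : nat, M < N%:R.
  exists (Num.bound M); apply: archi_boundP.
  by rewrite le_max invr_ge0 (ltW z0).
have N1 : z.2^-1 <= N%:R.
  by apply: le_trans (ltW NM); rewrite le_max lexx.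
have N2 : 1 + `|z.1| / z.2 <= N%:R.
  by apply: le_trans (ltW NM); rewrite le_max lexx orbT.
pose val (i : 'I_(2 * N).+1) : int := (i : nat)%:Z - N%:Z.
have valP (c : int) : (`|c| <= N)%N -> exists i, val i = c.
  move=> cN; have h : (`|(c + N%:Z)%R| < (2 * N).+1)%N by lia.
  by exists (Ordinal h); rewrite /val /=; lia.
pose P (i : 'I_(2 * N).+1 * 'I_(2 * N).+1) := (val i.1, val i.2) != (0, 0).
have N0 : (0 < N)%N.
  by rewrite -(ltr_nat R) (lt_le_trans _ N1)// invr_gt0.
have [i0 hi0] : exists i, val i = 0 by apply: valP.
have [i1 hi1] : exists i, val i = 1 by apply: valP.
have P0 : P (i0, i1) by rewrite /P /= hi0 hi1.
pose F (i : 'I_(2 * N).+1 * 'I_(2 * N).+1) := mobdenZ (val i.1) (val i.2) z.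
have [i Pi iF] := @Order.TotalTheory.arg_minP _ R _ (i0, i1) P F P0.
have i_le1 : F i <= 1.
  apply: le_trans (iF _ P0) _; rewrite /F /= hi0 hi1 /mobdenZ /mobden.
  by rewrite !mul0r add0r expr1n expr0n addr0.
have min c' d' : (c', d') != (0, 0) -> F i <= mobdenZ c' d' z.
  move=> cd0.
  have [cN|cN] := leqP `|c'| N; last first.
    by apply: le_trans i_le1 _; apply: (mobdenZ_ge1 z0 N1 N2); rewrite cN.
  have [dN|dN] := leqP `|d'| N; last first.
    by apply: le_trans i_le1 _; apply: (mobdenZ_ge1 z0 N1 N2); rewrite dN orbT.
  have [j1 h1] := valP _ cN; have [j2 h2] := valP _ dN.
  have := iF (j1, j2); rewrite /P /F /= h1 h2; exact.
exists (val i.1), (val i.2); split => //.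
set c := val i.1; set d := val i.2.
have cd0 : (c, d) != (0, 0) by [].
have g0 : gcdz c d != 0.
  by rewrite gcdz_eq0; move: cd0; rewrite xpair_eqE.
have gg : 0 <= gcdz c d by [].
have [c1 hc1] := dvdzP (dvdz_gcdl c d).
have [d1 hd1] := dvdzP (dvdz_gcdr c d).
have c1d1 : (c1, d1) != (0, 0).
  apply: contra_neq cd0 => -[c10 d10].
  by rewrite hc1 hd1 c10 d10 !mul0r.
have := min _ _ c1d1.
(* Dividing the pair by its gcd divides the value by the square of the gcd, so minimality forces
   coprimality. *)
have -> : F i = (gcdz c d)%:~R ^+ 2 * mobdenZ c1 d1 z.
  rewrite /F -/c -/d {1}hc1 {2}hd1 /mobdenZ /mobden !intrM; ring.
have m0 : 0 < mobdenZ c1 d1 z.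
  rewrite lt_neqAle addr_ge0 ?sqr_ge0// andbT eq_sym.
  apply: contra_neq c1d1; rewrite /mobdenZ /mobden => /eqP.
  rewrite paddr_eq0 ?sqr_ge0// !sqrf_eq0 mulf_eq0 intr_eq0 (gt_eqF z0) orbF.
  by move=> /andP[h /eqP c10]; move: h; rewrite c10 mulr0z mul0r add0r intr_eq0 => /eqP ->.
rewrite ger_pMl// -rmorphXn/= lerz1 /coprimez => h.
by apply/eqP; nia.
Qed.

(** The bottom row minimising [|c z + d|^2] maximises the height in the orbit. It is completed to
    determinant 1 by Bezout and followed by a translation to the central strip. *)
Lemma reduction z : 0 < z.2 -> exists a b c d : int,
  a * d - b * c = 1 /\ fund_dom (mobZ a b c d z).
Proof.
move=> z0; have [c [d [cd0 cop min]]] := mobdenZ_min z0.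
have [[u v] /= uv] := elimT (coprimezP _ _) cop.
have D0 : v * d - (- u) * c = 1 by rewrite -uv; ring.
pose w := mobZ v (- u) c d z.
pose k : int := - Num.floor (w.1 + 2^-1).
have Dk : (v + k * c) * d - (- u + k * d) * c = 1 by rewrite -D0; ring.
exists (v + k * c), (- u + k * d), c, d; split => //.
have wE : mobZ (v + k * c) (- u + k * d) c d z = (w.1 + k%:~R, w.2).
  rewrite -mobZ_shift mobZ_comp ?D0// ?mulr1 ?mulr0 ?subr0//.
  by congr (mobZ _ _ _ _ _); ring.
have m0 : 0 < mobdenZ c d z by apply: (@mobdenZ_gt0 _ v (- u)); rewrite ?D0.
split; last split.
- rewrite wE; change (`|w.1 + k%:~R| <= 2^-1).
  have [m mE] : exists m : R, m = (Num.floor (w.1 + 2^-1))%:~R by eexists.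
  have h1 : m <= w.1 + 2^-1 by rewrite mE ge_floor.
  have h2 : w.1 + 2^-1 < m + 1 by have := lt_succ_floor (w.1 + 2^-1); rewrite intrD -mE.
  rewrite /k mulrNz -mE ler_norml; move: (w.1) h1 h2 => t h1 h2.
  by apply/andP; split; lra.
- set a := v + _; set b := - u + _ in Dk *.
  have ab0 : (a, b) != (0, 0).
    apply/negP => /eqP [a0 b0]; move: Dk; rewrite -/a -/b a0 b0 !mul0r subr0.
    by move=> /esym/eqP; rewrite oner_eq0.
  (* That is [|a z + b|^2 / |c z + d|^2], which minimality of the denominator makes at least 1. *)
  have -> : (mobZ a b c d z).1 ^+ 2 + (mobZ a b c d z).2 ^+ 2 = mobdenZ a b z / mobdenZ c d z.
    rewrite /mobZ /mobR /=.
    have -> : a%:~R * d%:~R - b%:~R * c%:~R = 1 :> R by rewrite detZR Dk.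
    have m0' : mobdenZ c d z != 0 by rewrite gt_eqF.
    apply: (mulIf m0'); rewrite divfK//.
    have -> : mobden c%:~R d%:~R z = mobdenZ c d z by [].
    have H p q e : e != 0 -> ((p / e) ^+ 2 + (q / e) ^+ 2) * e = (p ^+ 2 + q ^+ 2) / e :> R.
      by move=> e0; field.
    rewrite H//; apply: (mulIf m0'); rewrite divfK// mul1r.
    have : a%:~R * d%:~R - b%:~R * c%:~R = 1 :> R by rewrite detZR Dk.
    rewrite /mobdenZ /mobden => hD.
    transitivity (((a%:~R * z.1 + b%:~R) * (c%:~R * z.1 + d%:~R) + a%:~R * c%:~R * z.2 ^+ 2) ^+ 2 +
     ((a%:~R * d%:~R - b%:~R * c%:~R) * z.2) ^+ 2); first by rewrite hD mul1r.
    ring.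
  by rewrite ler_pdivlMr// mul1r min.
- by apply: mobZ_gt0; rewrite ?Dk.
Qed.

Definition hecke1 z : R * R := (2 * z.1, 2 * z.2).
Definition hecke2 z : R * R := (z.1 / 2, z.2 / 2).
Definition hecke3 z : R * R := ((z.1 + 1) / 2, z.2 / 2).

Lemma hecke1E z : hecke1 z = mobZ 2 0 0 1 z.
Proof. by rewrite /hecke1 /mobZ /mobR /mobden; congr pair; rewrite ?(mulr0z, mulr1z); field. Qed.

Lemma hecke2E z : hecke2 z = mobZ 1 0 0 2 z.
Proof. by rewrite /hecke2 /mobZ /mobR /mobden; congr pair; rewrite ?(mulr0z, mulr1z); field. Qed.

Lemma hecke3E z : hecke3 z = mobZ 1 1 0 2 z.
Proof. by rewrite /hecke3 /mobZ /mobR /mobden; congr pair; rewrite ?(mulr0z, mulr1z); field. Qed.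

Lemma modular_shift f z : modular f -> 0 < z.2 -> f (z.1 + 1, z.2) = f z.
Proof. by move=> fm z0; rewrite -(fm 1 1 0 1 z)// mobZ_shift. Qed.

Lemma hecke_shift f z : modular f -> 0 < z.2 ->
  [/\ f (hecke1 (z.1 + 1, z.2)) = f (hecke1 z), f (hecke2 (z.1 + 1, z.2)) = f (hecke3 z) &
      f (hecke3 (z.1 + 1, z.2)) = f (hecke2 z)].
Proof.
move=> fm z0; split => //.
  rewrite -(fm 1 2 0 1 (hecke1 z))//; last by rewrite /= mulr_gt0.
  by rewrite mobZ_shift /hecke1 /=; congr (f (_, _)); ring.
rewrite -(modular_shift fm (z := hecke2 z))//; last by rewrite /= divr_gt0.
by rewrite /hecke3 /hecke2 /=; congr (f (_, _)); field.
Qed.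

(** With [hecke_shift]: the two generators permute the three Hecke neighbours modulo the modular
    group, so a symmetric expression in the values of [f] there is modular. *)
Lemma hecke_inversion f z : modular f -> 0 < z.2 ->
  let Sz := mobZ 0 (-1) 1 0 z in
  [/\ f (hecke1 Sz) = f (hecke2 z), f (hecke2 Sz) = f (hecke1 z) &
      f (hecke3 Sz) = f (hecke3 z)].
Proof.
move=> fm z0 Sz; split.
- rewrite -(fm 0 (-1) 1 0 (hecke2 z))//; last by rewrite /= divr_gt0.
  by rewrite hecke1E hecke2E /Sz !mobZ_comp.
- rewrite -(fm 0 (-1) 1 0 (hecke1 z))//; last by rewrite /= mulr_gt0.
  by rewrite hecke1E hecke2E /Sz !mobZ_comp.
(* Both sides come from the matrix [(1 -1; 2 0) = (1 1; 0 2) (0 -1; 1 0) = (1 -1; 2 -1) (1 1; 0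
   2)]. *)
- rewrite -(fm 1 (-1) 2 (-1) (hecke3 z))//; last by rewrite /= divr_gt0.
  by rewrite !hecke3E /Sz !mobZ_comp.
Qed.

End reduction.

(** * Self-adjointness of the Hecke operator at 2 *)

Lemma esum_countT (R : realType) (T : countType) (D : set T) (a : T -> \bar R) :
  (forall i, D i -> 0 <= a i)%E ->
  (\esum_(i in D) a i =
   \sum_(n <oo) oapp (fun i => if i \in D then a i else 0) 0 (pickle_inv (T := T) n))%E.
Proof.
move=> a0; rewrite nneseries_esumT; last first.
  move=> n; case: (pickle_inv n) => //= i; case: ifPn => // /set_mem; exact: a0.
rewrite esum_mkcond.
pose b n : \bar R := oapp (fun i => if i \in D then a i else 0%E) 0%E (pickle_inv (T := T) n).
have -> : \esum_(i in [set: nat]) b i = \esum_(i in range (@pickle T)) b i.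
  rewrite [RHS]esum_mkcond; apply: eq_esum => n _.
  case: ifPn => // /negP; rewrite inE => nT; rewrite /b.
  case E : (pickle_inv n) => [i|//]; exfalso; apply: nT.
  by exists i => //; have := pickle_invK (T := T) n; rewrite E.
rewrite esum_image; last by move=> i j _ _; exact: (pcan_inj pickleK_inv).
by apply: eq_esum => i _; rewrite /b pickleK_inv.
Qed.

Definition mat := (int * int * int * int)%type.
Definition mdet (m : mat) : int := m.1.1.1 * m.2 - m.1.1.2 * m.1.2.
Definition madj (m : mat) : mat := (m.2, - m.1.1.2, - m.1.2, m.1.1.1).
Definition mact (R : realType) (m : mat) (z : R * R) : R * R :=
  mobZ m.1.1.1 m.1.1.2 m.1.2 m.2 z.

Definition SL2Z : set mat := [set m | mdet m = 1].
Definition M2Z : set mat := [set m | mdet m = 2].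

(* The three left cosets [SL2Z * (2 0; 0 1)], [SL2Z * (1 0; 0 2)] and
   [SL2Z * (1 1; 0 2)] partition [M2Z]. *)
Definition coset1 (m : mat) : mat := (2 * m.1.1.1, m.1.1.2, 2 * m.1.2, m.2).
Definition coset2 (m : mat) : mat := (m.1.1.1, 2 * m.1.1.2, m.1.2, 2 * m.2).
Definition coset3 (m : mat) : mat :=
  (m.1.1.1, m.1.1.1 + 2 * m.1.1.2, m.1.2, m.1.2 + 2 * m.2).

(** Modulo 2 the columns are dependent and not both zero, as 4 does not divide the determinant. The
    cosets are the cases: first column even, second column even, columns congruent. *)
Lemma esum_M2Z (R : realType) (a : mat -> \bar R) : (forall m, 0 <= a m)%E ->
  (\esum_(m in M2Z) a m = \esum_(m in SL2Z) a (coset1 m) +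
    (\esum_(m in SL2Z) a (coset2 m) + \esum_(m in SL2Z) a (coset3 m)))%E.
Proof.
move=> a0.
pose C1 := [set m : mat | exists p q, m.1.1.1 = 2 * p /\ m.1.2 = 2 * q].
pose C2 := [set m : mat | exists p q, m.1.1.2 = 2 * p /\ m.2 = 2 * q].
rewrite (esumID C1)// (esumID C2 (M2Z `&` ~` C1))//.
have half (p : int) : exists q, p = 2 * q \/ p = 2 * q + 1.
  by exists (p %/ 2)%Z; lia.
congr (_ + (_ + _))%E; apply: reindex_esum; split.
- move=> [[[p q] r] s]; rewrite /SL2Z /M2Z /C1 /mdet /= => D.
  by split; [lia|exists p, r].
- by move=> [[[p q] r] s] [[[p' q'] r'] s'] _ _ [] *; congr (_, _, _, _); lia.
- move=> [[[p q] r] s]; rewrite /SL2Z /M2Z /C1 /mdet /= => -[D [u [v [h1 h2]]]].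
  exists (u, q, v, s) => //=; first by rewrite /mkset /=; move: D; rewrite h1 h2; lia.
  by rewrite /coset1 /= h1 h2.
- move=> [[[p q] r] s]; rewrite /SL2Z /M2Z /C1 /C2 /mdet /= => D.
  split; last by exists q, s.
  split; first lia.
  by move=> [u [v [h1 h2]]]; move: D; rewrite h1 h2; lia.
- by move=> [[[p q] r] s] [[[p' q'] r'] s'] _ _ [] *; congr (_, _, _, _); lia.
- move=> [[[p q] r] s]; rewrite /SL2Z /M2Z /C1 /C2 /mdet /= => -[[D _] [u [v [h1 h2]]]].
  exists (p, u, r, v) => //=; first by rewrite /mkset /=; move: D; rewrite h1 h2; lia.
  by rewrite /coset2 /= h1 h2.
- move=> [[[p q] r] s]; rewrite /SL2Z /M2Z /C1 /C2 /mdet /= => D.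
  split; first split; first lia.
    by move=> [u [v [h1 h2]]]; move: D; rewrite h1 h2; lia.
  move=> [u [v [h1 h2]]]; move: D.
  have -> : p = 2 * (u - q) by lia.
  have -> : r = 2 * (v - s) by lia.
  lia.
- by move=> [[[p q] r] s] [[[p' q'] r'] s'] _ _ [] *; congr (_, _, _, _); lia.
- move=> [[[p q] r] s]; rewrite /SL2Z /M2Z /C1 /C2 /mdet /= => -[[D n1] n2].
  have [p1 hp] := half p; have [q1 hq] := half q.
  have [r1 hr] := half r; have [s1 hs] := half s.
  have [e1 e2] : q = p + 2 * (q1 - p1) /\ s = r + 2 * (s1 - r1).
  { case: hp => hp; case: hr => hr; try by exfalso; apply: n1; exists p1, r1.
    all: case: hq => hq; case: hs => hs; try by exfalso; apply: n2; exists q1, s1.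
    all: try by split; lia.
    all: exfalso; move: D; rewrite hp hq hr hs; lia. }
  exists (p, q1 - p1, r, s1 - r1) => /=; last by rewrite /coset3 /= -e1 -e2.
  rewrite /mkset /=; move: D; rewrite e1 e2; lia.
Qed.

(** * Sums over integer matrices and the fundamental domain *)

Section unfolding.
Context (R : realType).
Local Notation mu := (@lebesgue_measure R).
Implicit Types (z w : R * R) (f g : R * R -> R).

Lemma hint_esum (T : countType) (D : set T) (F : T -> R * R -> \bar R) :
  (forall i, measurable_fun [set: R * R] (F i)) -> (forall i z, 0 <= F i z)%E ->
  hint (fun z => \esum_(i in D) F i z)%E = (\esum_(i in D) hint (F i))%E.
Proof.
move=> mF F0.
have h0 i : (0 <= hint (F i))%E.
  by apply: integral_ge0 => z _; rewrite mule_ge0// lee_fin inv_density_ge0.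
rewrite esum_countT//.
pose G n z := oapp (fun i => if i \in D then F i z else 0%E) 0%E (pickle_inv (T := T) n).
have G0 n z : (0 <= G n z)%E.
  by rewrite /G; case: (pickle_inv n) => //= i; case: ifP.
have mG n : measurable_fun [set: R * R] (G n).
  rewrite /G; case: (pickle_inv n) => [i|] /=; last exact: measurable_cst.
  by case: (i \in D); [exact: mF|exact: measurable_cst].
transitivity (\int[mu \x mu]_z (\sum_(n <oo) (G n z * (inv_density z.2)%:E)))%E.
  apply: eq_integral => z _; rewrite esum_countT// muleC -nneseriesZl.
    by apply: eq_eseriesr => n _; rewrite muleC.
  by move=> n _; exact: (G0 n z).
rewrite integral_nneseries//; last 2 first.
- by move=> n; apply: emeasurable_funM; [exact: mG|exact: measurable_hdens].
- by move=> n z _; rewrite mule_ge0// lee_fin inv_density_ge0.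
apply: eq_eseriesr => n _; rewrite /G; case: (pickle_inv n) => [i|] /=.
  by case: ifP => // _; apply: integral0_eq => z _; rewrite mul0e.
by apply: integral0_eq => z _; rewrite mul0e.
Qed.

Lemma hint_mact m (F : R * R -> \bar R) : 0 < mdet m ->
  measurable_fun [set: R * R] F -> (forall z, 0 <= F z)%E ->
  hint (fun z => F (mact m z)) = hint F.
Proof. by move=> D mF F0; apply: hint_mobR => //; rewrite detZR ltr0z. Qed.

Lemma measurable_mact m : measurable_fun [set: R * R] (@mact R m).
Proof. exact: measurable_mobR. Qed.

Lemma measurable_le_set (f g : R * R -> R) : measurable_fun [set: R * R] f ->
  measurable_fun [set: R * R] g -> measurable [set z | f z <= g z].
Proof.
move=> mf mg; rewrite -[X in measurable X]setTI.
have -> : [set z | f z <= g z] = (fun z => f z <= g z) @^-1` [set true] by [].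
exact: (measurable_fun_ler mf mg).
Qed.

Lemma measurable_lt_set (f g : R * R -> R) : measurable_fun [set: R * R] f ->
  measurable_fun [set: R * R] g -> measurable [set z | f z < g z].
Proof.
move=> mf mg; rewrite -[X in measurable X]setTI.
have -> : [set z | f z < g z] = (fun z => f z < g z) @^-1` [set true] by [].
exact: (measurable_fun_ltr mf mg).
Qed.

Let mabs : measurable_fun [set: R * R] (fun z : R * R => `|z.1|).
Proof. by apply: measurableT_comp => //; exact: measurable_fstR. Qed.

Let msq : measurable_fun [set: R * R] (fun z : R * R => z.1 ^+ 2 + z.2 ^+ 2).
Proof.
by apply: measurable_funD; apply: measurable_funX; [exact: measurable_fstR|exact: measurable_sndR].
Qed.

Lemma measurable_fund_dom : measurable (@fund_dom R).
Proof.
rewrite (_ : @fund_dom R = [set z | `|z.1| <= 2^-1] `&`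
  ([set z | 1 <= z.1 ^+ 2 + z.2 ^+ 2] `&` [set z | 0 < z.2])); last by [].
apply: measurableI; first by apply: measurable_le_set => //; exact: measurable_cst.
apply: measurableI; first by apply: measurable_le_set => //; exact: measurable_cst.
by apply: measurable_lt_set; [exact: measurable_cst|exact: measurable_sndR].
Qed.

Lemma measurable_fund_domo : measurable (@fund_domo R).
Proof.
rewrite (_ : @fund_domo R = [set z | `|z.1| < 2^-1] `&`
  ([set z | 1 < z.1 ^+ 2 + z.2 ^+ 2] `&` [set z | 0 < z.2])); last by [].
apply: measurableI; first by apply: measurable_lt_set => //; exact: measurable_cst.
apply: measurableI; first by apply: measurable_lt_set => //; exact: measurable_cst.
by apply: measurable_lt_set; [exact: measurable_cst|exact: measurable_sndR].
Qed.

Definition fund_bd : set (R * R) := @fund_dom R `\` @fund_domo R.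

Lemma measurable_fund_bd : measurable fund_bd.
Proof. exact: measurableD measurable_fund_dom measurable_fund_domo. Qed.

Lemma measurable_indicE (A : set (R * R)) : measurable A ->
  measurable_fun [set: R * R] (fun z => (\1_A z : R)%:E).
Proof. by move=> mA; apply/measurable_EFinP; exact: measurable_indic. Qed.

(** Each horizontal line meets the boundary in at most four points: two on the vertical sides, two
    on the unit circle. *)
Lemma hint_fund_bd : hint (fun z => (\1_fund_bd z)%:E) = 0%E.
Proof.
rewrite hintE; last 2 first.
- exact: measurable_indicE measurable_fund_bd.
- by move=> z; rewrite lee_fin.
apply: integral0_eq => y _.
suff -> : (\int[mu]_x (\1_fund_bd (x, y))%:E = 0)%E by rewrite mul0e.
pose s := Num.sqrt (1 - y ^+ 2).
pose A : set R := [set x | fund_bd (x, y)].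
have mA : measurable A.
  rewrite -[X in measurable X]setTI.
  have m1 : measurable_fun [set: R] (fun x : R => (x, y)) by exact: measurable_fun_pair.
  exact: (m1 measurableT _ measurable_fund_bd).
transitivity (\int[mu]_x (\1_A x)%:E)%E.
  apply: eq_integral => x _; rewrite !indicE.
  suff -> : ((x, y) \in fund_bd) = (x \in A) by [].
  by apply/idP/idP; rewrite !inE.
rewrite integral_indic// setIT.
pose B : set R := [set 2^-1] `|` [set - 2^-1] `|` ([set s] `|` [set - s]).
have AB : A `<=` B.
  move=> x; rewrite /A /fund_bd /= => -[[/= h1 [h2 h3]] h4].
  have [xh|xh] := eqVneq `|x| 2^-1.
    by left; move: xh; case: (ger0P x) => _ xh; [left|right]; rewrite /= -xh ?opprK.
  have [e|e] := eqVneq (x ^+ 2 + y ^+ 2) 1.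
    have sE : x ^+ 2 = s ^+ 2.
      by rewrite /s sqr_sqrtr -e; [ring|rewrite addrK sqr_ge0].
    by right; move/eqP: sE; rewrite eqf_sqr => /orP[/eqP ->|/eqP ->]; [left|right].
  exfalso; apply: h4; split => /=; first by rewrite lt_neqAle xh.
  by split => //; rewrite lt_neqAle eq_sym e.
have mB : measurable B by do 2 apply: measurableU; exact: measurable_set1.
have B0 : mu B = 0%E.
  apply: countable_lebesgue_measure0; apply: finite_set_countable.
  by rewrite !finite_setU; do !split; exact: finite_set1.
by apply/eqP; rewrite eq_le measure_ge0 andbT -B0 le_measure// inE.
Qed.

(** The count is 2 rather than 1 because a matrix and its negative act alike. If [m0] reduces [z],
    any other reducing [m] gives [m * m0^-1], which keeps an interior point interior and so is plus
    or minus the identity. *)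
Lemma SL2Z_count z : (forall m, SL2Z m -> ~ fund_bd (mact m z)) -> 0 < z.2 ->
  (\esum_(m in SL2Z) (\1_(@fund_dom R) (mact m z) : R)%:E = 2%:E :> \bar R)%E.
Proof.
move=> zg z0.
have [a [b [c [d [D h]]]]] := reduction z0.
pose m0 : mat := (a, b, c, d).
have ho : fund_domo (mact m0 z).
  by have := zg m0 D; rewrite /fund_bd /= => /not_andP[//|/contrapT].
pose m1 : mat := (- a, - b, - c, - d).
have D1 : SL2Z m1 by rewrite /SL2Z /mdet /mkset /= -D; ring.
have h1 : mact m1 z = mact m0 z.
  rewrite /mact /mobZ /mobR /mobden /= !mulrNz; congr pair; congr (_ / _); ring.
have m01 : m0 != m1.
  apply/eqP => -[ha hb hc hd]; move: D; have -> : a = 0 by lia.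
  have -> : b = 0 by lia. lia.
transitivity (\esum_(m in [set m0; m1]) (1%:E : \bar R))%E.
  rewrite esum_mkcond [RHS]esum_mkcond; apply: eq_esum => m _.
  case: (pselect ([set m0; m1] m)) => [mm|mm].
    rewrite (mem_set mm); case: mm => ->.
      by rewrite (mem_set (D : SL2Z m0)) indicE mem_set.
    by rewrite (mem_set D1) indicE mem_set// h1.
  rewrite (memNset mm); case: ifPn => // /set_mem Dm.
  rewrite indicE memNset// => hm; apply: mm.
  have hmo : fund_domo (mact m z).
    by have := zg m Dm; rewrite /fund_bd /= => /not_andP[//|/contrapT].
  case: m Dm hm hmo => [[[p q] r] s] Dm hm hmo.
  have Dm' : p * s - q * r = 1 by exact: Dm.
  pose w := mact m0 z.
  have w0 : 0 < w.2 by case: ho => _ [].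
  have zE : z = mobZ d (- b) (- c) a w.
    rewrite /w /mact /= mobZ_comp//; last 2 first.
    - by rewrite (_ : _ - _ = 1)// -D; ring.
    - by rewrite (_ : _ - _ = 1)// -D; ring.
    rewrite (_ : d * a + _ = 1); last by rewrite -D; ring.
    rewrite (_ : d * b + _ = 0); last by ring.
    rewrite (_ : - c * a + _ = 0); last by ring.
    rewrite (_ : - c * b + _ = 1); last by rewrite -D; ring.
    by rewrite mobZ_shift mulr0z addr0; case: (z).
  have := hmo; rewrite {1}zE /mact /= mobZ_comp//; last 2 first.
  - by rewrite Dm'.
  - by rewrite (_ : _ - _ = 1)// -D; ring.
  move=> /(fund_domo_unique _ ho) [].
    transitivity ((p * s - q * r) * (a * d - b * c)); first by ring.
    by rewrite D Dm'.
  move=> hb hc had haa.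
  set e := p * d + q * - c in hb hc had haa *.
  have [pE qE rE sE] : [/\ p = e * a, q = e * b, r = e * c & s = e * d].
    split.
    - transitivity (e * a + c * (p * - b + q * a)); last by rewrite hb mulr0 addr0.
      by rewrite /e -[LHS]mulr1 -D; ring.
    - transitivity (e * b + d * (p * - b + q * a)); last by rewrite hb mulr0 addr0.
      by rewrite /e -[LHS]mulr1 -D; ring.
    - transitivity (e * c + a * (r * d + s * - c)); last by rewrite hc mulr0 addr0.
      by rewrite had -[LHS]mulr1 -D; ring.
    - transitivity (e * d + b * (r * d + s * - c)); last by rewrite hc mulr0 addr0.
      by rewrite had -[LHS]mulr1 -D; ring.
  have [e1|e1] : e = 1 \/ e = -1.
    have : (e - 1) * (e + 1) = e * e - 1 by ring.
    rewrite haa subrr => /eqP.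
    by rewrite mulf_eq0 => /orP[/eqP|/eqP] h2; [left|right]; lia.
  - by left; rewrite /m0 pE qE rE sE e1 !mul1r.
  - by right; rewrite /m1 pE qE rE sE e1 !mulN1r.
rewrite esum_fset//= fsbigU0//=; last by move=> m [-> /= hm]; rewrite hm eqxx in m01.
by rewrite !fsbig_set1 -EFinD.
Qed.

Definition heckesum f z : R := f (hecke1 z) + f (hecke2 z) + f (hecke3 z).

(** On the coset of a neighbour [w], [f] is constantly [f w] and exactly two matrices land in the
    domain. *)
Lemma esum_M2Z_fund f z : modular f -> (forall z, 0 <= f z) -> 0 < z.2 ->
  (forall m, M2Z m -> ~ fund_bd (mact m z)) ->
  (\esum_(m in M2Z) (\1_(@fund_dom R) (mact m z) * f (mact m z))%:E = (2 * heckesum f z)%:E)%E.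
Proof.
move=> fm f0 z0 zg.
have h10 : 0 < (hecke1 z).2 by rewrite /= mulr_gt0.
have h20 : 0 < (hecke2 z).2 by rewrite /= divr_gt0.
have h30 : 0 < (hecke3 z).2 by rewrite /= divr_gt0.
have key (e : mat -> mat) w : 0 < w.2 -> (forall m, SL2Z m -> M2Z (e m) /\ mact (e m) z = mact m w) ->
    (\esum_(m in SL2Z) (\1_(@fund_dom R) (mact (e m) z) * f (mact (e m) z))%:E = (2 * f w)%:E)%E.
  move=> w0 he.
  transitivity (\esum_(m in SL2Z) ((f w)%:E * (\1_(@fund_dom R) (mact m w))%:E))%E.
    apply: eq_esum => m Dm; have [_ ->] := he _ Dm.
    by rewrite -EFinM mulrC; congr (_ * _)%:E; apply: fm.
  rewrite esum_countT//; last by move=> m _; rewrite -EFinM lee_fin mulr_ge0.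
  rewrite mulrC EFinM -(SL2Z_count (z := w))//; last first.
    by move=> m Dm; have [Dm' <-] := he _ Dm; exact: zg.
  rewrite [in RHS]esum_countT// -nneseriesZl; last first.
    by move=> n _; case: (pickle_inv n) => //= m; case: ifP.
  by apply: eq_eseriesr => n _; case: (pickle_inv n) => [m|] /=; [case: ifP|]; rewrite ?mule0.
rewrite esum_M2Z; last by move=> m; rewrite lee_fin mulr_ge0.
rewrite (key coset1 (hecke1 z))// ?(key coset2 (hecke2 z))// ?(key coset3 (hecke3 z))//.
- by rewrite -!EFinD /heckesum; congr EFin; ring.
- move=> [[[p q] r] s] D; split; first by move: D; rewrite /SL2Z /M2Z /mdet /mkset /=; lia.
  rewrite hecke3E /mact /= mobZ_comp//; last by move: D; rewrite /SL2Z /mdet /mkset /= => ->.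
  by congr (mobZ _ _ _ _ _); ring.
- move=> [[[p q] r] s] D; split; first by move: D; rewrite /SL2Z /M2Z /mdet /mkset /=; lia.
  rewrite hecke2E /mact /= mobZ_comp//; last by move: D; rewrite /SL2Z /mdet /mkset /= => ->.
  by congr (mobZ _ _ _ _ _); ring.
- move=> [[[p q] r] s] D; split; first by move: D; rewrite /SL2Z /M2Z /mdet /mkset /=; lia.
  rewrite hecke1E /mact /= mobZ_comp//; last by move: D; rewrite /SL2Z /mdet /mkset /= => ->.
  by congr (mobZ _ _ _ _ _); ring.
Qed.

End unfolding.

Section self_adjoint.
Context (R : realType).
Local Notation mu := (@lebesgue_measure R).
Local Notation phi := (\1_(@fund_dom R) : R * R -> R).
Implicit Types (z w : R * R) (f g : R * R -> R).

Lemma measurable_esum (T : countType) (D : set T) (F : T -> R * R -> \bar R) :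
  (forall i, measurable_fun [set: R * R] (F i)) -> (forall i z, 0 <= F i z)%E ->
  measurable_fun [set: R * R] (fun z => \esum_(i in D) F i z)%E.
Proof.
move=> mF F0.
pose G n z := oapp (fun i => if i \in D then F i z else 0%E) 0%E (pickle_inv (T := T) n).
have -> : (fun z => \esum_(i in D) F i z)%E = (fun z => \sum_(n <oo) G n z)%E.
  by apply/funext => z; rewrite esum_countT.
apply: (@ge0_emeasurable_sum _ _ _ _ G xpredT).
  by move=> n z _ _; rewrite /G; case: (pickle_inv n) => //= i; case: ifP.
move=> n _; rewrite /G; case: (pickle_inv n) => [i|] /=; last exact: measurable_cst.
by case: (i \in D); [exact: mF|exact: measurable_cst].
Qed.

(** The exceptional null set is presented as the set where a nonnegative function [B] of integral
    zero is positive, a form that suits the counting function [bad]. *)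
Lemma ae_eq_hint (F G : R * R -> \bar R) (B : R * R -> \bar R) :
  measurable_fun [set: R * R] F -> measurable_fun [set: R * R] G ->
  measurable_fun [set: R * R] B ->
  (forall z, 0 <= F z)%E -> (forall z, 0 <= G z)%E -> (forall z, 0 <= B z)%E ->
  hint B = 0%E -> (forall z, 0 < z.2 -> B z = 0%E -> F z = G z) -> hint F = hint G.
Proof.
move=> mF mG mB F0 G0 B0 hB FG.
have m H : measurable_fun [set: R * R] H ->
    measurable_fun [set: R * R] (fun z => H z * (inv_density z.2)%:E)%E.
  by move=> mH; apply: emeasurable_funM => //; exact: measurable_hdens.
have p H : (forall z, 0 <= H z)%E -> forall z, (0 <= H z * (inv_density z.2)%:E)%E.
  by move=> H0 z; rewrite mule_ge0// lee_fin inv_density_ge0.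
apply: ge0_ae_eq_integral => //; [exact: m|exact: m|by move=> z _; exact: p|by move=> z _; exact: p|].
have : ae_eq (mu \x mu)%E setT (fun z => B z * (inv_density z.2)%:E)%E (cst 0%E).
  apply/ae_eq_integral_abs => //; first exact: m.
  rewrite -[RHS]hB; apply: eq_integral => z _; rewrite gee0_abs//; exact: p.
apply: filterS => z /(_ I) /= Bz _.
have [z0|z0] := ltP 0 z.2; last by rewrite /inv_density ltNge z0 /= !mule0.
rewrite FG//; move/eqP: Bz; rewrite mule_eq0 => /orP[/eqP//|].
by rewrite /inv_density z0 eqe invr_eq0 expf_eq0 /= gt_eqF.
Qed.

Let bad z : \bar R := \esum_(m in M2Z) (\1_(@fund_bd R) (mact m z))%:E.

Let mbad1 m : measurable_fun [set: R * R] (fun z => (\1_(@fund_bd R) (mact m z) : R)%:E).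
Proof.
apply: (measurableT_comp (f := fun z => (\1_(@fund_bd R) z : R)%:E)).
  exact: measurable_indicE (@measurable_fund_bd R).
exact: measurable_mact.
Qed.

Let hint_bad : hint bad = 0%E.
Proof.
rewrite /bad hint_esum//; apply: esum1 => m Dm.
rewrite (@hint_mact _ m (fun z => (\1_(@fund_bd R) z : R)%:E))//.
- exact: hint_fund_bd.
- by rewrite Dm.
- exact: measurable_indicE (@measurable_fund_bd R).
Qed.

Let badP z m : bad z = 0%E -> M2Z m -> ~ fund_bd (mact m z).
Proof.
move=> b0 Dm mb; suff : (1%:E <= bad z)%E by rewrite b0 lee_fin ler10.
apply: esum_ge; exists [set m]; first by split; [exact: finite_set1|move=> _ ->].
by rewrite fsbig_set1 indicE mem_set.
Qed.

Lemma measurable_heckesum f : measurable_fun [set: R * R] f ->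
  measurable_fun [set: R * R] (heckesum f).
Proof.
move=> mf; have c (k : R) : measurable_fun [set: R * R] (cst k : R * R -> R) by exact: measurable_cst.
have m1 := @measurable_fstR R; have m2 := @measurable_sndR R.
apply: measurable_funD; first apply: measurable_funD; apply: (measurableT_comp mf);
  apply: measurable_pairR; apply: measurable_funM => //; exact: measurable_funD.
Qed.

Let mphi : measurable_fun [set: R * R] phi.
Proof. exact: measurable_indic (@measurable_fund_dom R). Qed.

Let mcomp f m : measurable_fun [set: R * R] f -> measurable_fun [set: R * R] (fun z => f (mact m z)).
Proof. by move=> mf; apply: (measurableT_comp mf); exact: measurable_mact. Qed.

(** Writing the Hecke sum over all matrices of determinant 2, with the indicator of the domain at
    the image point, makes the roles of [f] and [g] alike up to a change of variable. *)
Let unfold f g : measurable_fun [set: R * R] f -> measurable_fun [set: R * R] g ->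
  (forall z, 0 <= f z) -> (forall z, 0 <= g z) -> modular f ->
  (2%:E * hint (fun z => (phi z * g z * heckesum f z)%:E) =
   \esum_(m in M2Z) hint (fun z => (phi z * g z * (phi (mact m z) * f (mact m z)))%:E))%E.
Proof.
move=> mf mg f0 g0 fm.
have t0 z : 0 <= heckesum f z by rewrite /heckesum !addr_ge0.
have p0 z : 0 <= phi z * g z by rewrite mulr_ge0.
have q0 m z : 0 <= phi (mact m z) * f (mact m z) by rewrite mulr_ge0.
have mt := measurable_heckesum mf.
have mpg : measurable_fun [set: R * R] (fun z => phi z * g z) by exact: measurable_funM.
have mq m : measurable_fun [set: R * R] (fun z => phi (mact m z) * f (mact m z)).
  by apply: measurable_funM; exact: mcomp.
rewrite -hint_esum; last 2 first.
- by move=> m; apply/measurable_EFinP; exact: measurable_funM.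
- by move=> m z; rewrite lee_fin mulr_ge0.
transitivity (hint (fun z => (phi z * g z)%:E * (2 * heckesum f z)%:E))%E.
  rewrite /hint -ge0_integralZl//; last 2 first.
  - apply: emeasurable_funM; last exact: measurable_hdens.
    by apply/measurable_EFinP; exact: measurable_funM.
  - by move=> z _; rewrite mule_ge0 ?lee_fin ?mulr_ge0// inv_density_ge0.
  apply: eq_integral => z _; rewrite muleA; congr (_ * _)%E.
  by rewrite -!EFinM; congr EFin; ring.
transitivity (hint (fun z => (phi z * g z)%:E *
    \esum_(m in M2Z) (phi (mact m z) * f (mact m z))%:E))%E.
  apply: (ae_eq_hint (B := bad)).
  - apply/measurable_EFinP; apply: measurable_funM => //.
    by apply: measurable_funM => //; exact: measurable_cst.
  - apply: emeasurable_funM; first exact/measurable_EFinP.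
    by apply: measurable_esum => [m|m z]; [exact/measurable_EFinP|rewrite lee_fin].
  - by apply: measurable_esum => // m z; rewrite lee_fin.
  - by move=> z; rewrite mule_ge0 ?lee_fin ?mulr_ge0.
  - by move=> z; apply: mule_ge0; [rewrite lee_fin|apply: esum_ge0 => m _; rewrite lee_fin].
  - by move=> z; apply: esum_ge0 => m _; rewrite lee_fin.
  - exact: hint_bad.
  - by move=> z z0 bz; rewrite esum_M2Z_fund// => m Dm; exact: badP.
apply: eq_hint => z _.
rewrite !esum_countT -?nneseriesZl//; try by move=> m _; rewrite lee_fin.
- by apply: eq_eseriesr => n _; case: (pickle_inv n) => [m|] /=; [case: ifP|]; rewrite ?mule0.
- by move=> n _; case: (pickle_inv n) => //= m; case: ifP => //; rewrite lee_fin.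
- by move=> m _; rewrite lee_fin mulr_ge0.
Qed.

Lemma hint_hecke_sym f g : measurable_fun [set: R * R] f -> measurable_fun [set: R * R] g ->
  (forall z, 0 <= f z) -> (forall z, 0 <= g z) -> modular f -> modular g ->
  hint (fun z => (phi z * g z * heckesum f z)%:E) =
  hint (fun z => (phi z * f z * heckesum g z)%:E).
Proof.
move=> mf mg f0 g0 fm gm.
have half (a b : \bar R) : (2%:E * a = 2%:E * b)%E -> a = b.
  move=> h; have h2 c : (2^-1%:E * (2%:E * c) = c :> \bar R)%E.
    by rewrite muleA -EFinM mulVf ?mul1e.
  by rewrite -(h2 a) h h2.
apply: half; rewrite !unfold//.
(* The adjugate acts as the inverse, the product being the scalar matrix 2. Replacing [m] by its
   adjugate on one side and substituting in the integral exchanges [f] and [g]. *)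
rewrite (reindex_esum M2Z M2Z madj); last first.
  split.
  - by move=> [[[p q] r] s]; rewrite /M2Z /mdet /mkset /= => <-; ring.
  - by move=> [[[p q] r] s] [[[p' q'] r'] s'] _ _ [] *; congr (_, _, _, _); lia.
  - move=> [[[p q] r] s] D; exists (s, - q, - r, p); last by rewrite /madj /= !opprK.
    by move: D; rewrite /M2Z /mdet /mkset /= => <-; ring.
apply: eq_esum => m Dm.
have Dm' : M2Z (madj m).
  by move: Dm; case: m => [[[p q] r] s]; rewrite /M2Z /mdet /mkset /= => <-; ring.
have mm z : 0 < z.2 -> mact m (mact (madj m) z) = z.
  case: m Dm Dm' => [[[p q] r] s]; rewrite /M2Z /mdet /mkset /madj /mact /= => Dm Dm' z0.
  rewrite mobZ_comp//; [|by rewrite Dm|by rewrite Dm'].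
  rewrite (_ : p * s + _ = 2); last by rewrite -Dm; ring.
  rewrite (_ : p * - q + _ = 0); last by ring.
  rewrite (_ : r * s + _ = 0); last by ring.
  rewrite (_ : r * - q + _ = 2); last by rewrite -Dm; ring.
  rewrite /mobZ /mobR /mobden mulr0z; case: (z) => x y /=.
  by congr pair; field.
rewrite -(@hint_mact _ (madj m) (fun z => (phi z * f z * (phi (mact m z) * g (mact m z)))%:E))//.
- apply: eq_hint => z z0; rewrite mm//; congr EFin; ring.
- by rewrite Dm'.
- apply/measurable_EFinP; apply: measurable_funM; apply: measurable_funM => //; exact: mcomp.
- by move=> z; rewrite lee_fin !mulr_ge0.
Qed.

End self_adjoint.

(** * Means of modular functions *)

Section area.
Context (R : realType).
Local Notation mu := (@lebesgue_measure R).
Local Notation FD := (@fund_dom R).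
Local Notation phi := (\1_(@fund_dom R) : R * R -> R).
Implicit Types (z w : R * R) (f g : R * R -> R).

Lemma cos_pi3 : cos (pi / 3) = 2^-1 :> R.
Proof.
have pi0 := @pi_gt0 R.
have h1 : cos (pi / 3 *+ 2) = - cos (pi / 3) :> R.
  have -> : pi / 3 *+ 2 = - (pi / 3) + pi :> R by field.
  by rewrite cosDpi cosN.
have h2 : 0 < cos (pi / 3) :> R.
  by apply: cos_gt0_pihalf; apply/andP; split; lra.
move: h1; rewrite cos_mulr2n => h1.
have : (cos (pi / 3) + 1) * (2 * cos (pi / 3) - 1) = 0 :> R.
  by move: h1 => /eqP; rewrite -subr_eq0 => /eqP <-; ring.
by move=> /eqP; rewrite mulf_eq0 => /orP[/eqP|/eqP] h; lra.
Qed.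

Lemma asin_half : asin 2^-1 = pi / 6 :> R.
Proof.
have pi0 := @pi_gt0 R.
have -> : 2^-1 = sin (pi / 6) :> R.
  by rewrite -cosBpihalf -[LHS]cos_pi3 -[LHS]cosN; congr cos; field.
by rewrite sinK// in_itv/=; apply/andP; split; lra.
Qed.

Lemma asinN_half : asin (- 2^-1) = - (pi / 6) :> R.
Proof.
have pi0 := @pi_gt0 R.
have -> : - 2^-1 = sin (- (pi / 6)) :> R.
  by rewrite sinN; congr (- _); rewrite -cosBpihalf -[LHS]cos_pi3 -[LHS]cosN; congr cos; field.
by rewrite sinK// in_itv/=; apply/andP; split; lra.
Qed.

(** Over the abscissa [x] the domain starts at height [sqrt (1 - x^2)], so the inner integral of
    [1 / y^2] is [1 / sqrt (1 - x^2)], with antiderivative [asin]. *)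
Lemma hint_fund_dom : hint (fun z => (phi z)%:E) = (pi / 3)%:E.
Proof.
have mphi : measurable_fun [set: R * R] (fun z => (phi z)%:E).
  exact: measurable_indicE (@measurable_fund_dom R).
rewrite /hint (@fubini_tonelli1 _ _ (measurableTypeR R) (measurableTypeR R) R mu mu); last 2 first.
- by apply: emeasurable_funM => //; exact: measurable_hdens.
- by move=> z; rewrite mule_ge0// lee_fin inv_density_ge0.
rewrite /fubini_F /=.
transitivity (\int[mu]_(x in `[(- 2^-1)%R, (2^-1)%R]) ((Num.sqrt (1 - x ^+ 2))^-1)%:E)%E.
  rewrite [RHS]integral_mkcond; apply: eq_integral => x _; rewrite patchE.
  case: ifPn => [/set_mem|]; last first.
    rewrite notin_setE /= in_itv/= -ler_norml => /negP xn.
    apply: integral0_eq => y _; rewrite indicE memNset ?mul0e//.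
    by move=> [/= h _]; rewrite h in xn.
  rewrite /= in_itv/= -ler_norml => xh.
  have x2 : x ^+ 2 <= 4^-1.
    rewrite -real_normK ?num_real// (_ : 4^-1 = 2^-1 ^+ 2); last by field.
    by rewrite ler_pXn2r ?nnegrE.
  set s := Num.sqrt (1 - x ^+ 2).
  have s0 : 0 < s by rewrite sqrtr_gt0; lra.
  have sV0 : 0 < s^-1 by rewrite invr_gt0.
  (* After [y -> 1 / y] the half-line [y >= s] becomes an interval, whose length is the inner
     integral. *)
  pose F : R -> \bar R := fun t => (\1_(`]0, s^-1] : set R) t)%:E.
  transitivity (\int[mu]_y (F y^-1%R * (inv_density y)%:E))%E.
    apply: eq_integral => y _.
    have [y0|y0] := ltP 0 y; last by rewrite /inv_density ltNge y0 /= !mule0.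
    congr (_ * _)%E; rewrite /F !indicE; congr (_%:R%:E).
    suff -> : ((x, y) \in FD) = (y^-1 \in (`]0, s^-1]%classic : set R)) by [].
    have ys : (s <= y) = (1 <= x ^+ 2 + y ^+ 2).
      have -> : (s <= y) = (s ^+ 2 <= y ^+ 2) by rewrite ler_pXn2r// nnegrE ltW.
      rewrite /s sqr_sqrtr; last lra.
      by rewrite lerBlDl.
    apply/idP/idP; rewrite !inE /= in_itv/= invr_gt0 y0 /= lef_pV2 ?posrE// ys.
      by move=> [_ []].
    by move=> h; split.
  rewrite ge0_integral_inv//; last by move=> t; rewrite lee_fin.
  rewrite /F integral_indic// setIC (_ : _ `&` _ = `]0, s^-1]%classic).
    by rewrite [LHS](lebesgue_measure_itv `]0, s^-1])/= lte_fin sV0 sube0.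
  - by apply/seteqP; split => t /=; rewrite !in_itv/= andbT; [case|move=> /andP[-> ->]].
  - by apply/measurable_EFinP; exact: measurable_indic.
have bnd x : x \in `[(- 2^-1), 2^-1 : R] -> -1 < x < 1.
  by rewrite in_itv/= => /andP[h1 h2]; apply/andP; split; lra.
rewrite (@continuous_FTC2 _ _ (@asin R))//.
- by rewrite asin_half asinN_half -EFinB; congr EFin; field.
- lra.
- apply: continuous_in_subspaceT => x; rewrite inE /= => /bnd /andP[h1 h2].
  have x2 : x ^+ 2 < 1 by rewrite -(real_normK (num_real x)) exprn_ilt1// ltr_norml h1.
  apply: (@continuousV _ _ (fun x : R => Num.sqrt (1 - x ^+ 2))).
    by rewrite gt_eqF// sqrtr_gt0 subr_gt0.
  apply: continuous_comp; last exact: sqrt_continuous.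
  by apply: continuousB; [exact: cst_continuous|exact: exprn_continuous].
- split.
  + move=> x /(subset_itvW _ _ (lexx _) (lexx _)) /bnd hx.
    by have [] := is_derive1_asin hx.
  + apply: cvg_at_right_filter; apply: continuous_asin; apply: bnd.
    by rewrite in_itv/=; apply/andP; split; lra.
  + apply: cvg_at_left_filter; apply: continuous_asin; apply: bnd.
    by rewrite in_itv/=; apply/andP; split; lra.
- move=> x /(subset_itvW _ _ (lexx _) (lexx _)) /bnd hx.
  by rewrite derive1E; have [] := is_derive1_asin hx.
Qed.

End area.

Section modular_integral.
Context (R : realType).
Local Notation mu := (@lebesgue_measure R).
Local Notation FD := (@fund_dom R).
Local Notation phi := (\1_(@fund_dom R) : R * R -> R).
Local Notation T2 := (measurableTypeR R * measurableTypeR R)%type.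
Implicit Types (z w : R * R) (f g : R * R -> R).

Definition bounded_measurable f :=
  measurable_fun [set: R * R] f /\ exists M, forall z, `|f z| <= M.

Lemma bm_cst (c : R) : bounded_measurable (fun=> c).
Proof. by split; [exact: measurable_cst|exists `|c|]. Qed.

Lemma bm_add f g : bounded_measurable f -> bounded_measurable g ->
  bounded_measurable (fun z => f z + g z).
Proof.
move=> [mf [M fM]] [mg [N gN]]; split; first exact: measurable_funD.
by exists (M + N) => z; rewrite (le_trans (ler_normD _ _))// lerD.
Qed.

Lemma bm_mul f g : bounded_measurable f -> bounded_measurable g ->
  bounded_measurable (fun z => f z * g z).
Proof.
move=> [mf [M fM]] [mg [N gN]]; split; first exact: measurable_funM.
by exists (M * N) => z; rewrite normrM ler_pM.
Qed.

Lemma bm_opp f : bounded_measurable f -> bounded_measurable (fun z => - f z).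
Proof.
move=> [mf [M fM]]; split; first exact: measurable_funN.
by exists M => z; rewrite normrN.
Qed.

Lemma bm_hecke f : bounded_measurable f -> bounded_measurable (heckesum f).
Proof.
move=> [mf [M fM]]; split; first exact: measurable_heckesum.
exists (M + M + M) => z; rewrite /heckesum.
by rewrite (le_trans (ler_normD _ _))// lerD// (le_trans (ler_normD _ _))// lerD.
Qed.

Lemma bm_comp f (h : R * R -> R * R) : measurable_fun [set: R * R] h ->
  bounded_measurable f -> bounded_measurable (fun z => f (h z)).
Proof.
move=> mh [mf [M fM]]; split; first exact: measurableT_comp.
by exists M.
Qed.

Definition imu f : R := (\int[(mu \x mu)%E]_(z in FD) (f z / z.2 ^+ 2))%R.

Let den z : R := (z.2 ^+ 2)^-1.

Let mden : measurable_fun [set: R * R] den.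
Proof.
apply: (measurableT_comp (@measurable_invr R)).
by apply: measurable_funX; exact: measurable_sndR.
Qed.

Let den_ge0 z : 0 <= den z. Proof. by rewrite invr_ge0 sqr_ge0. Qed.

Lemma hint_fund_domE f : (forall z, 0 <= f z) -> measurable_fun [set: R * R] f ->
  hint (fun z => (phi z * f z)%:E) = (\int[(mu \x mu)%E]_(z in FD) (f z / z.2 ^+ 2)%:E)%E.
Proof.
move=> f0 mf; rewrite [RHS]integral_mkcond; apply: eq_integral => z _.
rewrite patchE indicE; case: ifPn => [/set_mem [_ [_ z0]]|_]; last by rewrite mul0r mul0e.
by rewrite mul1r -EFinM /inv_density z0.
Qed.

Let iden : (mu \x mu)%E.-integrable FD (EFin \o den).
Proof.
apply/integrableP; split.
  by apply/measurable_funTS/measurable_EFinP.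
have -> : (\int[(mu \x mu)%E]_(z in FD) `|(EFin \o den) z| =
    \int[(mu \x mu)%E]_(z in FD) (1 / z.2 ^+ 2)%:E)%E.
  by apply: eq_integral => z _; rewrite /= ger0_norm// div1r.
rewrite -(@hint_fund_domE (fun=> 1) (fun=> ler01) (bm_cst 1).1).
have -> : (fun z => (phi z * 1)%:E) = (fun z => (phi z)%:E).
  by apply/funext => z; rewrite mulr1.
by rewrite hint_fund_dom ltry.
Qed.

Lemma imu_integrable f : bounded_measurable f ->
  (mu \x mu)%E.-integrable FD (EFin \o (fun z => f z / z.2 ^+ 2)).
Proof.
move=> [mf [M fM]].
have M0 : 0 <= M by exact: le_trans (fM (0, 0)).
apply: (@le_integrable _ T2 R (mu \x mu)%E FD (@measurable_fund_dom R) _ (fun z => M%:E * (EFin \o den) z)%E).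
- by apply/measurable_funTS/measurable_EFinP; exact: measurable_funM.
- move=> z _ /=; rewrite lee_fin normrM [leRHS]ger0_norm ?mulr_ge0 ?den_ge0//.
  by rewrite (ger0_norm (den_ge0 z)) ler_wpM2r ?den_ge0.
- by apply: integrableZl => //; exact: measurable_fund_dom.
Qed.

Lemma imu_hint f : (forall z, 0 <= f z) -> bounded_measurable f ->
  hint (fun z => (phi z * f z)%:E) = (imu f)%:E.
Proof.
move=> f0 bf; rewrite (hint_fund_domE f0 bf.1) /imu /Rintegral fineK//.
apply: integrable_fin_num; first exact: measurable_fund_dom.
exact: imu_integrable.
Qed.

Lemma imuD f g : bounded_measurable f -> bounded_measurable g ->
  imu (fun z => f z + g z) = imu f + imu g.
Proof.
move=> bf bg; rewrite /imu -RintegralD//; last 3 first.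
- exact: measurable_fund_dom.
- exact: imu_integrable.
- exact: imu_integrable.
by apply: eq_Rintegral => z _; rewrite mulrDl.
Qed.

Lemma imuZ (k : R) f : bounded_measurable f -> imu (fun z => k * f z) = k * imu f.
Proof.
move=> bf; rewrite /imu -RintegralZl//; last 2 first.
- exact: measurable_fund_dom.
- exact: imu_integrable.
by apply: eq_Rintegral => z _; rewrite mulrA.
Qed.

Lemma le_imu f g : bounded_measurable f -> bounded_measurable g ->
  (forall z, FD z -> f z <= g z) -> imu f <= imu g.
Proof.
move=> bf bg fg; apply: le_Rintegral => //.
- exact: measurable_fund_dom.
- exact: imu_integrable.
- exact: imu_integrable.
- by move=> z zF; rewrite ler_wpM2r ?den_ge0// fg.
Qed.

Lemma eq_imu f g : (forall z, FD z -> f z = g z) -> imu f = imu g.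
Proof. by move=> fg; apply: eq_Rintegral => z /set_mem zF; rewrite fg. Qed.

Lemma imu_cst (c : R) : imu (fun=> c) = c * (pi / 3).
Proof.
have -> : imu (fun=> c) = c * imu (fun=> 1).
  by rewrite -(@imuZ _ (fun=> 1)); [apply: eq_imu => z _; rewrite mulr1|exact: bm_cst].
congr (_ * _); apply: EFin_inj; rewrite -imu_hint//; last exact: bm_cst.
by rewrite -hint_fund_dom; congr hint; apply/funext => z; rewrite mulr1.
Qed.

Lemma imu_ge0 f : (forall z, FD z -> 0 <= f z) -> 0 <= imu f.
Proof. by move=> f0; apply: Rintegral_ge0 => z zF; rewrite mulr_ge0 ?den_ge0 ?f0. Qed.

Lemma imu_cvg0 (f : nat -> R * R -> R) (M : R) : (forall k, measurable_fun [set: R * R] (f k)) ->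
  (forall k z, `|f k z| <= M) -> (forall z, FD z -> f k z @[k --> \oo] --> 0) ->
  imu (f k) @[k --> \oo] --> 0.
Proof.
move=> mf fM f0.
have mE k : measurable_fun FD (EFin \o (fun z => f k z / z.2 ^+ 2)).
  by apply/measurable_funTS/measurable_EFinP; apply: measurable_funM.
have c0 : {ae (mu \x mu)%E, forall z, FD z -> (EFin \o (fun z => f k z / z.2 ^+ 2)) z @[k --> \oo] --> (cst 0%E : R * R -> \bar R) z}.
  apply: aeW => z zF; apply/fine_cvgP; split; first exact: nearW.
  rewrite [X in _ --> X](_ : _ = 0 * (z.2 ^+ 2)^-1); last by rewrite mul0r.
  by apply: cvgM; [exact: f0|exact: cvg_cst].
have dom : {ae (mu \x mu)%E, forall z, forall k, FD z ->
    (`|(f k z / z.2 ^+ 2)%R%:E| <= M%:E * (EFin \o den) z)%E}.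
  apply: aeW => z k zF /=; rewrite lee_fin normrM (ger0_norm (den_ge0 z)).
  by rewrite ler_wpM2r ?den_ge0.
have mF : measurable (FD : set T2) by exact: measurable_fund_dom.
have idM := @integrableZl _ T2 R (mu \x mu)%E FD mF M _ iden.
have [_ _ h] := @dominated_convergence _ T2 R (mu \x mu)%E FD mF _ (cst 0%E) _
  mE (measurable_cst _) c0 idM dom.
rewrite integral0_eq// in h.
have : (imu (f k))%:E @[k --> \oo] --> 0%:E.
  apply: cvg_trans h; apply: near_eq_cvg; apply: nearW => k.
  rewrite /imu /Rintegral fineK//.
  apply: integrable_fin_num; first exact: measurable_fund_dom.
  apply: imu_integrable.
  by split => //; exists M.
by move/fine_cvg.
Qed.

Lemma imu_hecke_sym f g : bounded_measurable f -> bounded_measurable g ->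
  modular f -> modular g ->
  imu (fun z => g z * heckesum f z) = imu (fun z => f z * heckesum g z).
Proof.
(* Unfolding handles nonnegative functions only. Bounded ones are made nonnegative by adding
   constants; the cross terms then cancel by [int3], itself the case where one function is
   constant. *)
have pos f1 g1 : bounded_measurable f1 -> bounded_measurable g1 ->
    (forall z, 0 <= f1 z) -> (forall z, 0 <= g1 z) -> modular f1 -> modular g1 ->
    imu (fun z => g1 z * heckesum f1 z) = imu (fun z => f1 z * heckesum g1 z).
  move=> bf bg f0 g0 fm gm; apply: EFin_inj; rewrite -!imu_hint.
  - have := hint_hecke_sym bf.1 bg.1 f0 g0 fm gm.
    by under eq_fun do rewrite -mulrA; under [in RHS]eq_fun do rewrite -mulrA.
  - by move=> z; rewrite mulr_ge0// /heckesum !addr_ge0.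
  - by apply: bm_mul => //; exact: bm_hecke.
  - by move=> z; rewrite mulr_ge0// /heckesum !addr_ge0.
  - by apply: bm_mul => //; exact: bm_hecke.
have mcst (c : R) : modular (fun=> c) by [].
have shift f1 (c : R) : heckesum (fun z => f1 z + c) = (fun z => heckesum f1 z + 3 * c).
  by apply/funext => z; rewrite /heckesum; ring.
have modD f1 c : modular f1 -> modular (fun z => f1 z + c).
  by move=> fm a b c' d z D z0; rewrite fm.
have int3 f1 : bounded_measurable f1 -> modular f1 -> imu (heckesum f1) = 3 * imu f1.
  move=> bf fm; have [_ [M fM]] := bf.
  have bfM : bounded_measurable (fun z => f1 z + M) by apply: bm_add => //; exact: bm_cst.
  have := pos _ (fun=> 1) bfM (bm_cst 1) _ _ (modD _ M fm) (mcst 1).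
  have f0 z : 0 <= f1 z + M by have := fM z; rewrite ler_norml => /andP[]; lra.
  move=> /(_ f0 (fun=> ler01)).
  rewrite shift (eq_imu (g := fun z => heckesum f1 z + 3 * M)); last by move=> z _; rewrite mul1r.
  rewrite imuD; [|exact: bm_hecke|exact: bm_cst].
  rewrite (eq_imu (f := fun z => (f1 z + M) * _) (g := fun z => 3 * (f1 z + M))); last first.
    by move=> z _; rewrite /heckesum; ring.
  rewrite imuZ// imuD//; last exact: bm_cst.
  by rewrite !imu_cst; lra.
move=> bf bg fm gm; have [_ [M fM]] := bf; have [_ [N gN]] := bg.
have bfM : bounded_measurable (fun z => f z + M) by apply: bm_add => //; exact: bm_cst.
have bgN : bounded_measurable (fun z => g z + N) by apply: bm_add => //; exact: bm_cst.
have f0 z : 0 <= f z + M by have := fM z; rewrite ler_norml => /andP[]; lra.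
have g0 z : 0 <= g z + N by have := gN z; rewrite ler_norml => /andP[]; lra.
have := pos _ _ bfM bgN f0 g0 (modD _ _ fm) (modD _ _ gm); rewrite !shift.
have expand f1 g1 (A B : R) : bounded_measurable f1 -> bounded_measurable g1 -> modular f1 ->
    imu (fun z => (g1 z + B) * (heckesum f1 z + 3 * A)) =
    imu (fun z => g1 z * heckesum f1 z) + (B * (3 * imu f1) + 3 * A * imu g1 + 3 * A * B * (pi / 3)).
  move=> bf1 bg1 fm1; have bt := bm_hecke bf1.
  rewrite (eq_imu (g := fun z => g1 z * heckesum f1 z + (B * heckesum f1 z + (3 * A * g1 z + 3 * A * B)))); last first.
    by move=> z _; ring.
  have b1 : bounded_measurable (fun z => B * heckesum f1 z) by apply: bm_mul => //; exact: bm_cst.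
  have b2 : bounded_measurable (fun z => 3 * A * g1 z) by apply: bm_mul => //; exact: bm_cst.
  have b3 := bm_cst (3 * A * B).
  rewrite imuD; [|exact: bm_mul|by apply: bm_add => //; exact: bm_add].
  rewrite imuD; [|by []|exact: bm_add].
  by rewrite imuD// (imuZ B bt) int3// (imuZ (3 * A) bg1) imu_cst; ring.
by rewrite !expand//; lra.
Qed.

Lemma imu_hecke f : bounded_measurable f -> modular f -> imu (heckesum f) = 3 * imu f.
Proof.
move=> bf fm; have := imu_hecke_sym bf (bm_cst 1) fm (fun _ _ _ _ _ _ _ => erefl).
rewrite (eq_imu (g := heckesum f)); last by move=> z _; rewrite mul1r.
move=> ->; rewrite -imuZ//; apply: eq_imu => z _; rewrite /heckesum; ring.
Qed.

End modular_integral.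

(** * Decay of Hecke averages *)

Section hecke_recursion.
Context (R : realType).
Implicit Types (z w : R * R) (f g : R * R -> R).

(* [udist z w = 4 sinh^2 (d(z, w) / 2)] for the hyperbolic distance [d]. *)
Definition udist z w : R :=
  ((z.1 - w.1) ^+ 2 + (z.2 - w.2) ^+ 2) / (z.2 * w.2).

Lemma udist_mobR (a b c d : R) z w : 0 < a * d - b * c -> 0 < z.2 -> 0 < w.2 ->
  udist (mobR a b c d z) (mobR a b c d w) = udist z w.
Proof.
move=> D z0 w0; have D0 : a * d - b * c != 0 by rewrite gt_eqF.
have e0 : mobden c d z != 0 by rewrite gt_eqF// (mobden_gt0 z0 D0).
have e0' : mobden c d w != 0 by rewrite gt_eqF// (mobden_gt0 w0 D0).
have y0 : z.2 != 0 by rewrite gt_eqF.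
have y0' : w.2 != 0 by rewrite gt_eqF.
rewrite /udist /mobR /=.
have H (X X' Dt y y' e e' q : R) : Dt != 0 -> y != 0 -> y' != 0 -> e != 0 -> e' != 0 ->
    (X * e' - X' * e) ^+ 2 + Dt ^+ 2 * (y * e' - y' * e) ^+ 2 = Dt ^+ 2 * (e * e') * q ->
    ((X / e - X' / e') ^+ 2 + (Dt * y / e - Dt * y' / e') ^+ 2) / (Dt * y / e * (Dt * y' / e')) = q / (y * y').
  move=> h1 h2 h3 h4 h5 hq.
  have -> : (X / e - X' / e') ^+ 2 + (Dt * y / e - Dt * y' / e') ^+ 2 =
      ((X * e' - X' * e) ^+ 2 + Dt ^+ 2 * (y * e' - y' * e) ^+ 2) / (e * e') ^+ 2.
    by field; rewrite h4 h5.
  by rewrite hq; field; rewrite h1 h2 h3 h4 h5.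
apply: H => //; rewrite /mobden; case: z {z0 e0 y0} => x y; case: w {w0 e0' y0'} => x' y' /=.
ring.
Qed.

(** A modulus of continuity for the invariant distance: the Hecke maps preserve [udist], so all
    iterates keep the modulus of [f] up to a factor 2. *)
Definition osc f (d e : R) := forall z w, 0 < z.2 -> 0 < w.2 ->
  udist z w < d -> `|f z - f w| <= e.

Lemma udist_mobZ (a b c d : int) z w : 0 < a * d - b * c -> 0 < z.2 -> 0 < w.2 ->
  udist (mobZ a b c d z) (mobZ a b c d w) = udist z w.
Proof. by move=> D; apply: udist_mobR; rewrite detZR ltr0z. Qed.

Lemma hecke_gt0 z : 0 < z.2 ->
  [/\ 0 < (hecke1 z).2, 0 < (hecke2 z).2 & 0 < (hecke3 z).2].
Proof. by move=> z0; split; rewrite /= ?divr_gt0 ?mulr_gt0. Qed.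

Lemma osc_hecke f d e : osc f d e ->
  [/\ osc (fun z => f (hecke1 z)) d e, osc (fun z => f (hecke2 z)) d e &
      osc (fun z => f (hecke3 z)) d e].
Proof.
move=> o; split=> z w z0 w0 zw; have [h1 h2 h3] := hecke_gt0 z0;
  have [k1 k2 k3] := hecke_gt0 w0; apply: o => //.
- by rewrite !hecke1E udist_mobZ.
- by rewrite !hecke2E udist_mobZ.
- by rewrite !hecke3E udist_mobZ.
Qed.

Lemma heckesum_modular f : modular f -> modular (heckesum f).
Proof.
move=> fm; apply: modular_gen => z z0; rewrite /heckesum.
  by have [-> -> ->] := hecke_shift fm z0; ring.
by have [-> -> ->] := hecke_inversion fm z0; ring.
Qed.

Definition Uop f z : R := (f (hecke2 z) + f (hecke3 z)) / 2.

(* [wseq f k z] is [2 ^ - k] times the sum of [f ((a z + b) / d)] over [a d = 2 ^ k]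
   and [b] mod [d]. *)
Fixpoint wseq f (k : nat) : R * R -> R :=
  if k is k'.+1 then fun z => iter k Uop f z + 2^-1 * wseq f k' (hecke1 z) else f.

Lemma wseqS f k z : wseq f k.+1 z = iter k.+1 Uop f z + 2^-1 * wseq f k (hecke1 z).
Proof. by []. Qed.

Lemma wseq_rec0 f z : 2 * wseq f 1 z = heckesum f z.
Proof. by rewrite /= /heckesum /Uop; field. Qed.

Let hecke12 z : hecke1 (hecke2 z) = z.
Proof. by case: z => x y; rewrite /hecke1 /hecke2 /=; congr pair; field. Qed.

Let hecke13 z : hecke1 (hecke3 z) = (z.1 + 1, z.2).
Proof. by case: z => x y; rewrite /hecke1 /hecke3 /=; congr pair; field. Qed.

(** The recursion [T_2 T_{2^{k+1}} = T_{2^{k+2}} + 2 T_{2^k}] in the normalisation of [wseq]: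
    [hecke1] undoes [hecke2], and undoes [hecke3] up to a unit translation. Modularity at [k] is a
    hypothesis because it is proved by an induction that uses this recursion. *)
Let wseq_rec_aux f k z : modular (wseq f k) -> 0 < z.2 ->
  2 * wseq f k.+2 z = heckesum (wseq f k.+1) z - wseq f k z.
Proof.
move=> wm z0; rewrite /heckesum [in LHS]wseqS.
rewrite (wseqS f k (hecke2 z)) (wseqS f k (hecke3 z)) hecke12 hecke13 (modular_shift wm)//.
by rewrite [in LHS]iterS /Uop; field.
Qed.

Lemma wseq_modular f k : modular f -> modular (wseq f k).
Proof.
move=> fm; suff [] : modular (wseq f k) /\ modular (wseq f k.+1) by [].
elim: k => [|k [m0 m1]]; split=> //.
  move=> a b c d z D z0; have m : modular (heckesum f) by exact: heckesum_modular.
  have h1 := wseq_rec0 f (mobZ a b c d z); have h2 := wseq_rec0 f z.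
  by have h3 := m a b c d z D z0; lra.
move=> a b c d z D z0; have m := heckesum_modular m1.
have w0 : 0 < (mobZ a b c d z).2 by apply: mobZ_gt0 => //; rewrite D.
have h1 := wseq_rec_aux m0 w0; have h2 := wseq_rec_aux m0 z0.
have h3 := m a b c d z D z0; have h4 := m0 a b c d z D z0.
by lra.
Qed.

Lemma wseq_rec f k z : modular f -> 0 < z.2 ->
  2 * wseq f k.+2 z = heckesum (wseq f k.+1) z - wseq f k z.
Proof. by move=> fm; apply: wseq_rec_aux; exact: wseq_modular. Qed.

Lemma iterU_bound f M k z : (forall z, `|f z| <= M) -> `|iter k Uop f z| <= M.
Proof.
move=> fM; elim: k z => [//|k IH] z; rewrite iterS /Uop normrM (@ger0_norm _ 2^-1)//.
rewrite ler_pdivrMr// (le_trans (ler_normD _ _))//.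
by have := IH (hecke2 z); have := IH (hecke3 z); lra.
Qed.

(** The averages are bounded by [M] and their weights [1, 1/2, 1/4, ...] add up to less than 2. *)
Lemma wseq_bound f M k z : (forall z, `|f z| <= M) -> `|wseq f k z| <= 2 * M.
Proof.
move=> fM; have M0 : 0 <= M by exact: le_trans (fM z).
elim: k z => [|k IH] z; first by apply: le_trans (fM z) _; lra.
rewrite wseqS; apply: (le_trans (ler_normD _ _)).
rewrite [X in _ + X <= _]normrM (@ger0_norm _ 2^-1)//.
have h1 : 2^-1 * `|wseq f k (hecke1 z)| <= M by have := IH (hecke1 z); lra.
by apply: le_trans (lerD (@iterU_bound f M k.+1 z fM) h1) _; lra.
Qed.

Lemma iterU_osc f d e k : osc f d e -> osc (iter k Uop f) d e.
Proof.
move=> o; elim: k => [//|k IH] z w z0 w0 zw; rewrite !iterS /Uop.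
have [_ o2 o3] := osc_hecke IH.
rewrite -mulrBl normrM (@ger0_norm _ 2^-1)// ler_pdivrMr// opprD addrACA.
rewrite (le_trans (ler_normD _ _))//.
by have := o2 z w z0 w0 zw; have := o3 z w z0 w0 zw; lra.
Qed.

Lemma wseq_osc f d e k : 0 <= e -> osc f d e -> osc (wseq f k) d (2 * e).
Proof.
move=> e0 o; elim: k => [|k IH] z w z0 w0 zw.
  by apply: le_trans (o z w z0 w0 zw) _; lra.
have [p1 _ _] := osc_hecke IH.
rewrite !wseqS opprD addrACA -mulrBr; apply: (le_trans (ler_normD _ _)).
rewrite [X in _ + X <= _]normrM (@ger0_norm _ 2^-1)//.
have h1 : 2^-1 * `|wseq f k (hecke1 z) - wseq f k (hecke1 w)| <= e.
  by have := p1 z w z0 w0 zw; lra.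
by apply: le_trans (lerD (iterU_osc k.+1 o z0 w0 zw) h1) _; lra.
Qed.

Lemma measurable_hecke : [/\ measurable_fun [set: R * R] (@hecke1 R),
  measurable_fun [set: R * R] (@hecke2 R) & measurable_fun [set: R * R] (@hecke3 R)].
Proof.
have c (k : R) : measurable_fun [set: R * R] (cst k : R * R -> R) by exact: measurable_cst.
have m1 := @measurable_fstR R; have m2 := @measurable_sndR R.
by split; apply: measurable_pairR; apply: measurable_funM => //; exact: measurable_funD.
Qed.

Lemma iterU_bm f k : bounded_measurable f -> bounded_measurable (iter k Uop f).
Proof.
have [_ m2 m3] := measurable_hecke.
move=> bf; elim: k => [//|k IH].
have -> : iter k.+1 Uop f = (fun z => (iter k Uop f (hecke2 z) + iter k Uop f (hecke3 z)) * 2^-1).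
  by apply/funext => z; rewrite iterS.
apply: bm_mul; last exact: bm_cst.
by apply: bm_add; apply: bm_comp.
Qed.

Lemma wseq_bm f k : bounded_measurable f -> bounded_measurable (wseq f k).
Proof.
have [m1 _ _] := measurable_hecke.
move=> bf; elim: k => [//|k IH].
apply: bm_add; first exact: iterU_bm.
by apply: bm_mul; [exact: bm_cst|exact: bm_comp].
Qed.

Definition heckevar f z : R := (f (hecke1 z) - f (hecke2 z)) ^+ 2 +
  (f (hecke1 z) - f (hecke3 z)) ^+ 2 + (f (hecke2 z) - f (hecke3 z)) ^+ 2.

Lemma heckevar_modular f : modular f -> modular (heckevar f).
Proof.
move=> fm; apply: modular_gen => z z0; rewrite /heckevar.
  by have [-> -> ->] := hecke_shift fm z0; ring.
by have [-> -> ->] := hecke_inversion fm z0; ring.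
Qed.

(** Pointwise the variation is 3 times the sum of the three squares minus the square of the sum; the
    Hecke sum triples means, whence [9 = 3 * 3]. *)
Lemma imu_heckevar f : bounded_measurable f -> modular f ->
  imu (heckevar f) = 9 * imu (fun z => f z * f z) - imu (fun z => heckesum f z * heckesum f z).
Proof.
move=> bf fm; have bff := bm_mul bf bf.
have ffm : modular (fun z => f z * f z) by move=> a b c d z D z0; rewrite fm.
have bt := bm_hecke bf.
rewrite (eq_imu (g := fun z => 3 * heckesum (fun z => f z * f z) z + (-1) * (heckesum f z * heckesum f z))).
  rewrite imuD; [|apply: bm_mul; [exact: bm_cst|exact: bm_hecke]|apply: bm_mul; [exact: bm_cst|exact: bm_mul]].
  rewrite (imuZ 3 (bm_hecke bff)) (imuZ (-1) (bm_mul bt bt)) imu_hecke//; ring.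
by move=> z _; rewrite /heckevar /heckesum; ring.
Qed.

Section l2.
Variable f : R * R -> R.
Hypotheses (bf : bounded_measurable f) (fm : modular f).

Let w := wseq f.
Let bw k : bounded_measurable (w k). Proof. exact: wseq_bm. Qed.
Let wm k : modular (w k). Proof. exact: wseq_modular. Qed.
Let ip g h := imu (fun z => g z * h z).
Let a k := ip (w k) (w k).
Let E k := a k.+1 - ip (w k.+2) (w k).
Let dv k := imu (heckevar (w k.+1)).

Let rec k z : fund_dom z -> 2 * w k.+2 z = heckesum (w k.+1) z - w k z.
Proof. by move=> [_ [_ z0]]; exact: wseq_rec. Qed.

Let ipC g h : ip g h = ip h g.
Proof. by apply: eq_imu => z _; rewrite mulrC. Qed.

Let ip_rec k g : bounded_measurable g ->
  2 * ip (w k.+2) g = ip (heckesum (w k.+1)) g - ip (w k) g.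
Proof.
move=> bg; have bt := bm_hecke (bw k.+1).
rewrite /ip -(imuZ 2 (bm_mul (bw k.+2) bg)) -[X in _ + X]mulN1r -(imuZ (-1) (bm_mul (bw k) bg)).
rewrite -imuD; [|exact: bm_mul|by apply: bm_mul; [exact: bm_cst|exact: bm_mul]].
by apply: eq_imu => z zF; rewrite mulrA rec//; ring.
Qed.

Let ip_sym k j : ip (heckesum (w k)) (w j) = ip (w k) (heckesum (w j)).
Proof.
have := imu_hecke_sym (bw k) (bw j) (@wm k) (@wm j).
by rewrite /ip => <-; apply: eq_imu => z _; rewrite mulrC.
Qed.

(** Expand the top index of [a k.+2] and of [ip (w k.+3) (w k.+1)] by the recursion; the two terms
    with a Hecke sum cancel by symmetry. *)
Let E_rec k : 2 * E k.+1 = E k.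
Proof.
have h1 := ip_rec k.+1 (bw k.+1); have h2 := ip_rec k (bw k.+2).
have h3 := ip_sym k.+2 k.+1; have h4 := ipC (w k.+2) (heckesum (w k.+1)).
have h5 := ipC (w k) (w k.+2); rewrite /E /a; lra.
Qed.

(** The Hecke sum of [w k.+1] is [2 w k.+2 + w k]. The coefficients [5, -4, -1] add up to 0, so
    these terms telescope, while [E k] decays geometrically. *)
Let dvE k : dv k = 5 * a k.+1 - 4 * a k.+2 - a k + 4 * E k.
Proof.
have bt := bm_hecke (bw k.+1).
rewrite /dv (imu_heckevar (bw k.+1) (@wm k.+1)).
have h1 := ip_rec k bt; have h2 := ip_rec k (bw k.+2); have h3 := ip_rec k (bw k).
have h4 := ipC (w k.+2) (heckesum (w k.+1)); have h5 := ipC (w k) (heckesum (w k.+1)).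
have h6 := ipC (w k) (w k.+2); rewrite /E /a.
rewrite -[imu (fun z => w k.+1 z * _)]/(ip _ _) -[imu (fun z => heckesum _ z * _)]/(ip _ _).
lra.
Qed.

Lemma imu_heckevar_wseq_cvg0 : imu (heckevar (wseq f k.+1)) @[k --> \oo] --> (0 : R).
Proof.
have [_ [M fM]] := bf.
have dv0 k : 0 <= dv k.
  by apply: imu_ge0 => z _; rewrite /heckevar !addr_ge0// sqr_ge0.
have pi0 := @pi_ge0 R.
have a0 k : 0 <= a k by apply: imu_ge0 => z _; rewrite -expr2 sqr_ge0.
have aM k : a k <= (2 * M) ^+ 2 * (pi / 3).
  rewrite -imu_cst; apply: le_imu; [exact: bm_mul|exact: bm_cst|].
  move=> z _; rewrite -expr2 -(real_normK (num_real _)).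
  have M0 : 0 <= M by exact: le_trans (fM z).
  by rewrite ler_pXn2r ?nnegrE ?mulr_ge0// wseq_bound.
have EE k : E k = E 0 / 2 ^+ k.
  elim: k => [|k IH]; first by rewrite expr0 divr1.
  have := E_rec k; rewrite IH exprS => h.
  apply: (mulfI (_ : 2 != 0)) => //; rewrite h; field.
  by rewrite expf_neq0.
have sumE n : series dv n = 4 * (a 1 - a n.+1) + (a n - a 0) + 4 * (E 0 * (2 - 2 / 2 ^+ n)).
  elim: n => [|n IH].
    by rewrite /series /= big_geq// expr0; field.
  rewrite seriesSr IH dvE (EE n) exprS; field.
  by rewrite expf_neq0.
have cv : cvgn (series dv).
  apply: nondecreasing_is_cvgn; first by apply/nondecreasing_seqP => n; rewrite seriesSr lerDl.
  exists (4 * a 1 + (2 * M) ^+ 2 * (pi / 3) + 8 * `|E 0|) => _ [n _ <-].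
  rewrite sumE.
  have q0 : 0 < 2 / 2 ^+ n :> R by rewrite divr_gt0// exprn_gt0.
  have q1 : 2 / 2 ^+ n <= 2 :> R.
    by rewrite ler_pdivrMr ?exprn_gt0// ler_peMr// exprn_ege1// ler1n.
  have h1 : E 0 * (2 - 2 / 2 ^+ n) <= `|E 0| * 2.
    apply: le_trans (ler_norm _) _; rewrite normrM ler_wpM2l// ger0_norm; lra.
  by have := aM n; have := a0 n.+1; have := a0 0%N; lra.
exact: (cvg_series_cvg_0 cv).
Qed.

Lemma imu_wseq k : imu f = 0 -> imu (wseq f k) = 0.
Proof.
move=> f0; suff [] : imu (w k) = 0 /\ imu (w k.+1) = 0 by [].
elim: k => [|k [h0 h1]]; split=> //.
  have : imu (fun z => 2 * w 1 z) = imu (heckesum f) by apply: eq_imu => z _; exact: wseq_rec0.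
  by rewrite (imuZ 2 (bw 1)) imu_hecke// f0; lra.
have : imu (fun z => 2 * w k.+2 z) = imu (fun z => heckesum (w k.+1) z + (-1) * w k z).
  by apply: eq_imu => z zF; rewrite rec// mulN1r.
rewrite (imuZ 2 (bw k.+2)) imuD; [|exact: bm_hecke|by apply: bm_mul; [exact: bm_cst|]].
by rewrite (imuZ (-1) (bw k)) imu_hecke// h0 h1; lra.
Qed.

End l2.

End hecke_recursion.

(** * Small sets of positive area inside the fundamental domain *)

Section pointwise.
Context (R : realType).
Local Notation mu := (@lebesgue_measure R).
Local Notation FD := (@fund_dom R).
Implicit Types (z w : R * R) (f g : R * R -> R).

Lemma fund_dom_im z : FD z -> 3 / 4 <= z.2 ^+ 2.
Proof.
move=> [x2 [r1 _]]; have : z.1 ^+ 2 <= 4^-1.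
  rewrite -real_normK ?num_real// (_ : 4^-1 = 2^-1 ^+ 2); last by field.
  by rewrite ler_pXn2r ?nnegrE.
lra.
Qed.

Lemma imu_rect_gt0 (a b c d : R) : a < b -> 0 < c -> c < d ->
  (forall z, a <= z.1 <= b -> c <= z.2 <= d -> FD z) ->
  0 < imu (\1_([set z : R * R | a <= z.1 <= b /\ c <= z.2 <= d])).
Proof.
move=> ab c0 cd sub; set A := [set z : R * R | _].
have mA : measurable A.
  have -> : A = (`[a, b]%classic `*` `[c, d]%classic).
    by apply/seteqP; split => -[x y] /=; rewrite !in_itv/=.
  by apply: measurableX; exact: measurable_itv.
have bA : bounded_measurable (\1_A : R * R -> R).
  split; first exact: measurable_indic.
  by exists 1 => z; rewrite indicE; case: (_ \in _); rewrite ?normr1 ?normr0.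
rewrite -lte_fin -imu_hint//.
have -> : hint (fun z => (\1_FD z * \1_A z)%:E) = hint (fun z => (\1_A z)%:E).
  apply: eq_hint => z _; rewrite !indicE; case: (boolP (z \in A)) => [/set_mem [h1 h2]|_]; last by rewrite mulr0.
  by rewrite mem_set ?mul1r//; exact: sub.
have d0 : 0 < d by exact: lt_trans cd.
rewrite hintE; last 2 first.
- by apply/measurable_EFinP; exact: measurable_indic.
- by move=> z; rewrite lee_fin.
apply: (@lt_le_trans _ _ ((b - a) / d ^+ 2 * (d - c))%:E).
  by rewrite lte_fin !mulr_gt0 ?subr_gt0// invr_gt0 exprn_gt0.
have -> : ((b - a) / d ^+ 2 * (d - c))%:E =
    (\int[mu]_y (((b - a) / d ^+ 2)%:E * (\1_(`[c, d]%classic : set R) y)%:E))%E.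
  rewrite ge0_integralZl//.
  - rewrite integral_indic// setIT [X in (_ * X)%E](lebesgue_measure_itv `[c, d])/= lte_fin cd.
    by rewrite -EFinB -EFinM.
  - by apply/measurable_EFinP; exact: measurable_indic.
  - by rewrite lee_fin mulr_ge0 ?subr_ge0 ?ltW// invr_gt0 exprn_gt0.
apply: ge0_le_integral => //.
- move=> y _; rewrite mule_ge0// lee_fin// mulr_ge0 ?subr_ge0 ?ltW//.
  by rewrite invr_gt0 exprn_gt0.
- by apply: emeasurable_funM; [exact: measurable_cst|apply/measurable_EFinP; exact: measurable_indic].
- apply: emeasurable_funM; last by apply/measurable_EFinP; exact: measurable_inv_density.
  apply: (@measurable_yint _ (fun z => (\1_A z)%:E)); last by move=> z; rewrite lee_fin.
  by apply/measurable_EFinP; exact: measurable_indic.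
move=> y _; have -> : (\1_(`[c, d]%classic : set R) y : R) = (y \in (`[c, d]%classic : set R))%:R by rewrite indicE.
case: (boolP (y \in _)) => [/set_mem|_]; last first.
  rewrite mule0 mule_ge0// ?lee_fin ?inv_density_ge0//.
  by apply: integral_ge0 => x _; rewrite lee_fin.
rewrite /= in_itv/= => /andP[cy yd].
have y0 : 0 < y by exact: lt_le_trans cy.
have -> : (\int[mu]_x (\1_A (x, y))%:E = (b - a)%:E)%E.
  transitivity (\int[mu]_x (\1_(`[a, b]%classic : set R) x)%:E)%E.
    apply: eq_integral => x _; rewrite !indicE.
    suff -> : ((x, y) \in A) = (x \in (`[a, b]%classic : set R)) by [].
    apply/idP/idP; rewrite !inE /= in_itv/=; first by case.
    by move=> h; split => //; rewrite cy.
  by rewrite integral_indic// setIT [LHS](lebesgue_measure_itv `[a, b])/= lte_fin ab -EFinB.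
rewrite /inv_density y0 mule1 -EFinM lee_fin ler_wpM2l ?subr_ge0 ?(ltW ab)//.
by rewrite lef_pV2 ?posrE ?exprn_gt0// ler_pXn2r// nnegrE ltW.
Qed.

(** This must also work at boundary points: the rectangle lies above [z] and on the side of the
    imaginary axis. Moving up by the factor [1 + e] adds at least [e] to the squared height, which
    pays for the loss of at most [e] in the squared abscissa. *)
Lemma fund_dom_nbhs z (d : R) : FD z -> 0 < d -> exists A : set (R * R),
  [/\ bounded_measurable (\1_A : R * R -> R), A `<=` FD,
      (forall w, A w -> udist z w < d) & 0 < imu (\1_A : R * R -> R)].
Proof.
move=> zF d0; have y2 := fund_dom_im zF.
case: (zF) => xh [r1 y0].
pose e := Num.min 1 d / 7.
have e0 : 0 < e by rewrite divr_gt0// lt_min ltr01.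
have e1 : e <= 1 / 7 by rewrite ler_pM2r// ge_min lexx.
(* On the rectangle the squared Euclidean distance is at most [e^2 + 4 e^2 z.2^2 <= 6 e^2 z.2^2],
   because [z.2^2 >= 3/4]. *)
have ed : 6 * e ^+ 2 < d.
  have h : 7 * e <= d by rewrite /e mulrC divfK// ge_min lexx orbT.
  apply: lt_le_trans h; rewrite expr2; nra.
pose I := if 0 <= z.1 then (z.1 - e, z.1) else (z.1, z.1 + e).
have I12 : I.1 < I.2 by rewrite /I; case: ifP => _ /=; lra.
have Iz t : I.1 <= t <= I.2 -> [/\ `|t| <= 2^-1, (z.1 - t) ^+ 2 <= e ^+ 2 & z.1 ^+ 2 - e <= t ^+ 2].
  move: xh; rewrite !ler_norml => /andP[h1 h2].
  rewrite /I; case: (leP 0 z.1) => hz /= /andP[t1 t2]; split.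
  - by apply/andP; split; lra.
  - nra.
  - nra.
  - by apply/andP; split; lra.
  - nra.
  - nra.
have J0 : 0 < z.2 * (1 + e) by rewrite mulr_gt0//; lra.
have J12 : z.2 * (1 + e) < z.2 * (1 + 2 * e) by rewrite ltr_pM2l//; lra.
pose A := [set w : R * R | I.1 <= w.1 <= I.2 /\ z.2 * (1 + e) <= w.2 <= z.2 * (1 + 2 * e)].
have sub w : I.1 <= w.1 <= I.2 -> z.2 * (1 + e) <= w.2 <= z.2 * (1 + 2 * e) -> FD w.
  move=> /Iz[h1 h2 h3] /andP[k1 k2]; split => //; split; last exact: lt_le_trans k1.
  have : (z.2 * (1 + e)) ^+ 2 <= w.2 ^+ 2.
    by rewrite ler_pXn2r// nnegrE ltW// (lt_le_trans J0).
  have : z.2 ^+ 2 + e <= (z.2 * (1 + e)) ^+ 2 by rewrite exprMn; nra.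
  lra.
exists A; split.
- split; last by exists 1 => w; rewrite indicE; case: (_ \in _); rewrite ?normr1 ?normr0.
  apply: measurable_indic.
  have -> : A = (`[I.1, I.2]%classic `*` `[z.2 * (1 + e), z.2 * (1 + 2 * e)]%classic).
    by apply/seteqP; split => -[x y] /=; rewrite !in_itv/=.
  by apply: measurableX; exact: measurable_itv.
- by move=> w [h1 h2]; exact: sub.
- move=> w [/Iz[h1 h2 h3] /andP[k1 k2]].
  have w0 : 0 < w.2 by exact: lt_le_trans k1.
  rewrite /udist ltr_pdivrMr ?mulr_gt0//.
  have hw : z.2 <= w.2 by apply: le_trans k1; rewrite ler_peMr ?ltW//; lra.
  have h4 : (z.2 - w.2) ^+ 2 <= (2 * e * z.2) ^+ 2.
    have t0 : 0 <= 2 * e * z.2 by apply: mulr_ge0; [apply: mulr_ge0 => //|]; exact: ltW.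
    by rewrite -[leLHS]sqrrN opprB ler_pXn2r ?nnegrE ?subr_ge0//; lra.
  have h5 : z.2 ^+ 2 <= z.2 * w.2 by rewrite expr2 ler_pM2l.
  apply: (@le_lt_trans _ _ (6 * e ^+ 2 * z.2 ^+ 2)).
    have : (2 * e * z.2) ^+ 2 = 4 * e ^+ 2 * z.2 ^+ 2 by ring.
    have : 0 <= e ^+ 2 by exact: sqr_ge0.
    nra.
  apply: (@le_lt_trans _ _ (6 * e ^+ 2 * (z.2 * w.2))).
    by rewrite ler_wpM2l// mulr_ge0// sqr_ge0.
  by rewrite ltr_pM2r// mulr_gt0.
- exact: imu_rect_gt0.
Qed.

End pointwise.

(** * From vanishing variation to pointwise decay *)

Section chain.
Context (R : realType).
Local Notation FD := (@fund_dom R).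
Implicit Types (z w : R * R) (f g : R * R -> R).

Definition equiosc (v : nat -> R * R -> R) :=
  forall e : R, 0 < e -> exists2 d : R, 0 < d & forall k, osc (v k) d e.

Section sequence.
Variables (v : nat -> R * R -> R) (M : R).
Hypotheses (vm : forall k, modular (v k)) (vb : forall k, bounded_measurable (v k))
  (vM : forall k z, `|v k z| <= M) (vo : equiosc v)
  (var0 : imu (heckevar (v k)) @[k --> \oo] --> (0 : R)).

(** By equicontinuity the variation at [z] is controlled by its values on a set of positive area
    near [z], hence by its mean. *)
Let heckevar_cvg_FD z : FD z -> heckevar (v k) z @[k --> \oo] --> (0 : R).
Proof.
move=> zF; have z0 : 0 < z.2 by case: zF => _ [].
apply/cvgrPdist_le => e e0.
have e2 : 0 < Num.min 1 (e / 48) by rewrite lt_min ltr01 divr_gt0.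
have [d d0 od] := vo e2.
set e1 := Num.min 1 (e / 48) in od.
have e10 : 0 <= e1 by rewrite le_min ler01 divr_ge0// ltW.
have e1e : 24 * e1 ^+ 2 <= e / 2.
  have h : e1 <= e / 48 by rewrite ge_min lexx orbT.
  have h' : e1 <= 1 by rewrite ge_min lexx.
  have : e1 ^+ 2 <= e1 by rewrite expr2 ler_piMl.
  lra.
have [A [bA AF Ad A0]] := fund_dom_nbhs zF d0.
have key k w : A w -> heckevar (v k) z <= 2 * heckevar (v k) w + 24 * e1 ^+ 2.
  move=> Aw; have wF := AF _ Aw; have w0 : 0 < w.2 by case: wF => _ [].
  have [q1 q2 q3] := osc_hecke (od k).
  have c1 := q1 z w z0 w0 (Ad _ Aw); have c2 := q2 z w z0 w0 (Ad _ Aw).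
  have c3 := q3 z w z0 w0 (Ad _ Aw).
  (* From [(t + s)^2 <= 2 t^2 + 2 s^2] with [|s| <= 2 e1]; three differences give the constant
     24. *)
  have sq (a b a' b' : R) : `|a - a'| <= e1 -> `|b - b'| <= e1 ->
      (a - b) ^+ 2 <= 2 * (a' - b') ^+ 2 + 8 * e1 ^+ 2.
    rewrite !ler_norml => /andP[l1 l2] /andP[l3 l4].
    pose s := (a - a') - (b - b').
    have s2 : s ^+ 2 <= (2 * e1) ^+ 2.
      rewrite -(real_normK (num_real s)) ler_pXn2r ?nnegrE ?mulr_ge0//.
      by rewrite ler_norml /s; apply/andP; split; lra.
    have -> : a - b = (a' - b') + s by rewrite /s; ring.
    have : (2 * e1) ^+ 2 = 4 * e1 ^+ 2 by ring.
    have := sqr_ge0 ((a' - b') - s); nra.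
  rewrite /heckevar; have := sq _ _ _ _ c1 c2; have := sq _ _ _ _ c1 c3.
  have := sq _ _ _ _ c2 c3; lra.
have bv k : bounded_measurable (heckevar (v k)).
  have b := vb k; have [m1 m2 m3] := @measurable_hecke R.
  have d2 g h : bounded_measurable g -> bounded_measurable h ->
      bounded_measurable (fun z => (g z - h z) ^+ 2).
    move=> bg bh; have bd := bm_add bg (bm_opp bh).
    by have := bm_mul bd bd; congr bounded_measurable; apply/funext => x; rewrite expr2.
  by apply: bm_add; first apply: bm_add; apply: d2; apply: bm_comp.
have main k : imu (\1_A : R * R -> R) * heckevar (v k) z <= 2 * imu (heckevar (v k)) + 24 * e1 ^+ 2 * imu (\1_A : R * R -> R).
  rewrite mulrC -(imuZ _ bA) -(imuZ _ (bv k)) -(imuZ _ bA) -imuD; last 2 first.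
  - by apply: bm_mul => //; exact: bm_cst.
  - by apply: bm_mul => //; exact: bm_cst.
  apply: le_imu.
  - by apply: bm_mul => //; exact: bm_cst.
  - by apply: bm_add; apply: bm_mul => //; exact: bm_cst.
  - move=> w wF; rewrite indicE; case: (boolP (w \in A)) => [/set_mem Aw|_].
      by rewrite !mulr1 key.
    by rewrite !mulr0 addr0 mulr_ge0// /heckevar !addr_ge0// sqr_ge0.
move/cvgrPdist_le : var0 => /(_ (imu (\1_A : R * R -> R) * e / 4)) var0'.
have : 0 < imu (\1_A : R * R -> R) * e / 4 by rewrite divr_gt0// mulr_gt0.
move=> /var0'; apply: filterS => k; rewrite !sub0r !normrN => h.
have p0 : 0 <= heckevar (v k) z by rewrite /heckevar !addr_ge0// sqr_ge0.
rewrite ger0_norm//; have := main k; have := le_trans (ler_norm _) h.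
move: A0 e1e; set m := imu _; set q := imu _; set p := heckevar _ _ => m0 h1 h2 h3.
rewrite -(ler_pM2l m0); apply: le_trans h3 _.
have : 24 * e1 ^+ 2 * m <= e / 2 * m by rewrite ler_pM2r.
lra.
Qed.

Let heckevar_cvg z : 0 < z.2 -> heckevar (v k) z @[k --> \oo] --> (0 : R).
Proof.
move=> z0; have [a [b [c [d [D h]]]]] := reduction z0.
have := heckevar_cvg_FD h.
rewrite (_ : (fun k => heckevar (v k) (mobZ a b c d z)) = (fun k => heckevar (v k) z))//.
by apply/funext => k; apply: heckevar_modular.
Qed.

(** An equivalence relation, closed by equicontinuity, that contains modular equivalence. The
    following lemmas show that it relates all points. *)
Let rel z w := v k z - v k w @[k --> \oo] --> (0 : R).

Let relC z w : rel z w -> rel w z.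
Proof.
rewrite /rel => h; rewrite -oppr0.
rewrite (_ : (fun k => v k w - v k z) = (fun k => - (v k z - v k w))); first exact: cvgN.
by apply/funext => k; rewrite opprB.
Qed.

Let rel_trans z1 z2 z3 : rel z1 z2 -> rel z2 z3 -> rel z1 z3.
Proof.
move=> h1 h2; rewrite /rel -[X in _ --> X](addr0 0).
rewrite (_ : (fun k => v k z1 - v k z3) = (fun k => (v k z1 - v k z2) + (v k z2 - v k z3))).
  exact: cvgD h1 h2.
by apply/funext => k; rewrite addrA subrK.
Qed.

Let rel_eq z w : (forall k, v k z = v k w) -> rel z w.
Proof.
move=> h; rewrite /rel (_ : (fun k => _) = (fun=> 0)); first exact: cvg_cst.
by apply/funext => k; rewrite h subrr.
Qed.

Let rel_mod (a b c d : int) z : a * d - b * c = 1 -> 0 < z.2 -> rel z (mobZ a b c d z).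
Proof. by move=> D z0; apply: rel_eq => k; rewrite vm. Qed.

Let rel_closed z w : 0 < z.2 -> 0 < w.2 ->
  (forall d, 0 < d -> exists w', [/\ 0 < w'.2, rel z w' & udist w' w < d]) -> rel z w.
Proof.
move=> z0 w0 H; apply/cvgrPdist_le => e e0.
have e2 : 0 < e / 2 by rewrite divr_gt0.
have [d d0 od] := vo e2.
have [w' [w'0 /cvgrPdist_le /(_ (e / 2))]] := H _ d0.
rewrite divr_gt0// => /(_ isT) hz hw.
apply: filterS hz => k; rewrite !sub0r !normrN => h.
rewrite -(subrK (v k w') (v k z)) -addrA (le_trans (ler_normD _ _))//.
by have := od k w' w w'0 w0 hw; lra.
Qed.

Let rel_hecke z : 0 < z.2 -> rel (hecke1 z) (hecke2 z).
Proof.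
move=> z0; have h0 := heckevar_cvg z0.
apply/cvgrPdist_le => e e0.
move/cvgrPdist_le : h0 => /(_ (e ^+ 2)); rewrite exprn_gt0// => /(_ isT).
apply: filterS => k; rewrite !sub0r !normrN => h.
have : (v k (hecke1 z) - v k (hecke2 z)) ^+ 2 <= e ^+ 2.
  apply: le_trans h; apply: le_trans (ler_norm _).
  by rewrite /heckevar -addrA lerDl addr_ge0// sqr_ge0.
by rewrite -(real_normK (num_real (_ - _))) ler_pXn2r// nnegrE ltW.
Qed.

(** Two Hecke neighbours of [2 z] are [4 z] and [z]. *)
Let rel4 z : 0 < z.2 -> rel z (4 * z.1, 4 * z.2).
Proof.
move=> z0; have h : 0 < (hecke1 z).2 by have [] := hecke_gt0 z0.
have := rel_hecke h; rewrite /hecke1 /hecke2 /= => /relC.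
rewrite (_ : (2 * z.1 / 2, _) = z); last by case: (z) => x y /=; congr pair; field.
by rewrite (_ : (2 * (2 * z.1), _) = (4 * z.1, 4 * z.2)); last by congr pair; ring.
Qed.

Let rel4n (n : nat) z : 0 < z.2 -> rel z (4 ^+ n * z.1, 4 ^+ n * z.2).
Proof.
move=> z0; elim: n => [|n IH].
  by apply: rel_eq => k; rewrite expr0 !mul1r; case: z {z0}.
apply: rel_trans IH _.
have h : 0 < ((4 ^+ n * z.1, 4 ^+ n * z.2) : R * R).2 by rewrite /= mulr_gt0// exprn_gt0.
by have := rel4 h; rewrite /= !exprS !mulrA.
Qed.

(** Conjugating integer translations by the dilation [4^n] gives translations by dyadic rationals;
    closedness then gives all real ones. *)
Let rel_dyadic (n m : nat) z : 0 < z.2 -> rel z (z.1 + m%:R / 4 ^+ n, z.2).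
Proof.
move=> z0; apply: rel_trans (rel4n n z0) _.
have h : 0 < ((4 ^+ n * z.1, 4 ^+ n * z.2) : R * R).2 by rewrite /= mulr_gt0// exprn_gt0.
have h' : 0 < ((z.1 + m%:R / 4 ^+ n, z.2) : R * R).2 by [].
apply: rel_trans (relC (rel4n n h')).
have -> : (4 ^+ n * (z.1 + m%:R / 4 ^+ n, z.2).1, 4 ^+ n * (z.1 + m%:R / 4 ^+ n, z.2).2) =
    mobZ 1 m%:Z 0 1 (4 ^+ n * z.1, 4 ^+ n * z.2).
  rewrite mobZ_shift /=; congr pair; rewrite mulrDr; congr (_ + _).
  by rewrite mulrCA divff ?mulr1// expf_neq0.
by apply: rel_mod => //; rewrite mulr0 subr0 mulr1.
Qed.

Let rel_shift (t : R) z : 0 < z.2 -> rel z (z.1 + t, z.2).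
Proof.
have pos (s : R) z1 : 0 <= s -> 0 < z1.2 -> rel z1 (z1.1 + s, z1.2).
  move=> s0 z0; apply: rel_closed => // d d0.
  pose e := z1.2 * Num.min 1 d.
  have e0 : 0 < e by rewrite mulr_gt0// lt_min ltr01.
  have [n nE] : exists n : nat, (4 ^+ n)^-1 < e.
    have [n hn] : exists n : nat, e^-1 < n%:R.
      by exists (Num.bound e^-1); apply: archi_boundP; rewrite invr_ge0 ltW.
    exists n; rewrite invf_plt ?posrE ?exprn_gt0//; apply: lt_le_trans hn _.
    by rewrite -natrX ler_nat ltnW// ltn_expl.
  have n0 : 0 < 4 ^+ n :> R by rewrite exprn_gt0.
  exists (z1.1 + (Num.truncn (s * 4 ^+ n))%:R / 4 ^+ n, z1.2); split => //.
    exact: rel_dyadic.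
  have h : 0 <= s * 4 ^+ n by rewrite mulr_ge0// ltW.
  have /andP[t1 t2'] := truncn_itv h.
  have t2 : s * 4 ^+ n < (Num.truncn (s * 4 ^+ n))%:R + 1 by rewrite natr1.
  move: t1 t2; set m : R := (Num.truncn _)%:R => t1 t2 {t2'}.
  rewrite /udist /= subrr expr0n addr0 ltr_pdivrMr ?mulr_gt0//.
  set q := _ - _; have q1 : `|q| <= (4 ^+ n)^-1.
    have -> : q = (m - s * 4 ^+ n) / 4 ^+ n by rewrite /q; field; rewrite gt_eqF.
    have nV : 0 <= (4 ^+ n)^-1 :> R by rewrite invr_ge0 ltW.
    rewrite normrM (ger0_norm nV) ler_piMl//.
    move: t1 t2; move: (s * 4 ^+ n) => X t1 t2.
    by rewrite ler_norml; apply/andP; split; lra.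
  have q2 : `|q| < e by exact: le_lt_trans nE.
  rewrite -(real_normK (num_real q)).
  apply: (@lt_le_trans _ _ (e ^+ 2)); first by rewrite ltr_pXn2r// nnegrE ltW.
  have h1 : Num.min 1 d <= 1 by rewrite ge_min lexx.
  have h2 : Num.min 1 d <= d by rewrite ge_min lexx orbT.
  have h3 : 0 <= Num.min 1 d by rewrite le_min ler01 ltW.
  rewrite /e exprMn mulrC -expr2 ler_wpM2r ?sqr_ge0// expr2.
  by apply: le_trans (ler_piMl h3 h1) h2.
move=> z0; have [t0|t0] := leP 0 t; first exact: pos.
have := @pos (- t) (z.1 + t, z.2) _ z0; rewrite /= addrK oppr_ge0 => /(_ (ltW t0)) h.
by apply: relC; case: (z) h.
Qed.

(** Translate to [x + i y] before inverting. The new height [y / (x^2 + y^2)] equals [y'] for a real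
    [x] precisely when [y' y <= 1]. *)
Let rel_vert (y y' : R) : 0 < y -> 0 < y' -> y' * y <= 1 -> rel (0, y) (0, y').
Proof.
move=> y0 y'0 yy.
have x2 : 0 <= y / y' - y ^+ 2.
  by rewrite subr_ge0 ler_pdivlMr// expr2 -mulrA ger_pMr// mulrC.
pose x := Num.sqrt (y / y' - y ^+ 2).
have xE : x ^+ 2 = y / y' - y ^+ 2 by rewrite /x sqr_sqrtr.
have p0 : 0 < ((x, y) : R * R).2 by [].
apply: (@rel_trans _ (x, y)); first by have := @rel_shift x (0, y) y0; rewrite /= add0r.
apply: rel_trans (@rel_mod 0 (-1) 1 0 (x, y) _ p0) _ => //.
set w := mobZ _ _ _ _ _.
have w2 : w.2 = y'.
  rewrite /w mobZ_im// /mobdenZ /mobden /= !mul1r addr0 xE subrK.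
  by rewrite invf_div mulrCA divff ?mulr1// gt_eqF.
have w0 : 0 < w.2 by rewrite w2.
by have := @rel_shift (- w.1) w w0; rewrite subrr w2.
Qed.

Let rel_all z w : 0 < z.2 -> 0 < w.2 -> rel z w.
Proof.
move=> z0 w0; pose y := Num.min z.2^-1 w.2^-1.
have y0 : 0 < y by rewrite lt_min !invr_gt0 z0.
have go z1 : 0 < z1.2 -> y <= z1.2^-1 -> rel z1 (0, y).
  move=> z10 yz; apply: (@rel_trans _ (0, z1.2)).
    by have := @rel_shift (- z1.1) z1 z10; rewrite subrr.
  by apply: rel_vert => //; rewrite -ler_pdivlMr// div1r.
apply: (@rel_trans _ (0, y)); first by apply: go => //; rewrite ge_min lexx.
by apply: relC; apply: go => //; rewrite ge_min lexx orbT.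
Qed.

(** The functions become asymptotically constant, and dominated convergence on the domain identifies
    the constant with the mean. *)
Lemma chain_cvg0 : (forall k, imu (v k) = 0) ->
  forall z, 0 < z.2 -> v k z @[k --> \oo] --> (0 : R).
Proof.
move=> v0.
pose i : R * R := (0, 1).
have i0 : 0 < i.2 by rewrite /i.
have pi0 := @pi_gt0 R.
have h1 : imu (fun z => v k z - v k i) @[k --> \oo] --> (0 : R).
  apply: (@imu_cvg0 _ (fun k z => v k z - v k i) (2 * M)).
  - by move=> k; apply: measurable_funB; [exact: (vb k).1|exact: measurable_cst].
  - move=> k z; rewrite (le_trans (ler_normB _ _))//.
    by have := vM k z; have := vM k i; lra.
  - by move=> z [_ [_ z0]]; exact: rel_all.
have h2 : v k i @[k --> \oo] --> (0 : R).
  have h3 : - (3 / pi) * imu (fun z => v k z - v k i) @[k --> \oo] --> (- (3 / pi) * 0 : R).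
    by apply: cvgM h1; exact: cvg_cst.
  rewrite mulr0 in h3; apply: cvg_trans h3; apply: near_eq_cvg; apply: nearW => k.
  by rewrite (imuD (vb k) (bm_cst _)) v0 imu_cst; move: (@pi R) pi0 => p p0; field; rewrite gt_eqF.
move=> z z0; have h3 : (v k z - v k i) + v k i @[k --> \oo] --> (0 + 0 : R).
  by apply: cvgD h2; exact: rel_all.
by rewrite addr0 in h3; apply: cvg_trans h3; apply: near_eq_cvg; apply: nearW => k; rewrite subrK.
Qed.

End sequence.

Lemma wseq_cvg0 f : bounded_measurable f -> modular f ->
  (forall e : R, 0 < e -> exists2 d : R, 0 < d & osc f d e) -> imu f = 0 ->
  forall z, 0 < z.2 -> wseq f k z @[k --> \oo] --> (0 : R).
Proof.
move=> bf fm fo f0 z z0; have [_ [M fM]] := bf.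
rewrite -cvg_shiftS.
apply: (@chain_cvg0 (fun k => wseq f k.+1) (2 * M)) => //.
- by move=> k; exact: wseq_modular.
- by move=> k; exact: wseq_bm.
- by move=> k w; exact: wseq_bound.
- move=> e e0; have e2 : 0 < e / 2 by rewrite divr_gt0.
  have [d d0 od] := fo _ e2.
  exists d => // k; have := @wseq_osc _ f d (e / 2) k.+1 (ltW e2) od.
  by rewrite mulrC divfK.
- exact: imu_heckevar_wseq_cvg0.
- by move=> k; exact: imu_wseq.
Qed.

End chain.

(** * Equidistribution of horocycles in mean *)

Section horocycle.
Context (R : realType).
Local Notation mu := (@lebesgue_measure R).
Local Notation FD := (@fund_dom R).
Implicit Types (z w : R * R) (f g : R * R -> R).

Lemma udist_small z (d : R) : 0 < z.2 -> 0 < d -> exists2 e : R, 0 < e &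
  forall w, `|z.1 - w.1| < e -> `|z.2 - w.2| < e -> 0 < w.2 /\ udist z w < d.
Proof.
move=> z0 d0; pose m := Num.min 1 d.
have m0 : 0 < m by rewrite lt_min ltr01.
have m1 : m <= 1 by rewrite ge_min lexx.
have md : m <= d by rewrite ge_min lexx orbT.
exists (z.2 * m / 4); first by rewrite !mulr_gt0.
move=> w h1 h2.
have e4 : z.2 * m / 4 <= z.2 / 4 by rewrite ler_pM2r// ler_piMr// ltW.
have w2 : z.2 / 2 <= w.2 by move: h2; rewrite ltr_norml => /andP[]; lra.
have w0 : 0 < w.2 by apply: lt_le_trans w2; rewrite divr_gt0.
split=> //; rewrite /udist ltr_pdivrMr ?mulr_gt0//.
have e0 : 0 <= z.2 * m / 4 by rewrite !mulr_ge0// ltW.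
have s1 : (z.1 - w.1) ^+ 2 <= (z.2 * m / 4) ^+ 2.
  by rewrite -(real_normK (num_real (_ - _))) ler_pXn2r ?nnegrE// ltW.
have s2 : (z.2 - w.2) ^+ 2 <= (z.2 * m / 4) ^+ 2.
  by rewrite -(real_normK (num_real (_ - _))) ler_pXn2r ?nnegrE// ltW.
have z2 : 0 < z.2 ^+ 2 by rewrite exprn_gt0.
have h3 : d * (z.2 ^+ 2 / 2) <= d * (z.2 * w.2).
  by rewrite ler_pM2l// expr2 -mulrA ler_pM2l.
apply: lt_le_trans h3.
have -> : d * (z.2 ^+ 2 / 2) = z.2 ^+ 2 * (d / 2) by ring.
apply: (@le_lt_trans _ _ (z.2 ^+ 2 * (m / 8))).
  have h4 : (z.2 * m / 4) ^+ 2 = z.2 ^+ 2 * (m * m / 16) by field.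
  have h5 : m * m <= m by rewrite ler_piMl// ltW.
  have h6 : z.2 ^+ 2 * (m * m / 16) <= z.2 ^+ 2 * (m / 16) by rewrite ler_pM2l// ler_pM2r.
  lra.
by rewrite ltr_pM2l//; lra.
Qed.

(** The domain truncated at height [T] lies in a compact rectangle with lower edge [1/2]; pointwise
    convergence and equicontinuity are uniform there. *)
Lemma uniform_cvg0 (v : nat -> R * R -> R) : equiosc v ->
  (forall z, 0 < z.2 -> v k z @[k --> \oo] --> (0 : R)) ->
  forall T e : R, 0 < e -> \forall k \near \oo, forall z, FD z -> z.2 <= T -> `|v k z| <= e.
Proof.
move=> vo v0 T e e0.
have cK : compact (`[- 2^-1, 2^-1]%classic `*` `[2^-1, T]%classic : set (R * R)).
  by apply: compact_setX; exact: segment_compact.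
have e2 : 0 < e / 2 by rewrite divr_gt0.
have [d d0 od] := vo _ e2.
have := (proj1 (compact_near_coveringP _) cK) nat \oo (fun k z => `|v k z| <= e) _.
have H : forall z, (`[- 2^-1, 2^-1]%classic `*` `[2^-1, T]%classic : set (R * R)) z ->
    \forall z' \near z & k \near \oo, `|v k z'| <= e.
  move=> z [_ /= ]; rewrite in_itv/= => /andP[zh _].
  have z0 : 0 < z.2 by apply: lt_le_trans zh.
  have [h h0 hz] := udist_small z0 d0.
  move/cvgrPdist_le : (v0 z z0) => /(_ _ e2) vz.
  exists (ball z h, [set k | `|0 - v k z| <= e / 2]); first by split => //=; exact: nbhsx_ballx.
  move=> [w k] [/= [b1 b2]]; rewrite sub0r normrN => b3.
  have [w0 zw] := hz w b1 b2.
  have := od k z w z0 w0 zw => h1.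
  rewrite -(subrK (v k z) (v k w)) (le_trans (ler_normD _ _))// distrC; lra.
move=> /(_ _ H); apply: filterS => k kP z zF zT; apply: kP.
have [z1 [z2 z0]] := zF.
split; rewrite /= in_itv/=; first by rewrite -ler_norml.
rewrite zT andbT; have := fund_dom_im zF => h.
rewrite -(ler_pXn2r (n := 2)) ?nnegrE ?ltW//; lra.
Qed.

(** * Cusp excursions of long horocycles *)

Section cusp.
Variables (h : R * R -> R) (n : nat) (Y T e M : R).
Hypotheses (n0 : (0 < n)%N) (Y0 : 0 < Y) (YT : Y <= T) (T1 : 1 <= T) (e0 : 0 <= e)
  (hm : modular h) (mh : measurable_fun [set: R * R] h) (hM : forall z, `|h z| <= M)
  (he : forall z, FD z -> z.2 <= T -> `|h z| <= e).

Let T0 : 0 < T. Proof. exact: lt_le_trans ltr01 T1. Qed.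
(** An excursion above [T] with bottom row [(c, d)] forces [c Y < s] and [|c n x + d| < s], where
    [s^2 = Y / T]. The first condition reads [c < 1 / q], whence the cutoff [C]; the second puts [x]
    in an interval [J c j] with [j = -d]. *)
Let q : R := Num.sqrt (Y * T).
Let s : R := q / T.
Let C : nat := Num.truncn q^-1.

Let q0 : 0 < q. Proof. by rewrite sqrtr_gt0 mulr_gt0. Qed.
Let q2 : q ^+ 2 = Y * T. Proof. by rewrite sqr_sqrtr// mulr_ge0// ltW. Qed.
Let s0 : 0 < s. Proof. by rewrite divr_gt0. Qed.
Let s2 : s ^+ 2 = Y / T.
Proof. by rewrite /s expr_div_n q2; field; rewrite gt_eqF. Qed.
Let s1 : s <= 1.
Proof.
by rewrite -(ler_pXn2r (n := 2)) ?nnegrE ?(ltW s0)// s2 expr1n ler_pdivrMr// mul1r.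
Qed.

Let J (c j : nat) : set R := `[(j%:R - s) / (c * n)%:R, (j%:R + s) / (c * n)%:R]%classic.

Let mJ c j : measurable (J c j). Proof. exact: measurable_itv. Qed.

Let cn0 (c : nat) : (0 < c)%N -> 0 < (c * n)%:R :> R.
Proof. by move=> c0; rewrite ltr0n muln_gt0 c0. Qed.

(* If the reduced point lies above height [T], the bottom row [(c, d)] of the
   reducing matrix satisfies [(c n x + d)^2 + c^2 Y^2 < Y / T = s^2 <= 1]. *)
Let excursion x : 0 <= x <= 1 -> e < `|h (n%:R * x, Y)| ->
  exists c j : nat, [/\ (0 < c <= C)%N, (j <= c * n)%N & J c j x].
Proof.
move=> /andP[x0 x1] eh.
set z := (n%:R * x, Y) in eh.
have z0 : 0 < z.2 by [].
have [a [b [c [d [D zF]]]]] := reduction z0.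
have den0 : 0 < mobdenZ c d z by apply: (@mobdenZ_gt0 _ a b) => //; rewrite D.
have zT : T < (mobZ a b c d z).2.
  rewrite ltNge; apply/negP => zT; have := he zF zT.
  by rewrite hm// leNgt eh.
have denT : mobdenZ c d z < s ^+ 2.
  move: zT; rewrite mobZ_im// ltr_pdivlMr// s2 ltr_pdivlMr//= => zT.
  by rewrite mulrC.
(* Negating the matrix does not change the map. *)
wlog c0 : a b c d D zF den0 zT denT / 0 <= c => [H|].
  have [c0|c0] := leP 0 c; first exact: (H a b c d).
  have D' : (- a) * (- d) - (- b) * (- c) = 1 by rewrite -D; ring.
  have dE : mobdenZ (- c) (- d) z = mobdenZ c d z.
    by rewrite /mobdenZ /mobden !mulrNz; ring.
  have mE : mobZ (- a) (- b) (- c) (- d) z = mobZ a b c d z.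
    rewrite /mobZ /mobR -/(mobdenZ c d z) -/(mobdenZ (- c) (- d) z) dE !mulrNz.
    by congr pair; congr (_ / _); ring.
  apply: (H (- a) (- b) (- c) (- d)) => //; rewrite ?mE ?dE// oppr_ge0 ltW//.
(* For [c = 0] the denominator is [d^2 = 1], not below [s^2 <= 1]: this is where [Y <= T] enters. *)
have {}c0 : 0 < c.
  rewrite lt_neqAle c0 andbT; apply/eqP => c00.
  have [_ d1] : a * a = 1 /\ a = d by apply: mulz_eq1; move: D; rewrite -c00 mulr0 subr0.
  have [dd _] : d * d = 1 /\ d = d by rewrite -d1; apply: mulz_eq1; move: D; rewrite -c00 d1 mulr0 subr0.
  have : mobdenZ c d z = 1.
    by rewrite /mobdenZ /mobden -c00 !mulr0z !mul0r add0r expr0n addr0 expr2 -intrM dd.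
  move=> dE; move: denT; rewrite dE => h1.
  have : s ^+ 2 <= 1 by rewrite exprn_ile1// ltW.
  by rewrite leNgt h1.
case: c c0 D zF den0 zT denT => // c c0 D zF den0 zT.
rewrite /mobdenZ /mobden /= -!pmulrn => denT.
have cY : (c%:R * Y) ^+ 2 < s ^+ 2 by apply: le_lt_trans denT; rewrite lerDr sqr_ge0.
have cx : (c%:R * (n%:R * x) + d%:~R) ^+ 2 < s ^+ 2 by apply: le_lt_trans denT; rewrite lerDl sqr_ge0.
have cpos : (0 < c)%N by rewrite -ltz_nat.
have cC : (c <= C)%N.
  have qV : 0 <= q^-1 by rewrite invr_ge0 ltW.
  rewrite /C truncn_ge_nat// -[q^-1]div1r ler_pdivlMr//.
  have : c%:R * Y <= s.
    have h1 : 0 <= c%:R * Y by rewrite mulr_ge0// ltW.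
    by rewrite -(ler_pXn2r (n := 2))// ?nnegrE ?(ltW s0)// ltW.
  rewrite /s ler_pdivlMr// -mulrA -q2 expr2 mulrA => h1.
  by rewrite -(ler_pM2r q0) mul1r.
have : `|c%:R * (n%:R * x) + d%:~R| < s.
  by rewrite -(ltr_pXn2r (n := 2)) ?nnegrE ?(ltW s0)// real_normK ?num_real.
rewrite ltr_norml => /andP[h1 h2].
have cnx : 0 <= c%:R * (n%:R * x) <= (c * n)%:R.
  by rewrite natrM mulrA !mulr_ge0//= ler_piMr// mulr_ge0.
move/andP: cnx => [k1 k2].
have dlt : d < 1 by rewrite -(@ltrz1 R); have := s1; lra.
have dgt : - d < (c * n)%:Z + 1.
  by rewrite -(ltr_int R) mulrNz intrD mulr1z -pmulrn; have := s1; lra.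
exists c, `|d|%N; split; first by rewrite cpos.
  by move: dlt dgt; clear; lia.
have dE : (`|d|%N)%:R = - d%:~R :> R.
  by rewrite pmulrn abszE ler0_norm ?mulrNz//; move: dlt; clear; lia.
rewrite /J /= in_itv/= dE ler_pdivrMr ?ler_pdivlMr ?cn0//.
have -> : x * (c * n)%:R = c%:R * (n%:R * x) by rewrite natrM; ring.
by apply/andP; split; lra.
Qed.

Let S (x : R) : R := \sum_(0 <= c < C) \sum_(0 <= j < (c.+1 * n).+1) \1_(J c.+1 j) x.

Let S_ge0 x : 0 <= S x.
Proof. by apply: sumr_ge0 => c _; apply: sumr_ge0 => j _. Qed.

Let bound x : 0 <= x <= 1 -> `|h (n%:R * x, Y)| <= e + M * S x.
Proof.
move=> x01; have M0 : 0 <= M by exact: le_trans (hM (0, 0)).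
have [he'|eh] := leP `|h (n%:R * x, Y)| e.
  by rewrite (le_trans he')// lerDl mulr_ge0.
have [c [j [/andP[c0 cC] jc Jx]]] := excursion x01 eh.
have S1 : 1 <= S x.
  have -> : 1 = \1_(J c j) x :> R by rewrite indicE mem_set.
  case: c c0 cC jc {Jx} => // c _ cC jc.
  have jc' : (j < (c.+1 * n).+1)%N by rewrite ltnS.
  rewrite /S (big_rem c)/=; last by rewrite mem_index_iota.
  rewrite (big_rem j)/=; last by rewrite mem_index_iota.
  rewrite -addrA lerDl addr_ge0// sumr_ge0// => i _.
  by apply: sumr_ge0.
rewrite (le_trans (hM _))// (@le_trans _ _ (M * S x))//; first by rewrite ler_peMr.
by rewrite lerDr.
Qed.

Let measurable_S : measurable_fun [set: R] S.
Proof.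
apply: measurable_sum => c; apply: measurable_sum => j.
exact: measurable_indic (mJ _ _).
Qed.

(** For each [c] there are [c n + 1] intervals of length [2 s / (c n)], of total length at most
    [4 s]; summing over [c <= 1 / q] gives [4 s / q = 4 / T], whatever [Y] and [n] are. *)
Let int_S : (\int[mu]_(x in `[0%R, 1%R]) (S x)%:E <= (4 / T)%:E)%E.
Proof.
apply: (@le_trans _ _ (\int[mu]_x (S x)%:E)%E).
  apply: ge0_subset_integral => //; first by apply/measurable_EFinP.
  by move=> x _; rewrite lee_fin.
have JE c j : (0 < c)%N -> (\int[mu]_x (\1_(J c j) x)%:E = (2 * s / (c * n)%:R)%:E)%E.
  move=> c0; rewrite integral_indic//; last exact: mJ.
  rewrite setIT [LHS](lebesgue_measure_itv _)/= lte_fin.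
  rewrite ltr_pM2r ?invr_gt0 ?cn0// ifT; last by have := s0; lra.
  by rewrite -EFinB; congr EFin; rewrite -mulrBl; congr (_ / _); ring.
have -> : (\int[mu]_x (S x)%:E = \sum_(0 <= c < C) \sum_(0 <= j < (c.+1 * n).+1) (2 * s / (c.+1 * n)%:R)%:E)%E.
  rewrite /S; under eq_integral do rewrite -sumEFin.
  rewrite ge0_integral_sum//.
  - apply: eq_bigr => c _; under eq_integral do rewrite -sumEFin.
    rewrite ge0_integral_sum//.
    + by apply: eq_bigr => j _; rewrite JE.
    + by move=> j; apply/measurable_EFinP; exact: measurable_indic (mJ _ _).
  - move=> c; apply/measurable_EFinP; apply: measurable_sum => j.
    exact: measurable_indic (mJ _ _).
  - by move=> c x _; rewrite lee_fin sumr_ge0.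
apply: (@le_trans _ _ (\sum_(0 <= c < C) (4 * s)%:E)%E).
  apply: lee_sum => c _; rewrite sumEFin lee_fin sumr_const_nat subn0 -(mulr_natr (2 * s / _)).
  have X0 := cn0 (ltn0Sn c); have : 1 <= (c.+1 * n)%:R :> R by rewrite ler1n muln_gt0.
  have XE : ((c.+1 * n).+1)%:R = (c.+1 * n)%:R + 1 :> R by rewrite natr1.
  move: X0; rewrite XE {XE}; move: ((c.+1 * n)%:R : R) => X X0 X1.
  have -> : 2 * s / X * (X + 1) = 2 * s + 2 * s / X by field; rewrite gt_eqF.
  have : 2 * s / X <= 2 * s by rewrite ler_pdivrMr// ler_peMr// mulr_ge0// ltW.
  lra.
rewrite sumEFin lee_fin sumr_const_nat subn0 -(mulr_natr (4 * s)).
have : C%:R <= q^-1 by rewrite truncn_le invr_ge0 ltW.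
move=> Cq; rewrite ler_pdivlMr//.
have : C%:R * q <= 1 by rewrite -ler_pdivlMr// div1r.
rewrite /s; have -> : 4 * (q / T) * C%:R * T = 4 * (C%:R * q) by field; rewrite gt_eqF.
lra.
Qed.

Lemma horocycle_bound :
  (\int[mu]_(x in `[0%R, 1%R]) (`|h (n%:R * x, Y)|)%:E <= (e + 4 * M / T)%:E)%E.
Proof.
have M0 : 0 <= M by exact: le_trans (hM (0, 0)).
have mhx : measurable_fun [set: R] (fun x : R => `|h (n%:R * x, Y)|).
  apply: measurableT_comp => //; apply: (measurableT_comp mh).
  by apply: measurable_fun_pair => //; exact: mulrl_measurable.
apply: (@le_trans _ _ (\int[mu]_(x in `[0%R, 1%R]) (e%:E + M%:E * (S x)%:E))%E).
  apply: ge0_le_integral => //.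
  - by apply/measurable_funTS/measurable_EFinP.
  - apply/measurable_funTS; apply: emeasurable_funD; first exact: measurable_cst.
    by apply: emeasurable_funM; [exact: measurable_cst|exact/measurable_EFinP].
rewrite ge0_integralD//; last 2 first.
- by move=> x _; rewrite mule_ge0// lee_fin.
- by apply/measurable_funTS; apply: emeasurable_funM; [exact: measurable_cst|exact/measurable_EFinP].
rewrite integral_cst// [X in (_ * X)%E](lebesgue_measure_itv `[0, 1])/= lte_fin ltr01 sube0 mule1.
rewrite ge0_integralZl//; last 2 first.
- by apply/measurable_funTS/measurable_EFinP.
- by move=> x _; rewrite lee_fin.
rewrite EFinD leeD2l//; apply: (@le_trans _ _ (M%:E * (4 / T)%:E)%E).
  by apply: lee_wpmul2l; [rewrite lee_fin|exact: int_S].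
by rewrite -EFinM lee_fin; have -> : M * (4 / T) = 4 * M / T by ring.
Qed.

End cusp.

End horocycle.

(** * The rate in [L^1] *)

Section rate.
Context (R : realType).
Local Notation mu := (@lebesgue_measure R).
Local Notation FD := (@fund_dom R).
Implicit Types (z w : R * R) (f g : R * R -> R).

Lemma sum_nat_double (F : nat -> R) n :
  \sum_(0 <= i < 2 * n) F i = \sum_(0 <= i < n) (F (2 * i)%N + F (2 * i).+1).
Proof.
elim: n => [|n IH]; first by rewrite muln0 !big_geq.
have -> : (2 * n.+1 = (2 * n).+2)%N by rewrite mulnS.
by rewrite [RHS]big_nat_recr//= -IH !big_nat_recr//= addrA.
Qed.

Lemma iterU_sum f k z : iter k (@Uop R) f z =
  (2 ^+ k)^-1 * \sum_(0 <= j < 2 ^ k) f ((z.1 + j%:R) / 2 ^+ k, z.2 / 2 ^+ k).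
Proof.
have k0 n : 2 ^+ n != 0 :> R by rewrite expf_neq0.
elim: k z => [|k IH] z.
  by rewrite expn0 big_nat1 expr0 invr1 mul1r addr0 !mulr1; case: z.
rewrite iterS /Uop !IH expnS sum_nat_double -mulrDr -big_split /= exprS.
rewrite invfM mulrAC (mulrC 2^-1) -!mulrA; congr (_ * _).
rewrite mulrC; congr (_ * _); apply: eq_bigr => j _.
congr (f (_, _) + f (_, _)).
- by rewrite natrM; field.
- by rewrite -(natr1 (2 * j)%N) natrM; field.
Qed.

Lemma int_deltaE f k x y :
  int_delta (2 ^ k) x y f = iter k (@Uop R) f ((2 ^ k)%:R * x, (2 ^ k)%:R * y).
Proof.
rewrite iterU_sum /int_delta natrX big_mkord; congr (_ * _).
have k0 : 2 ^+ k != 0 :> R by rewrite expf_neq0.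
apply: eq_bigr => j _; congr (f (_, _)) => /=; last by field.
by rewrite mulrDl mulrAC divff// mul1r.
Qed.

Lemma int_deltaB f (n : nat) x y c : (0 < n)%N ->
  int_delta n x y (fun z => f z - c) = int_delta n x y f - c.
Proof.
move=> n0; rewrite /int_delta sumrB mulrBr sumr_const card_ord -(mulr_natl c) mulrA.
by rewrite mulVf ?mul1r// pnatr_eq0 -lt0n.
Qed.

Definition ucont f := forall e : R, 0 < e -> exists2 d : R, 0 < d & osc f d e.

Lemma measurable_horocycle f (n : nat) (Y : R) : measurable_fun [set: R * R] f ->
  measurable_fun [set: R] (fun x => f (n%:R * x, Y)).
Proof.
move=> mf; apply: (measurableT_comp mf).
by apply: measurable_fun_pair => //; exact: mulrl_measurable.
Qed.

Lemma L1_rate f : bounded_measurable f -> modular f -> ucont f ->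
  forall c e : R, 0 < e -> exists k0 : nat, forall k y, (k0 <= k)%N -> 0 < y ->
    (2 ^ k)%:R * y <= c ->
    (\int[mu]_(x in `[0%R, 1%R]) (`|int_delta (2 ^ k) x y f - int_muM f|)%:E <= e%:E)%E.
Proof.
move=> bf fm fu c e e0.
have pi0 := @pi_gt0 R.
set m := int_muM f; pose g z := f z - m.
have bg : bounded_measurable g by apply: bm_add => //; exact: bm_cst.
have gm : modular g by move=> a b c' d z D z0; rewrite /g fm.
have gu : ucont g.
  move=> e' e'0; have [d d0 od] := fu _ e'0; exists d => // z w z0 w0 zw.
  by rewrite /g opprB addrA subrK; exact: od.
have g0 : imu g = 0.
  rewrite /g (imuD bf (bm_cst _)) imu_cst /m /int_muM -/(imu f).
  have -> : fine (\int[(mu \x mu)%E]_(z in FD) (f z / z.2 ^+ 2)%:E)%E = imu f by [].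
  by move: pi0; move: (@pi R) => p p0; field; rewrite gt_eqF.
have [_ [M gM]] := bg; have M0 : 0 <= M by exact: le_trans (gM (0, 0)).
(* The term [w_{k-1} (2 z)] sits at twice the height, hence [2 * c]. Since [wseq] is bounded by
   [2 M], the choice [32 M / e] makes the cusp contribution [4 (2 M) / T] at most [e / 4]. *)
pose T := Num.max 1 (Num.max (2 * c) (32 * M / e)).
have T1 : 1 <= T by rewrite le_max lexx.
have Tc : 2 * c <= T by rewrite !le_max lexx orbT.
have TM : 32 * M / e <= T by rewrite !le_max lexx !orbT.
have T0 : 0 < T by exact: lt_le_trans T1.
have wo : equiosc (wseq g).
  move=> e' e'0; have e2 : 0 < e' / 2 by rewrite divr_gt0.
  have [d d0 od] := gu _ e2; exists d => // k.
  by have := @wseq_osc _ g d (e' / 2) k (ltW e2) od; rewrite mulrC divfK.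
have e4 : 0 < e / 4 by rewrite divr_gt0.
have [K _ hK] := uniform_cvg0 wo (wseq_cvg0 bg gm gu g0) T e4.
exists K.+1 => -[//|k] y; rewrite ltnS => Kk y0 yc.
have M8 : 4 * (2 * M) / T <= e / 4.
  by rewrite ler_pdivrMr//; move: TM; rewrite ler_pdivrMr//; lra.
have p2 n : 0 < (2 ^ n)%:R :> R by rewrite ltr0n expn_gt0.
have e44 : 0 <= e / 4 by exact: ltW.
have H1 := @horocycle_bound _ (wseq g k.+1) (2 ^ k.+1) ((2 ^ k.+1)%:R * y) T (e / 4) (2 * M).
have H2 := @horocycle_bound _ (wseq g k) (2 ^ k.+2) ((2 ^ k.+2)%:R * y) T (e / 4) (2 * M).
have q1 : (2 ^ k.+1)%:R * y <= T.
  have : 0 <= (2 ^ k.+1)%:R * y by rewrite mulr_ge0 ?ltW.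
  lra.
have q2 : (2 ^ k.+2)%:R * y <= T.
  by rewrite expnS natrM -mulrA; apply: le_trans Tc; rewrite ler_pM2l.
move: H1 => /(_ _ _ q1 T1 e44 (wseq_modular _ gm) (wseq_bm _ bg).1) H1.
move: H2 => /(_ _ _ q2 T1 e44 (wseq_modular _ gm) (wseq_bm _ bg).1) H2.
have {}H1 := H1 _ _ (fun z => wseq_bound k.+1 z gM) (hK _ (leqW Kk)).
have {}H2 := H2 _ _ (fun z => wseq_bound k z gM) (hK _ Kk).
have {}H1 : (\int[mu]_(x in `[0%R, 1%R]) (`|wseq g k.+1 ((2 ^ k.+1)%:R * x, (2 ^ k.+1)%:R * y)|)%:E <= (e / 2)%:E)%E.
  apply: le_trans (H1 _ _) _; rewrite ?expn_gt0 ?mulr_gt0//.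
  by rewrite lee_fin; lra.
have {}H2 : (\int[mu]_(x in `[0%R, 1%R]) (`|wseq g k ((2 ^ k.+2)%:R * x, (2 ^ k.+2)%:R * y)|)%:E <= (e / 2)%:E)%E.
  apply: le_trans (H2 _ _) _; rewrite ?expn_gt0 ?mulr_gt0//.
  by rewrite lee_fin; lra.
have mw j n Y : measurable_fun [set: R] (fun x : R => `|wseq g j (n%:R * x, Y)|).
  apply: measurableT_comp => //; apply: (@measurable_horocycle (wseq g j)).
  exact: (wseq_bm _ bg).1.
apply: (@le_trans _ _ (\int[mu]_(x in `[0%R, 1%R])
   ((`|wseq g k.+1 ((2 ^ k.+1)%:R * x, (2 ^ k.+1)%:R * y)|)%:E +
    (`|wseq g k ((2 ^ k.+2)%:R * x, (2 ^ k.+2)%:R * y)|)%:E))%E).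
  have E x : int_delta (2 ^ k.+1) x y f - m =
      wseq g k.+1 ((2 ^ k.+1)%:R * x, (2 ^ k.+1)%:R * y) -
      2^-1 * wseq g k ((2 ^ k.+2)%:R * x, (2 ^ k.+2)%:R * y).
    rewrite -int_deltaB ?expn_gt0// -/g int_deltaE wseqS.
    rewrite /hecke1 /= !mulrA -!natrM -!expnS; ring.
  apply: ge0_le_integral => //.
  - apply/measurable_funTS/measurable_EFinP; apply: measurableT_comp => //.
    under eq_fun do rewrite -int_deltaB ?expn_gt0// -/g int_deltaE.
    by apply: (@measurable_horocycle (iter k.+1 (@Uop R) g)); exact: (iterU_bm _ bg).1.
  - by apply/measurable_funTS; apply: emeasurable_funD; apply/measurable_EFinP; exact: mw.
  - move=> x _; rewrite -EFinD lee_fin E (le_trans (ler_normB _ _))// lerD2l.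
    by rewrite normrM (@ger0_norm _ 2^-1)// ler_piMl//; lra.
rewrite ge0_integralD//; last 2 first.
- by apply/measurable_funTS/measurable_EFinP; exact: mw.
- by apply/measurable_funTS/measurable_EFinP; exact: mw.
apply: le_trans (leeD H1 H2) _; rewrite -EFinD lee_fin; lra.
Qed.

End rate.

(** * A countable family of test functions *)

Section test_functions.
Context (R : realType).
Implicit Types (z w q : R * R) (f g : R * R -> R).

(** Continuity on the upper half-plane in Euclidean boxes, with nothing required below; [ext] then
    supplies a function measurable on the whole plane. *)
Definition half_cont f := forall z, 0 < z.2 -> forall e : R, 0 < e ->
  exists2 h : R, 0 < h &
    forall w, `|z.1 - w.1| < h -> `|z.2 - w.2| < h -> 0 < w.2 /\ `|f z - f w| < e.

Definition ext f z : R := if 0 < z.2 then f z else 0.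

Lemma extE f z : 0 < z.2 -> ext f z = f z.
Proof. by rewrite /ext => ->. Qed.

Let rat_box z (h : R) : 0 < h -> exists t : rat * rat * rat * rat,
  [/\ ratr t.1.1.1 < z.1 < ratr t.1.1.2, ratr t.1.2 < z.2 < ratr t.2 &
   forall w, ratr t.1.1.1 < w.1 < ratr t.1.1.2 -> ratr t.1.2 < w.2 < ratr t.2 ->
     `|z.1 - w.1| < h /\ `|z.2 - w.2| < h].
Proof.
move=> h0.
have lo (x : R) : exists p : rat, x - h < ratr p < x.
  by have [|p] := @rat_in_itvoo R (x - h) x; [lra|rewrite in_itv/=; exists p].
have hi (x : R) : exists p : rat, x < ratr p < x + h.
  by have [|p] := @rat_in_itvoo R x (x + h); [lra|rewrite in_itv/=; exists p].
have [a /andP[a1 a2]] := lo z.1; have [b /andP[b1 b2]] := hi z.1.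
have [c /andP[c1 c2]] := lo z.2; have [d /andP[d1 d2]] := hi z.2.
exists (a, b, c, d); split => /=; [by rewrite a2|by rewrite c2|].
move=> w /andP[w1 w2] /andP[w3 w4].
by rewrite !ltr_norml; split; apply/andP; split; lra.
Qed.

(** The superlevel sets in the half-plane are unions of rational boxes, hence countable unions of
    measurable sets. *)
Lemma measurable_ext f : half_cont f -> measurable_fun [set: R * R] (ext f).
Proof.
move=> fc.
have mO r : measurable [set z : R * R | 0 < z.2 /\ r < f z].
  pose box (t : rat * rat * rat * rat) : set (R * R) :=
    `]ratr t.1.1.1, ratr t.1.1.2[%classic `*` `]ratr t.1.2, ratr t.2[%classic.
  have -> : [set z : R * R | 0 < z.2 /\ r < f z] =
      \bigcup_(t in [set t | box t `<=` [set z : R * R | 0 < z.2 /\ r < f z]]) box t.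
    apply/seteqP; split => [z [z0 rz]|z [t s]]; last exact: s.
    have [|h h0 hz] := fc z z0 (f z - r); first by rewrite subr_gt0.
    have [t [t1 t2 ht]] := rat_box z h0.
    exists t => /=; last by split; rewrite /= in_itv.
    move=> w [/= w1 w2]; rewrite !in_itv/= in w1 w2.
    have [b1 b2] := ht w w1 w2; have [w0] := hz w b1 b2.
    by rewrite ltr_norml => /andP[_ h3]; split => //; lra.
  rewrite bigcup_mkcond; apply: countable_bigcupT_measurable => [|t]; first exact: countableP.
  by case: ifP => // _; apply: measurableX; exact: measurable_itv.
apply: (measurability _ (RGenOInfty.measurableE R)) => _ [_ [r ->] <-].
rewrite setTI; have m0 : measurable [set z : R * R | z.2 <= 0].
  by apply: measurable_le_set; [exact: measurable_sndR|exact: measurable_cst].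
have [r0|r0] := ltP r 0.
  rewrite (_ : _ @^-1` _ = [set z : R * R | 0 < z.2 /\ r < f z] `|` [set z : R * R | z.2 <= 0]).
    exact: measurableU.
  apply/seteqP; split => z /=; rewrite in_itv/= andbT /ext; case: (ltP 0 z.2) => // z0.
  - by left.
  - by right.
  - by case=> [[]|] //; rewrite leNgt z0.
rewrite (_ : _ @^-1` _ = [set z : R * R | 0 < z.2 /\ r < f z])//.
apply/seteqP; split => z /=; rewrite in_itv/= andbT /ext; case: (ltP 0 z.2) => // z0.
- by rewrite ltNge r0.
- by case.
- by case.
Qed.

Lemma ucont_half_cont f : ucont f -> half_cont f.
Proof.
move=> fu z z0 e e0; have e2 : 0 < e / 2 by rewrite divr_gt0.
have [d d0 od] := fu _ e2; have [h h0 hz] := udist_small z0 d0.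
exists h => // w w1 w2; have [w0 zw] := hz w w1 w2; split=> //.
by have := od z w z0 w0 zw; lra.
Qed.

Lemma test_fun_half_cont f : test_fun f -> half_cont f.
Proof.
move=> [fc _] z z0 e e0.
have oH : open (@upper_half R).
  rewrite (_ : @upper_half R = snd @^-1` [set y : R | 0 < y])//.
  by apply: open_comp => [w _|]; [exact: cvg_snd|exact: open_gt].
move: fc; rewrite (continuous_open_subspace _ oH) => fc.
have /cvgrPdist_lt /(_ e e0) : {for z, continuous f} by apply: fc; rewrite inE.
move=> /nbhs_ballP [h h0 hf]; exists (Num.min h z.2); first by rewrite lt_min h0 z0.
move=> w; rewrite !lt_min => /andP[a1 a2] /andP[b1 b2].
split; last by apply: hf; split.
by move: b2; rewrite ltr_norml => /andP[]; lra.
Qed.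

(** Since [(z.2 - q.2)^2 < z.2 q.2] bounds the ratio of heights by 4, the denominator [z.2 q.2] may
    be replaced by [4 q.2^2]. *)
Lemma udist_near z q (r : R) : 0 < z.2 -> 0 < q.2 -> 0 < r -> r <= 1 -> udist z q < r ^+ 2 ->
  [/\ `|z.1 - q.1| < 2 * r * q.2, `|z.2 - q.2| < 2 * r * q.2 & z.2 < 4 * q.2].
Proof.
move=> z0 q0 r0 r1; rewrite /udist ltr_pdivrMr ?mulr_gt0// => h.
have zq : 0 < z.2 * q.2 by rewrite mulr_gt0.
have r2 : r ^+ 2 <= 1 by rewrite exprn_ile1// ltW.
have h1 : (z.2 - q.2) ^+ 2 < z.2 * q.2.
  apply: (@lt_le_trans _ _ (r ^+ 2 * (z.2 * q.2))); last by rewrite ler_piMl// ltW.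
  by apply: le_lt_trans h; rewrite lerDr sqr_ge0.
have z4 : z.2 < 4 * q.2 by rewrite ltNge; apply/negP => z4; nra.
have hb : (z.1 - q.1) ^+ 2 + (z.2 - q.2) ^+ 2 < (2 * r * q.2) ^+ 2.
  have -> : (2 * r * q.2) ^+ 2 = r ^+ 2 * (4 * q.2 * q.2) by ring.
  by apply: lt_le_trans h _; rewrite ler_pM2l ?exprn_gt0// ler_pM2r// ltW.
have p0 : 0 < 2 * r * q.2 by rewrite !mulr_gt0.
split=> //; rewrite -(ltr_pXn2r (n := 2)) ?nnegrE ?(ltW p0)// real_normK ?num_real//.
- by apply: le_lt_trans hb; rewrite lerDl sqr_ge0.
- by apply: le_lt_trans hb; rewrite lerDr sqr_ge0.
Qed.

End test_functions.

(** * Modular bumps with an explicit modulus of continuity *)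

Section bumps.
Context (R : realType).
Implicit Types (z w q : R * R) (f g : R * R -> R).

Lemma udistC z w : udist z w = udist w z.
Proof. by rewrite /udist (mulrC z.2); congr (_ / _); ring. Qed.

Lemma udist_ge0 z w : 0 < z.2 -> 0 < w.2 -> 0 <= udist z w.
Proof.
move=> z0 w0; rewrite /udist divr_ge0 ?addr_ge0 ?sqr_ge0//.
by rewrite mulr_ge0// ltW.
Qed.

(** The numerator in [E] is at most [48 r + 48 r + 8 r = 104 r] and [w.2 > 1/16], so 2000 is a
    generous constant. Other centres reduce to [i] by invariance. *)
Let udist_lip01 z w (r : R) : 0 < z.2 -> 0 < w.2 -> 0 < r -> r <= 4^-1 ->
  udist z (0, 1) < 1 -> udist z w < r ^+ 2 ->
  `|udist z (0, 1) - udist w (0, 1)| <= 2000 * r.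
Proof.
move=> z0 w0 r0 r1 zq zw.
have r1' : r <= 1 by lra.
have o0 : 0 < ((0, 1) : R * R).2 by exact: ltr01.
have zq' : udist z (0, 1) < 1 ^+ 2 by rewrite expr1n.
have [a1 a2 a3] := udist_near z0 o0 ltr01 (lexx _) zq'.
have zq2 : udist (0, 1) z < 1 ^+ 2 by rewrite udistC expr1n.
have [_ _ a4] := udist_near o0 z0 ltr01 (lexx _) zq2.
have wz : udist w z < r ^+ 2 by rewrite udistC.
have [b1 b2 _] := udist_near w0 z0 r0 r1' wz.
have [_ _ b3] := udist_near z0 w0 r0 r1' zw.
rewrite /= subr0 in a1; rewrite /= in a2 a3 a4.
have rz : 2 * r * z.2 <= 8 * r by nra.
have c1 : `|w.1 - z.1| <= 8 * r by rewrite (le_trans (ltW b1)).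
have c2 : `|w.2 - z.2| <= 8 * r by rewrite (le_trans (ltW b2)).
move: a1 a2; rewrite !ltr_norml => /andP[a1 a1'] /andP[a2 a2'].
have d1 : `|w.1 + z.1| <= 6 by move: c1; rewrite !ler_norml => /andP[]; lra.
have d2 : `|w.2 + z.2 - 2| <= 6 by move: c2; rewrite !ler_norml => /andP[]; lra.
have E : udist z (0, 1) - udist w (0, 1) =
    - ((w.1 - z.1) * (w.1 + z.1) + (w.2 - z.2) * (w.2 + z.2 - 2)
       - udist z (0, 1) * (w.2 - z.2)) / w.2.
  by rewrite /udist /=; field; rewrite !gt_eqF.
rewrite E normrM normrN (@ger0_norm _ (w.2)^-1) ?invr_ge0 ?(ltW w0)// ler_pdivrMr//.
have u0 : 0 <= udist z (0, 1) by exact: udist_ge0.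
have e1 : `|(w.1 - z.1) * (w.1 + z.1)| <= 8 * r * 6 by rewrite normrM ler_pM.
have e2 : `|(w.2 - z.2) * (w.2 + z.2 - 2)| <= 8 * r * 6 by rewrite normrM ler_pM.
have e3 : `|udist z (0, 1) * (w.2 - z.2)| <= 1 * (8 * r).
  by rewrite normrM ler_pM// ger0_norm// ltW.
apply: le_trans (ler_normB _ _) _; apply: le_trans (lerD (ler_normD _ _) (lexx _)) _.
nra.
Qed.

Lemma udist_lip z w q (r : R) : 0 < z.2 -> 0 < w.2 -> 0 < q.2 -> 0 < r -> r <= 4^-1 ->
  udist z q < 1 -> udist z w < r ^+ 2 -> `|udist z q - udist w q| <= 2000 * r.
Proof.
move=> z0 w0 q0 r0 r1.
have D : 0 < 1 * q.2 - - q.1 * 0 by rewrite mulr0 subr0 mul1r.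
have qE : mobR 1 (- q.1) 0 q.2 q = (0, 1).
  by case: q q0 {D} => x y /= y0; rewrite /mobR /mobden /=; congr pair; field; rewrite gt_eqF.
have p0 v : 0 < v.2 -> 0 < (mobR 1 (- q.1) 0 q.2 v).2.
  by move=> v0; exact: mobR_gt0.
rewrite -(udist_mobR D z0 q0) -(udist_mobR D z0 w0) -(udist_mobR D w0 q0) qE.
by move=> h1 h2; apply: udist_lip01 => //; exact: p0.
Qed.

Definition cone q (K : R) z : R := Num.max 0 (1 - K * udist z q).

Let max0_lip (s t : R) : `|Num.max 0 s - Num.max 0 t| <= `|s - t|.
Proof.
have [s0|s0] := leP 0 s; have [t0|t0] := leP 0 t; rewrite ?subr0 ?sub0r ?normrN ?normr0//.
- by rewrite !ger0_norm; lra.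
- by rewrite (ger0_norm t0) (@ler0_norm _ (s - t)); lra.
Qed.

Lemma cone_osc q (K r : R) : 0 < q.2 -> 1 <= K -> 0 < r -> r <= 4^-1 ->
  osc (cone q K) (r ^+ 2) (K * (2000 * r)).
Proof.
move=> q0 K1 r0 r1.
have K0 : 0 < K by lra.
have near z w : 0 < z.2 -> 0 < w.2 -> udist z q < 1 -> udist z w < r ^+ 2 ->
    `|cone q K z - cone q K w| <= K * (2000 * r).
  move=> z0 w0 zq zw; apply: le_trans (max0_lip _ _) _.
  have -> : 1 - K * udist z q - (1 - K * udist w q) = K * (udist w q - udist z q) by ring.
  rewrite normrM gtr0_norm// ler_pM2l// distrC.
  exact: udist_lip.
have far z : 1 <= udist z q -> cone q K z = 0.
  by move=> zq; rewrite /cone max_l//; nra.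
move=> z w z0 w0 zw.
have [zq|zq] := ltP (udist z q) 1; first exact: near.
have [wq|wq] := ltP (udist w q) 1; first by rewrite distrC near// udistC.
rewrite !far// subrr normr0; have : 0 < K * r by rewrite mulr_gt0.
by lra.
Qed.

Let orbit q K z := [set cone q K (mact m z) | m in SL2Z].

(** A supremum over the modular orbit rather than a Poincare series: it stays below 1 and inherits
    the modulus of [cone] without counting orbit points. *)
Definition bump q (K : R) z : R := if 0 < z.2 then sup (orbit q K z) else 0.

Let cone01 q K z : 0 < q.2 -> 0 <= K -> 0 < z.2 -> 0 <= cone q K z <= 1.
Proof.
move=> q0 K0 z0; rewrite /cone le_max lexx /= ge_max ler01 /= gerBl.
by rewrite mulr_ge0// udist_ge0.
Qed.

Lemma mact_gt0 m z : SL2Z m -> 0 < z.2 -> 0 < (mact m z).2.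
Proof. by move=> mS z0; apply: mobZ_gt0 => //; rewrite -/(mdet m) mS. Qed.

Let orbit_sup q K z : 0 < q.2 -> 0 <= K -> 0 < z.2 -> has_sup (orbit q K z).
Proof.
move=> q0 K0 z0; split.
  by exists (cone q K (mact (1, 0, 0, 1) z)); exists (1, 0, 0, 1).
exists 1 => _ [m mS <-].
by have /andP[] := cone01 q0 K0 (mact_gt0 mS z0).
Qed.

Lemma cone_le_bump q K z m : 0 < q.2 -> 0 <= K -> 0 < z.2 -> SL2Z m ->
  cone q K (mact m z) <= bump q K z.
Proof.
move=> q0 K0 z0 mS; rewrite /bump z0; apply: sup_upper_bound; first exact: orbit_sup.
by exists m.
Qed.

Let mobZ1 z : mobZ 1 0 0 1 z = z.
Proof. by rewrite mobZ_scalar// mulr0 mulr0z addr0; case: z. Qed.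

Lemma cone_le_bump1 q K z : 0 < q.2 -> 0 <= K -> 0 < z.2 -> cone q K z <= bump q K z.
Proof.
move=> q0 K0 z0; have S1 : SL2Z (1, 0, 0, 1) by [].
by have := cone_le_bump q0 K0 z0 S1; rewrite /mact /= mobZ1.
Qed.

Lemma bump_le q K z (c : R) : 0 < q.2 -> 0 <= K -> 0 < z.2 ->
  (forall m, SL2Z m -> cone q K (mact m z) <= c) -> bump q K z <= c.
Proof.
move=> q0 K0 z0 H; rewrite /bump z0; apply: ge_sup; first by case: (orbit_sup q0 K0 z0).
by move=> _ [m mS <-]; exact: H.
Qed.

Lemma bump01 q K z : 0 < q.2 -> 0 <= K -> 0 <= bump q K z <= 1.
Proof.
move=> q0 K0; have [z0|z0] := ltP 0 z.2; last first.
  by rewrite /bump ltNge z0 /= lexx ler01.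
have S1 : SL2Z (1, 0, 0, 1) by [].
rewrite (le_trans _ (cone_le_bump q0 K0 z0 S1)) /=.
  by apply: bump_le => // m mS; have /andP[] := cone01 q0 K0 (mact_gt0 mS z0).
by have /andP[] := cone01 q0 K0 (mact_gt0 S1 z0).
Qed.

Lemma bump_modular q K : 0 < q.2 -> 0 <= K -> modular (bump q K).
Proof.
move=> q0 K0.
have le a b c d z : a * d - b * c = 1 -> 0 < z.2 -> bump q K (mobZ a b c d z) <= bump q K z.
  move=> D z0; have z1 : 0 < (mobZ a b c d z).2 by apply: mobZ_gt0 => //; rewrite D.
  apply: bump_le => // -[[[a' b'] c'] d'] mS; rewrite /mact mobZ_comp//; last 2 first.
  - by move: mS; rewrite /SL2Z /= /mdet /= => ->.
  - by rewrite D.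
  have E : a' * d' - b' * c' = 1 by exact: mS.
  have S : (a' * a + b' * c) * (c' * b + d' * d) - (a' * b + b' * d) * (c' * a + d' * c) = 1.
    apply: (@etrans _ _ ((a * d - b * c) * (a' * d' - b' * c'))); first by ring.
    by rewrite D E.
  exact: (@cone_le_bump _ _ _ (_, _, _, _) q0 K0 z0 S).
move=> a b c d z D z0; apply/eqP; rewrite eq_le le//=.
have z1 : 0 < (mobZ a b c d z).2 by apply: mobZ_gt0 => //; rewrite D.
(* The reverse inequality is the one just proved, for the inverse matrix. *)
have := @le d (- b) (- c) a _ _ z1.
have D' : d * a - - b * - c = 1 by rewrite mulrNN mulrC.
move=> /(_ D'); rewrite mobZ_comp ?D ?D'//.
have -> : d * a + - b * c = 1 by rewrite mulNr mulrC.
have -> : d * b + - b * d = 0 by rewrite mulNr mulrC subrr.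
have -> : - c * a + a * c = 0 by rewrite mulNr mulrC addNr.
have -> : - c * b + a * d = 1 by rewrite -[RHS]D; ring.
by rewrite mobZ1.
Qed.

Lemma bump_osc q (K r : R) : 0 < q.2 -> 1 <= K -> 0 < r -> r <= 4^-1 ->
  osc (bump q K) (r ^+ 2) (K * (2000 * r)).
Proof.
move=> q0 K1 r0 r1; have K0 : 0 <= K by lra.
have le z w : 0 < z.2 -> 0 < w.2 -> udist z w < r ^+ 2 ->
    bump q K z <= bump q K w + K * (2000 * r).
  move=> z0 w0 zw; apply: bump_le => // m mS.
  have zw' : udist (mact m z) (mact m w) < r ^+ 2 by rewrite udist_mobZ// -/(mdet m) mS.
  have := cone_osc q0 K1 r0 r1 (mact_gt0 mS z0) (mact_gt0 mS w0) zw'.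
  have := cone_le_bump q0 K0 w0 mS.
  by move=> h; rewrite ler_norml => /andP[_]; lra.
move=> z w z0 w0 zw; have h := le z w z0 w0 zw.
have h' := le w z w0 z0; rewrite udistC in h'.
by rewrite ler_norml; apply/andP; split; have := h' zw; lra.
Qed.

Lemma bump_ucont q (K : R) : 0 < q.2 -> 1 <= K -> ucont (bump q K).
Proof.
move=> q0 K1 e e0; have K0 : 0 < K by lra.
have e1 : 0 < e / 2000 by lra.
pose r := Num.min 4^-1 (e / 2000 / K).
have r0 : 0 < r by rewrite lt_min (divr_gt0 e1 K0) andbT invr_gt0 ltr0n.
have r1 : r <= 4^-1 by rewrite ge_min lexx.
exists (r ^+ 2); first by rewrite exprn_gt0.
move=> z w z0 w0 zw; apply: le_trans (bump_osc q0 K1 r0 r1 z0 w0 zw) _.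
have re : r <= e / 2000 / K by rewrite ge_min lexx orbT.
by move: re; rewrite ler_pdivlMr//; lra.
Qed.

Lemma bump_bm q (K : R) : 0 < q.2 -> 1 <= K -> bounded_measurable (bump q K).
Proof.
move=> q0 K1; have K0 : 0 <= K by lra.
split; last first.
  by exists 1 => z; have /andP[h0 h1] := bump01 z q0 K0; rewrite ger0_norm.
rewrite (_ : bump q K = ext (bump q K)); last first.
  by apply/funext => z; rewrite /ext /bump; case: ifP.
by apply: measurable_ext; apply: ucont_half_cont; exact: bump_ucont.
Qed.

End bumps.

(** * Approximation from below by finite maxima of bumps *)

Section lower_family.
Context (R : realType).
Local Notation FD := (@fund_dom R).
Implicit Types (z w q : R * R) (f g : R * R -> R).

Definition nice f := [/\ bounded_measurable f, modular f & ucont f].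

Lemma nice0 : nice (fun=> 0).
Proof.
split=> //; first exact: bm_cst.
by move=> e e0; exists 1 => // z w _ _ _; rewrite subrr normr0 ltW.
Qed.

Lemma nice_scale (c : R) f : 0 <= c -> nice f -> nice (fun z => c * f z).
Proof.
move=> c0 [bf fm fu]; split.
- by apply: bm_mul => //; exact: bm_cst.
- by move=> a b c' d z D z0; rewrite fm.
move=> e e0; have c1 : 0 < c + 1 by lra.
have [|d d0 od] := fu (e / (c + 1)); first by rewrite divr_gt0.
exists d => // z w z0 w0 zw; rewrite -mulrBr normrM ger0_norm//.
apply: (@le_trans _ _ ((c + 1) * `|f z - f w|)); first by rewrite ler_wpM2r//; lra.
by rewrite mulrC -ler_pdivlMr//; exact: od.
Qed.

Lemma max_lip (a b c d e : R) : `|a - c| <= e -> `|b - d| <= e ->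
  `|Num.max a b - Num.max c d| <= e.
Proof.
rewrite !ler_norml => /andP[h1 h2] /andP[h3 h4].
have [h5|h5] := leP a b; have [h6|h6] := leP c d; apply/andP; split; lra.
Qed.

Lemma nice_max f g : nice f -> nice g -> nice (fun z => Num.max (f z) (g z)).
Proof.
move=> [[mf [M fM]] fm fu] [[mg [N gN]] gm gu]; split.
- split; first exact: measurable_maxr.
  exists (M + N) => z; have := fM z; have := gN z.
  have := normr_ge0 (f z); have := normr_ge0 (g z).
  by case: (leP (f z) (g z)) => _; lra.
- by move=> a b c d z D z0; rewrite fm// gm.
move=> e e0; have [d1 d10 o1] := fu e e0; have [d2 d20 o2] := gu e e0.
exists (Num.min d1 d2); first by rewrite lt_min d10.
by move=> z w z0 w0; rewrite lt_min => /andP[h1 h2]; apply: max_lip; [exact: o1|exact: o2].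
Qed.

(* Indices that do not decode to [(c, x, y, K)] with [0 <= c] and [0 < y] give the
   zero function. *)
Definition basic (i : nat) : R * R -> R :=
  if @unpickle (rat * rat * rat * nat)%type i is Some (c, x, y, K) then
    if (0 <= c) && (0 < y) then
      fun z => ratr c * bump (ratr x, ratr y) K.+1%:R z
    else fun=> 0
  else fun=> 0.

Lemma basicE (c x y : rat) (K : nat) : 0 <= c -> 0 < y ->
  basic (pickle (c, x, y, K)) = (fun z => ratr c * bump (ratr x, ratr y) K.+1%:R z).
Proof. by move=> c0 y0; rewrite /basic pickleK c0 y0. Qed.

Lemma basic_nice i : nice (basic i).
Proof.
rewrite /basic; case: unpickle => [[[[c x] y] K]|]; last exact: nice0.
case: ifPn => [/andP[c0 y0]|_]; last exact: nice0.
have y0' : 0 < ((ratr x, ratr y) : R * R).2 by rewrite /= ltr0q.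
have K1 : 1 <= K.+1%:R :> R by rewrite ler1n.
apply: nice_scale; first by rewrite ler0q.
split; [exact: bump_bm|exact: bump_modular|exact: bump_ucont].
Qed.

Lemma basic_off i z : z.2 <= 0 -> basic i z = 0.
Proof.
move=> z0; rewrite /basic; case: unpickle => [[[[c x] y] K]|//].
by case: ifPn => // _; rewrite /bump ltNge z0 /= mulr0.
Qed.

(** A rational level [c] just below [f z] times a bump so narrow that [f > c] on its support near
    [z]; modularity carries the bound to the whole orbit. *)
Lemma basic_approx f z (e : R) : modular f -> half_cont f ->
  (forall z, 0 < z.2 -> 0 <= f z) -> 0 < z.2 -> 0 < e ->
  exists i, (forall w, 0 < w.2 -> basic i w <= f w) /\ f z - e <= basic i z.
Proof.
move=> fm fc f0 z0 e0.
have [fz|fz] := leP (f z) e.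
  exists (pickle ((0 : rat), (0 : rat), (1 : rat), 0%N)); rewrite basicE//; split.
    by move=> w w0; rewrite rmorph0 mul0r f0.
  by rewrite rmorph0 mul0r; lra.
have [|c] := @rat_in_itvoo R (Num.max 0 (f z - e / 2)) (f z).
  by rewrite gt_max; apply/andP; split; lra.
rewrite in_itv/= gt_max => /andP[/andP[c0 c1] c2].
have c0' : 0 < c by rewrite -(ltr0q R).
have [|h h0 hz] := fc z z0 (f z - ratr c); first by lra.
(* The support [udist < 1 / K <= r^2] has Euclidean radius [2 r q.2 < 4 r z.2 <= h / 2] about [q];
   the other half of [h] is kept for the distance from [q] to [z]. *)
pose r := Num.min 1 (h / (8 * z.2)).
have r0 : 0 < r by rewrite lt_min ltr01 divr_gt0// mulr_gt0.
have r1 : r <= 1 by rewrite ge_min lexx.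
have rh : r * (8 * z.2) <= h.
  by rewrite -ler_pdivlMr ?mulr_gt0// ge_min lexx orbT.
pose K := Num.truncn (r ^+ 2)^-1.
have rr : 0 < r ^+ 2 by rewrite exprn_gt0.
have K0 : 0 < K.+1%:R :> R by rewrite ltr0n.
have Kr : 1 <= K.+1%:R * r ^+ 2.
  by rewrite -ler_pdivrMr// div1r; apply/ltW; rewrite truncnS_gt.
have D0 : 0 < 2 * ratr c * K.+1%:R :> R by exact: mulr_gt0 (mulr_gt0 (ltr0Sn R 1) c0) K0.
(* With [udist z q] below this, moving the centre from [z] to the rational point [q] costs at most
   [e / 2] of the value at [z]. *)
have d0 : 0 < e / (2 * ratr c * K.+1%:R) by rewrite divr_gt0.
have [h' h'0 hz'] := udist_small z0 d0.
pose t := Num.min h' (Num.min (h / 2) z.2).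
have t0 : 0 < t by rewrite !lt_min h'0 z0 divr_gt0.
have near (s : R) : exists p : rat, `|s - ratr p| < t.
  have [|p] := @rat_in_itvoo R (s - t) (s + t); first by lra.
  by rewrite in_itv/= => /andP[p1 p2]; exists p; rewrite ltr_norml; apply/andP; split; lra.
have [x xz] := near z.1; have [y yz] := near z.2.
move: xz yz; rewrite !lt_min => /and3P[x1 x2 _] /and3P[y1 y2 y3].
have [q0 zq] := hz' (ratr x, ratr y) x1 y1.
set q := (ratr x, ratr y) in q0 zq.
rewrite -[ratr x]/(q.1) in x2; rewrite -[ratr y]/(q.2) in y2 y3.
have y0 : 0 < y by rewrite -(ltr0q R).
exists (pickle (c, x, y, K)); rewrite (basicE _ _ (ltW c0') y0) -/q.
split=> [w w0|]; last first.
  apply: (@le_trans _ _ (ratr c * (1 - K.+1%:R * udist z q))).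
    move: zq; rewrite ltr_pdivlMr// => zq; lra.
  rewrite ler_pM2l//; apply: le_trans (cone_le_bump1 _ _ _) => //.
  by rewrite /cone le_max lexx orbT.
rewrite mulrC -ler_pdivlMr//; apply: bump_le => // m mS.
have w0' := mact_gt0 mS w0.
have -> : f w = f (mact m w) by rewrite /mact fm.
rewrite /cone ge_max divr_ge0 ?f0 ?(ltW c0)//=.
have [u1|u1] := leP 1 (K.+1%:R * udist (mact m w) q).
  by apply: (@le_trans _ _ 0); [lra|rewrite divr_ge0 ?f0 ?(ltW c0)].
have u0 : 0 <= K.+1%:R * udist (mact m w) q.
  by rewrite mulr_ge0// udist_ge0.
apply: (@le_trans _ _ 1); first by lra.
rewrite ler_pdivlMr// mul1r.
have ur : udist (mact m w) q < r ^+ 2.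
  by rewrite -(ltr_pM2l K0); apply: lt_le_trans u1 Kr.
have [v1 v2 _] := udist_near w0' q0 r0 r1 ur.
have q2 : q.2 < 2 * z.2 by move: y3; rewrite ltr_norml => /andP[]; lra.
have q3 : 2 * r * q.2 <= h / 2.
  apply: (@le_trans _ _ (2 * r * (2 * z.2))); last by lra.
  by rewrite ler_pM2l ?mulr_gt0// ltW.
have b1 : `|z.1 - (mact m w).1| < h.
  move: x2 (lt_le_trans v1 q3); rewrite !ltr_norml => /andP[g1 g2] /andP[g3 g4].
  by apply/andP; split; lra.
have b2 : `|z.2 - (mact m w).2| < h.
  move: y2 (lt_le_trans v2 q3); rewrite !ltr_norml => /andP[g1 g2] /andP[g3 g4].
  by apply/andP; split; lra.
have [_] := hz _ b1 b2; rewrite ltr_norml => /andP[_]; lra.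
Qed.

Definition basicmax (s : seq nat) : R * R -> R :=
  foldr (fun i g z => Num.max (basic i z) (g z)) (fun=> 0) s.

Lemma basicmax_nice s : nice (basicmax s).
Proof.
by elim: s => [|i s IH] /=; [exact: nice0|apply: nice_max => //; exact: basic_nice].
Qed.

Lemma basicmax_ge0 s z : 0 <= basicmax s z.
Proof. by elim: s => //= i s IH; rewrite le_max IH orbT. Qed.

Lemma basicmax_off s z : z.2 <= 0 -> basicmax s z = 0.
Proof. by move=> z0; elim: s => //= i s ->; rewrite basic_off// maxxx. Qed.

Lemma basicmax_le s z (c : R) : 0 <= c -> (forall i, i \in s -> basic i z <= c) ->
  basicmax s z <= c.
Proof.
move=> c0; elim: s => //= i s IH H; rewrite ge_max H ?mem_head//=.
by apply: IH => j js; apply: H; rewrite in_cons js orbT.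
Qed.

Lemma basic_le_max s z i : i \in s -> basic i z <= basicmax s z.
Proof.
elim: s => //= j s IH; rewrite in_cons => /orP[/eqP ->|/IH h]; first by rewrite le_max lexx.
by rewrite le_max h orbT.
Qed.

Lemma int_muME f : int_muM f = 3 / pi * imu f. Proof. by []. Qed.

Definition lowfam (i : nat) : R * R -> R := basicmax (odflt [::] (unpickle i)).

Lemma lowfam_nice i : nice (lowfam i). Proof. exact: basicmax_nice. Qed.

(** The maxima of the first [n] basic functions lying below [f] tend to [f] pointwise, so dominated
    convergence brings their means to that of [f]. *)
Lemma lowfam_approx f (M : R) : modular f -> half_cont f ->
  (forall z, 0 < z.2 -> 0 <= f z <= M) -> forall e : R, 0 < e ->
  exists i, (forall w, 0 < w.2 -> lowfam i w <= f w) /\ int_muM f - e < int_muM (lowfam i).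
Proof.
move=> fm fc fM e e0.
have f0 z : 0 < z.2 -> 0 <= f z by move=> /fM/andP[].
pose P i := `[< forall w, 0 < w.2 -> basic i w <= f w >].
pose s n := [seq i <- iota 0 n | P i].
pose F n z := ext f z - basicmax (s n) z.
have sf n z : 0 < z.2 -> basicmax (s n) z <= f z.
  move=> z0; apply: basicmax_le; first exact: f0.
  by move=> i; rewrite mem_filter => /andP[/asboolP Pi _]; exact: Pi.
have mext : measurable_fun [set: R * R] (ext f) by exact: measurable_ext.
have M0 : 0 <= M by have /andP[h1 h2] := fM (0, 1) ltr01; exact: le_trans h2.
have bext : bounded_measurable (ext f).
  split=> //; exists M => z; rewrite /ext; case: ifPn => z0; last by rewrite normr0.
  by have /andP[h1 h2] := fM z z0; rewrite ger0_norm.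
have bF n : bounded_measurable (F n).
  by apply: bm_add => //; apply: bm_opp; have [] := basicmax_nice (s n).
have FM n z : `|F n z| <= M.
  rewrite /F /ext; case: ifPn => z0; last by rewrite basicmax_off ?subr0 ?normr0// leNgt.
  have /andP[h1 h2] := fM z z0; have h3 := sf n z z0; have h4 := basicmax_ge0 (s n) z.
  by rewrite ger0_norm; lra.
have F0 z : FD z -> F n z @[n --> \oo] --> (0 : R).
  move=> [_ [_ z0]]; apply/cvgrPdist_le => d d0.
  have [i [Pi iz]] := basic_approx fm fc f0 z0 d0.
  exists i.+1 => // n /= ni; rewrite sub0r normrN /F extE//.
  have h3 := sf n z z0; have h4 : basic i z <= basicmax (s n) z.
    by apply: basic_le_max; rewrite mem_filter mem_iota add0n ni /= andbT; apply/asboolP.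
  by rewrite ger0_norm; lra.
have pi0 := @pi_gt0 R.
have e1 : 0 < e * pi / 4 by rewrite divr_gt0// mulr_gt0.
have /cvgrPdist_le/(_ _ e1) [n _ /(_ n (leqnn n))] := imu_cvg0 (fun n => (bF n).1) FM F0.
rewrite /= sub0r normrN => hn; exists (pickle (s n)).
rewrite /lowfam pickleK /=; split; first exact: sf.
have [bg _ _] := basicmax_nice (s n).
have E : imu f = imu (F n) + imu (basicmax (s n)).
  rewrite -imuD//; apply: eq_imu => z [_ [_ z0]].
  by rewrite /F extE// subrK.
rewrite !int_muME E mulrDr ltrBlDr addrC ltrD2l.
apply: (@le_lt_trans _ _ (3 / pi * (e * pi / 4))).
  rewrite ler_pM2l ?divr_gt0//; exact: le_trans (ler_norm _) hn.
have -> : 3 / pi * (e * pi / 4) = 3 / 4 * e by move: pi0; move: (@pi R) => p p0; field; rewrite gt_eqF.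
lra.
Qed.

End lower_family.

(** * Almost everywhere convergence along sparse scales *)

Section weak_convergence.
Context (R : realType).
Implicit Types (z w : R * R) (f g : R * R -> R).

Let half_cont_affine f (a c : R) : half_cont f -> half_cont (fun z => a * f z + c).
Proof.
move=> fc z z0 e e0; have a0 : 0 < `|a| + 1 by have := normr_ge0 a; lra.
have [|h h0 hf] := fc z z0 (e / (`|a| + 1)); first by rewrite divr_gt0.
exists h => // w h1 h2; have [w0 fw] := hf w h1 h2; split=> //.
have -> : a * f z + c - (a * f w + c) = a * (f z - f w) by ring.
move: fw; rewrite ltr_pdivlMr// mulrDr mulr1 normrM mulrC.
by have := normr_ge0 (f z - f w); lra.
Qed.

Let bm_ext f (M : R) : half_cont f -> (forall z, 0 < z.2 -> `|f z| <= M) ->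
  bounded_measurable (ext f).
Proof.
move=> fc fM; split; first exact: measurable_ext.
exists M => z; rewrite /ext; case: ifPn => z0; first exact: fM.
by rewrite normr0; apply: le_trans (fM (0, 1) ltr01).
Qed.

Lemma int_muM_affine f (M a c : R) : half_cont f -> (forall z, 0 < z.2 -> `|f z| <= M) ->
  int_muM (fun z => a * f z + c) = a * int_muM f + c.
Proof.
move=> fc fM; rewrite !int_muME; have bf := bm_ext fc fM.
have -> : imu (fun z => a * f z + c) = imu (fun z => a * ext f z + c).
  by apply: eq_imu => z [_ [_ z0]]; rewrite extE.
have -> : imu f = imu (ext f) by apply: eq_imu => z [_ [_ z0]]; rewrite extE.
rewrite imuD; [|by apply: bm_mul => //; exact: bm_cst|exact: bm_cst].
rewrite imuZ// imu_cst; have := @pi_gt0 R; move: (@pi R) => p p0.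
by field; rewrite gt_eqF.
Qed.

(* Weak convergence of normalised positive functionals [L j] only has to be
   tested from below, and only on the functions [lowfam i]. *)
Lemma sandwich (L : nat -> (R * R -> R) -> R) :
  (forall j f g, (forall w, 0 < w.2 -> f w <= g w) -> L j f <= L j g) ->
  (forall j f a c, L j (fun z => a * f z + c) = a * L j f + c) ->
  (forall i, L j (@lowfam R i) @[j --> \oo] --> int_muM (@lowfam R i)) ->
  forall f, test_fun f -> L j f @[j --> \oo] --> int_muM f.
Proof.
move=> Lpos Laff Llow f tf.
have fc := test_fun_half_cont tf; have [_ [[M fM] fm]] := tf.
have fm' : modular f by move=> a b c d z D z0; rewrite -(moebiusE z D) fm.
(* Applied with [a = 1] and [a = -1]: adding [M] makes [a * f] nonnegative, and a lower bound for
   [- f] is an upper bound for [f]. *)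
have lower a e : `|a| = 1 -> 0 < e -> \forall j \near \oo, a * int_muM f - e <= a * L j f.
  move=> a1 e0; have e2 : 0 < e / 2 by rewrite divr_gt0.
  have fa z : 0 < z.2 -> `|a * f z| <= M by move=> z0; rewrite normrM a1 mul1r fM.
  have [||z z0|i [i1 i2]] := @lowfam_approx R (fun z => a * f z + M) (2 * M) _ _ _ (e / 2) e2.
  - by move=> b b' c d z D z0; rewrite fm'.
  - exact: half_cont_affine.
  - by have := fa z z0; rewrite ler_norml => /andP[h1 h2]; apply/andP; split; lra.
  rewrite (int_muM_affine _ _ fc fM) in i2.
  have /cvgrPdist_le/(_ _ e2) := Llow i; apply: filterS => j.
  rewrite ler_norml => /andP[h1 h2].
  have := Lpos j _ _ i1; rewrite Laff => h3; lra.
apply/cvgrPdist_le => e e0.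
have h1 : \forall j \near \oo, 1 * int_muM f - e <= 1 * L j f by apply: lower; rewrite ?normr1.
have h2 : \forall j \near \oo, -1 * int_muM f - e <= -1 * L j f.
  by apply: lower; rewrite ?normrN ?normr1.
by near=> j; rewrite ler_norml; apply/andP; split;
  [have : -1 * int_muM f - e <= -1 * L j f by near: j
  |have : 1 * int_muM f - e <= 1 * L j f by near: j]; lra.
Unshelve. all: by end_near. Qed.

Lemma average_affine (n : nat) (P : pred nat) (d : nat) (F : nat -> R) (a c : R) :
  (0 < d)%N -> \sum_(j < n | P j) 1 = d ->
  d%:R^-1 * (\sum_(j < n | P j) (a * F j + c)) = a * (d%:R^-1 * \sum_(j < n | P j) F j) + c.
Proof.
move=> d0 dE; have dn : d%:R != 0 :> R by rewrite pnatr_eq0 -lt0n.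
rewrite big_split /= -mulr_sumr.
have -> : \sum_(j < n | P j) c = d%:R * c.
  by rewrite -dE natr_sum mulr_suml; apply: eq_bigr => j _; rewrite mul1r.
by field.
Qed.

Lemma int_delta_affine (n : nat) x y f (a c : R) : (0 < n)%N ->
  int_delta n x y (fun z => a * f z + c) = a * int_delta n x y f + c.
Proof.
move=> n0; apply: (@average_affine n xpredT n (fun j => f (x + j%:R / n%:R, y))) => //.
by rewrite sum1_card card_ord.
Qed.

Lemma int_delta_pr_affine (n : nat) x y f (a c : R) : (0 < n)%N ->
  int_delta_pr n x y (fun z => a * f z + c) = a * int_delta_pr n x y f + c.
Proof.
move=> n0; apply: (@average_affine n (fun j => coprime j n) (totient n) (fun j => f (x + j%:R / n%:R, y))).
  by rewrite totient_gt0.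
by rewrite totient_count_coprime big_mkord big_mkcond; apply: eq_bigr => j _; rewrite coprime_sym; case: coprime.
Qed.

Lemma le_int_delta (n : nat) x y f g : 0 < y -> (forall w, 0 < w.2 -> f w <= g w) ->
  int_delta n x y f <= int_delta n x y g.
Proof.
by move=> y0 fg; rewrite /int_delta ler_wpM2l ?invr_ge0// ler_sum// => j _; apply: fg.
Qed.

Lemma le_int_delta_pr (n : nat) x y f g : 0 < y -> (forall w, 0 < w.2 -> f w <= g w) ->
  int_delta_pr n x y f <= int_delta_pr n x y g.
Proof.
by move=> y0 fg; rewrite /int_delta_pr ler_wpM2l ?invr_ge0// ler_sum// => j _; apply: fg.
Qed.

(** The residues prime to [2 ^ k.+1] are the odd ones; the even ones reproduce the points at scale
    [2 ^ k]. *)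
Lemma int_delta_prE k x y f :
  int_delta_pr (2 ^ k.+1) x y f = 2 * int_delta (2 ^ k.+1) x y f - int_delta (2 ^ k) x y f.
Proof.
rewrite /int_delta_pr /int_delta totient_pfactor// mul1n /=.
pose F (j : nat) : R := f (x + j%:R / (2 ^ k.+1)%:R, y).
have k0 : (2 ^ k)%:R != 0 :> R by rewrite pnatr_eq0 -lt0n expn_gt0.
have -> : \sum_(j < 2 ^ k.+1 | coprime j (2 ^ k.+1)) f (x + j%:R / (2 ^ k.+1)%:R, y) =
    \sum_(0 <= i < 2 ^ k) F (2 * i).+1.
  rewrite -(big_mkord (fun j => coprime j (2 ^ k.+1)) F) big_mkcond [X in \sum_(0 <= i < X) _]expnS sum_nat_double.
  apply: eq_bigr => i _; rewrite !coprime_pexpr// !coprimen2 /= mul2n odd_double.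
  by rewrite /= add0r.
have -> : \sum_(j < 2 ^ k.+1) f (x + j%:R / (2 ^ k.+1)%:R, y) =
    \sum_(j < 2 ^ k) f (x + j%:R / (2 ^ k)%:R, y) + \sum_(0 <= i < 2 ^ k) F (2 * i).+1.
  rewrite -(big_mkord xpredT F) [X in \sum_(0 <= i < X) _]expnS sum_nat_double big_split /=.
  congr (_ + _); rewrite big_mkord; apply: eq_bigr => j _.
  by rewrite /F expnS !natrM; congr (f (x + _, y)); field.
rewrite expnS natrM; field.
by rewrite k0.
Qed.

End weak_convergence.

Section almost_everywhere_convergence.
Context (R : realType).
Local Notation mu := (@lebesgue_measure R).

(* Borel--Cantelli. *)
Lemma ae_cvg0 (u : nat -> R -> R) (J : nat) : (forall j, measurable_fun [set: R] (u j)) ->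
  (forall j x, 0 <= u j x) ->
  (forall j, (J <= j)%N -> (\int[mu]_(x in `[0%R, 1%R]) (u j x)%:E <= ((2^-1) ^+ j)%:E)%E) ->
  {ae mu, forall x, `[0%R, 1%R]%classic x -> u j x @[j --> \oo] --> (0 : R)}.
Proof.
move=> mu_ u0 uJ.
(* The series starts at [J], where the geometric bounds begin; the limit is unaffected. *)
pose v j x : \bar R := (u (j + J)%N x)%:E.
have v0 j x : (0 <= v j x)%E by rewrite lee_fin.
have mv j : measurable_fun (`[0%R, 1%R] : set (measurableTypeR R)) (v j).
  by apply/measurable_funTS/measurable_EFinP; exact: mu_.
have sum2 n : \sum_(0 <= i < n) (2^-1) ^+ i <= 2 :> R.
  have -> : \sum_(0 <= i < n) (2^-1) ^+ i = 2 - 2 * (2^-1) ^+ n :> R.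
    elim: n => [|n IH]; first by rewrite big_geq// expr0; ring.
    by rewrite big_nat_recr//= IH exprS; field.
  by rewrite gerBl mulr_ge0// exprn_ge0.
have vs : (\sum_(0 <= j <oo) \int[mu]_(x in `[0%R, 1%R]) v j x <= 2%:E)%E.
  apply: lime_le.
    by apply: is_cvg_nneseries => j _ _; apply: integral_ge0 => x _.
  apply: nearW => n; apply: (@le_trans _ _ (\sum_(0 <= i < n) ((2^-1) ^+ i)%:E)%E).
    apply: lee_sum => i _; apply: (le_trans (uJ _ (leq_addl _ _))).
    by rewrite lee_fin exprD ler_piMr ?exprn_ge0// exprn_ile1//; lra.
  by rewrite sumEFin lee_fin.
have iS : mu.-integrable `[0%R, 1%R] (fun x => \sum_(0 <= j <oo) v j x)%E.
  apply/integrableP; split; first by apply: ge0_emeasurable_sum.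
  apply: (@le_lt_trans _ _ 2%:E); last by rewrite ltry.
  under eq_integral do rewrite gee0_abs ?nneseries_ge0//.
  by rewrite integral_nneseries.
have := integrable_ae _ iS => /(_ (measurable_itv _)); apply: filterS => x xS x01.
have {}xS := xS x01.
have cv : cvgn (series (fun j => u (j + J)%N x)).
  apply: nondecreasing_is_cvgn; first by apply/nondecreasing_seqP => n; rewrite seriesSr lerDl.
  exists (fine (\sum_(0 <= j <oo) v j x)%E) => _ [n _ <-].
  rewrite -lee_fin fineK// /series /= -sumEFin.
  by apply: nneseries_lim_ge => j _ _; exact: v0.
by have := cvg_series_cvg_0 cv; rewrite (cvg_shiftn J (fun j => u j x)).
Qed.

End almost_everywhere_convergence.

Section scales.
Context (R : realType).
Local Notation mu := (@lebesgue_measure R).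

(** Diagonal choice: stage [j] serves the functions of index at most [j] and all heights with
    [2 ^ k * y <= j], with errors that are summable. The predecessor [(kk j).-1] is included because
    the primitive measure also involves the scale just below. *)
Lemma sparse_scales : exists kk : nat -> nat,
  [/\ forall j, (kk j < kk j.+1)%N, forall j, (0 < kk j)%N &
   forall i j k (y : R), (i <= j)%N -> ((kk j).-1 <= k)%N -> 0 < y -> (2 ^ k)%:R * y <= j%:R ->
   (\int[mu]_(x in `[0%R, 1%R])
      (`|int_delta (2 ^ k) x y (@lowfam R i) - int_muM (@lowfam R i)|)%:E <= ((2^-1) ^+ j)%:E)%E].
Proof.
have level j : exists k0, forall i k (y : R), (i <= j)%N -> (k0 <= k)%N -> 0 < y ->
   (2 ^ k)%:R * y <= j%:R -> (\int[mu]_(x in `[0%R, 1%R])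
      (`|int_delta (2 ^ k) x y (@lowfam R i) - int_muM (@lowfam R i)|)%:E <= ((2^-1) ^+ j)%:E)%E.
  suff [k0 H] : exists k0, forall i k (y : R), (i < j.+1)%N -> (k0 <= k)%N -> 0 < y ->
   (2 ^ k)%:R * y <= j%:R -> (\int[mu]_(x in `[0%R, 1%R])
      (`|int_delta (2 ^ k) x y (@lowfam R i) - int_muM (@lowfam R i)|)%:E <= ((2^-1) ^+ j)%:E)%E.
    by exists k0.
  elim: {1}j.+1 => [|m [k0 IH]]; first by exists 0%N.
  have e0 : 0 < (2^-1) ^+ j :> R by rewrite exprn_gt0// invr_gt0.
  have [bg gm gu] := @lowfam_nice R m.
  have [k1 H1] := L1_rate bg gm gu j%:R e0.
  exists (maxn k0 k1) => i k y; rewrite ltnS leq_eqVlt geq_max => /orP[/eqP ->|im] /andP[h0 h1].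
    exact: H1.
  exact: IH.
have [K0 H] := choice level.
pose kk := fix F j : nat := if j is j'.+1 then (maxn (F j') (K0 j)).+1 else (K0 0%N).+1.
exists kk; split=> [j|[|j]//|i j k y ij jk]; first by rewrite /= ltnS leq_maxl.
apply: H => //; apply: leq_trans jk; case: j {ij} => [//|j].
by rewrite /= leq_maxr.
Qed.

End scales.

Theorem theorem1p5 (R : realType) :
  exists N : set nat,
    (forall n, N n -> (0 < n)%N) /\
    (forall m : nat, exists n, N n /\ (m < n)%N) /\
    forall y : nat -> R,
      (forall n, (0 < n)%N -> 0 < y n) ->
      (exists C : R, forall n, (0 < n)%N ->
         y n <= C * (n%:R `^ (-2 + 4 * @theta R))) ->
      {ae @lebesgue_measure R, forall x : R, x \in `[0, 1[ ->
         forall f : R * R -> R, test_fun f ->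
           cvg_along N (fun n => int_delta n x (y n) f) (int_muM f) /\
           cvg_along N (fun n => int_delta_pr n x (y n) f) (int_muM f)}.
Proof.
have [kk [kkS kk0 kkI]] := sparse_scales R.
have kk_lt : {homo kk : i j / (i < j)%N} by exact: (homo_ltn ltn_trans kkS).
have kk_ge j : (j <= kk j)%N.
  by elim: j => // j IH; exact: leq_ltn_trans IH (kkS j).
exists [set (2 ^ kk j)%N | j in setT]; split; [|split].
- by move=> _ [j _ <-]; rewrite expn_gt0.
- move=> m; exists (2 ^ kk m)%N; split; first by exists m.
  by apply: leq_ltn_trans (kk_ge m) _; exact: ltn_expl.
move=> y y0 [C yC].
have C0 : 0 < C.
  by have := lt_le_trans (y0 1%N isT) (yC 1%N isT); rewrite powR1 mulr1.
pose Y j := y (2 ^ kk j)%N.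
have Y0 j : 0 < Y j by apply: y0; rewrite expn_gt0.
(* The value of theta enters here: the exponent is [-25/16], at most [-1], so [y n <= C / n]. *)
have YC j k : (k <= kk j)%N -> (2 ^ k)%:R * Y j <= C.
  move=> kj; apply: (@le_trans _ _ ((2 ^ kk j)%:R * Y j)).
    by rewrite ler_pM2r// ler_nat leq_exp2l.
  have p0 : 0 < (2 ^ kk j)%:R :> R by rewrite ltr0n expn_gt0.
  have p1 : 1 <= (2 ^ kk j)%:R :> R by rewrite ler1n expn_gt0.
  rewrite mulrC -ler_pdivlMr//; apply: le_trans (yC _ _) _; first by rewrite expn_gt0.
  rewrite ler_pM2l// -(powR_inv1 (ltW p0)); apply: ler_powR => //.
  by rewrite /theta; lra.
pose J := (Num.truncn C).+1.
have CJ j : (J <= j)%N -> C <= j%:R.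
  by move=> Jj; apply/ltW; apply: lt_le_trans (truncnS_gt C) _; rewrite ler_nat.
(* The shift [b] is 0 or 1: the scale of the set itself and the one below, both at the same height
   [Y j]. *)
pose u b i j x := `|int_delta (2 ^ (kk j - b)) x (Y j) (@lowfam R i) - int_muM (@lowfam R i)|.
have u_ae b i : (b <= 1)%N ->
    {ae @lebesgue_measure R, forall x, `[0%R, 1%R]%classic x -> u b i j x @[j --> \oo] --> (0 : R)}.
  move=> b1; apply: (@ae_cvg0 R (u b i) (maxn i J)) => [j|j x|j]; rewrite /u.
  - apply: measurableT_comp => //; apply: measurable_funB; last exact: measurable_cst.
    under eq_fun do rewrite int_deltaE.
    have [bg _ _] := @lowfam_nice R i.
    by apply: (@measurable_horocycle R (iter (kk j - b) (@Uop R) (@lowfam R i))); exact: (iterU_bm _ bg).1.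
  - exact: normr_ge0.
  - rewrite geq_max => /andP[ij Jj]; apply: kkI => //.
      by rewrite -subn1 leq_sub2l.
    by apply: le_trans (YC _ _ _) (CJ _ Jj); exact: leq_subr.
have : {ae @lebesgue_measure R, forall x i, `[0%R, 1%R]%classic x ->
    (u 0 i j x @[j --> \oo] --> (0 : R)) /\ (u 1 i j x @[j --> \oo] --> (0 : R))}.
  apply: ae_foralln => i.
  move: (u_ae 0%N i isT) (u_ae 1%N i isT); apply: filterS2.
    exact: (ae_filter_ringOfSetsType (@lebesgue_measure R)).
  move=> x h0 h1 x01.
  by split; [exact: h0|exact: h1].
apply: filterS; first exact: (ae_filter_ringOfSetsType (@lebesgue_measure R)).
move=> x ux x01 f tf.
have {}x01 : `[0%R, 1%R]%classic x by move: x01; rewrite /= !in_itv/= => /andP[-> /ltW].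
have along (F : nat -> R) : F (2 ^ kk j)%N @[j --> \oo] --> int_muM f ->
    cvg_along [set (2 ^ kk j)%N | j in setT] F (int_muM f).
  move=> /cvgrPdist_lt cF e e0; have [m _ Fm] := cF e e0.
  exists (2 ^ kk m)%N => _ [j _ <-]; rewrite leq_exp2l// => mj.
  rewrite distrC; apply: Fm => /=; rewrite leqNgt; apply/negP => /kk_lt.
  by rewrite ltnNge mj.
split; apply: along.
  apply: (@sandwich R (fun j => int_delta (2 ^ kk j) x (Y j))) => //.
  - by move=> j g h; exact: le_int_delta.
  - by move=> j g a c; apply: int_delta_affine; rewrite expn_gt0.
  move=> i; have [h0 _] := ux i x01; apply/cvgrPdist_le => e e0.
  move/cvgrPdist_le : h0 => /(_ e e0); apply: filterS => j.
  by rewrite sub0r normrN /u normr_id subn0 distrC.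
apply: (@sandwich R (fun j => int_delta_pr (2 ^ kk j) x (Y j))) => //.
- by move=> j g h; exact: le_int_delta_pr.
- by move=> j g a c; apply: int_delta_pr_affine; rewrite expn_gt0.
move=> i; have [h0 h1] := ux i x01; apply/cvgrPdist_le => e e0.
(* The primitive average is twice one average minus another, so the errors add up with weights
   [2 + 1]. *)
have e3 : 0 < e / 3 by rewrite divr_gt0.
move/cvgrPdist_le : h0 => /(_ _ e3) h0; move/cvgrPdist_le : h1 => /(_ _ e3) h1.
move: h0 h1; apply: filterS2 => j; rewrite !sub0r !normrN /u !normr_id subn0 subn1.
case: (kk j) (kk0 j) => // k _; rewrite int_delta_prE /= !ler_norml.
by move=> /andP[a1 a2] /andP[a3 a4]; apply/andP; split; lra.
Qed.
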